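(* Let $k\ge\ell\ge1$ be integers with $k+\ell\ge 6$. Then $\sup_G s_{k,\ell}(G)=\mathrm{OPT}(k,\ell)$, where the supremum is over all finite digraphs $G$.
   Context: Put $m=k+\ell$. Digraphs are finite, without loops; $xy$ denotes an arc from $x$ to $y$. The oriented star $S_{k,\ell}$ has a center $c$, a set $O$ of $k$ out-leaves and a set $I$ of $\ell$ in-leaves; its arcs are exactly $co$ ($o\in O$) and $ic$ ($i\in I$). For a digraph $G$ on $n$ vertices, let $\phi$ be a uniformly random map from $V(S_{k,\ell})$ to $V(G)$ (all $n^{m+1}$ maps equally likely), and let $\mathcal S$ be the set of maps $\phi$ that are isomorphisms from $S_{k,\ell}$ onto the induced subdigraph $G[\mathrm{Im}\,\phi]$ (in particular injective). Set $s_{k,\ell}(G)=\Pr[\phi\in\mathcal S]$. Define $\mathrm{OPT}(k,\ell)=2^{-2k}\max_{\alpha\in[0,1]}\{\alpha(1-\alpha)^{2k}+(1-\alpha)\alpha^{2k}\}$ if $k=\ell$, and, if $k>\ell$, $\mathrm{OPT}(k,\ell)=\max_{(\alpha,d)\in[0,\frac12]\times[0,\frac{k}{k+\ell}]}\{\alpha(1-\alpha)^{m}d^k(1-d)^\ell+\frac{(k-1)^{k-1}\ell^\ell}{(m-1)^{m-1}}(1-\alpha)\alpha^{m}(1-d)\}$. *)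

(* Defs.v *)
From HB Require Import structures.
From mathcomp Require Import all_boot all_order all_algebra.
From mathcomp Require Import classical_sets reals.
Set Implicit Arguments. Unset Strict Implicit. Unset Printing Implicit Defensive.
Import Order.TTheory GRing.Theory Num.Theory.
Local Open Scope ring_scope.
Local Open Scope classical_set_scope.

(* Vertices of the oriented star S_{k,l}:
   None = center c, Some (inl i) = out-leaf o_i, Some (inr j) = in-leaf i_j. *)
Definition star_vertex (k l : nat) : finType := option ('I_k + 'I_l).

Definition star_arc (k l : nat) (u v : star_vertex k l) : bool :=
  match u, v with
  | None, Some (inl _) => true
  | Some (inr _), None => true
  | _, _ => false
  end.

(* A digraph is a finite vertex type V with arc relation E (E x y = arc xy);
   looplessness is the hypothesis [irreflexive E].
   phi : V(S) -> V(G) is in \mathcal S iff it is injective and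
   E (phi u) (phi v) = star_arc u v for all u v (isomorphism onto the
   induced subdigraph on its image). *)
Definition star_copy (k l : nat) (V : finType) (E : rel V)
  (phi : {ffun star_vertex k l -> V}) : bool :=
  injectiveb phi && [forall u, forall v, E (phi u) (phi v) == star_arc u v].

(* s_{k,l}(G) = |S| / n^(m+1)  (uniform map from V(S_{k,l}) to V(G)). *)
Definition s_kl (R : realType) (k l : nat) (V : finType) (E : rel V) : R :=
  (#|[set phi : {ffun star_vertex k l -> V} | star_copy E phi]|)%:R
    / (#|V| ^ (k + l + 1))%:R.

(* OPT(k,l); the maxima are over compact sets of continuous functions, so they
   equal the suprema used here. Defined for k = l and for k > l. *)
Definition OPT (R : realType) (k l : nat) : R :=
  let m := (k + l)%N in
  if k == l then
    (2 ^+ (2 * k))^-1 *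
      sup [set x : R | exists a : R, 0 <= a <= 1 /\
             x = a * (1 - a) ^+ (2 * k) + (1 - a) * a ^+ (2 * k)]
  else
    sup [set x : R | exists a d : R, 0 <= a <= 2^-1 /\ 0 <= d <= k%:R / m%:R /\
           x = a * (1 - a) ^+ m * d ^+ k * (1 - d) ^+ l
             + ((k.-1 ^ k.-1 * l ^ l)%:R / (m.-1 ^ m.-1)%:R)
               * (1 - a) * a ^+ m * (1 - d)].

(* Main.v *)
(** Let M w be the mass of the maps sending the star onto an induced star, several out-leaves
    (or in-leaves) being allowed to coincide, when vertices carry weights w of total 1. On the
    simplex M has a maximizer w, whose value T dominates every s_{k,l}, and stationarity says
    that the stars through v have total mass (m + 1) T w(v). By AM-GM this forces every vertex
    of positive weight to have degree at least 17/20 (set A) or at most 11/25 (set B); then A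
    has weight alpha close to 1/(m + 1), and the vertices of B have weight at most 1/m of
    neighbours in B. Now split the stars by the sides of their center and leaves. Each adjacent pair in B
    destroys more stars centered in A with leaves in B than it creates elsewhere, so such pairs
    and the mixed stars only decrease the total, and for k > l
      T <= sum over a in A of w(a) (x^k y^l + gam (k-1) l alpha^(m-1) y),   x + y = 1 - alpha,
    where x is the weight of the out-neighbours of a in B; each bracket is bounded by OPT / alpha.
    Conversely the two terms of OPT are the masses of the stars centered on the two sides of a
    weighted bipartite digraph, regular thanks to a rotation of Z/n, together with a sink;
    blowing its vertices up into independent sets of sizes proportional to the weights gives
    digraphs approaching that mass. *)

Require Import Defs.
From HB Require Import structures.
From mathcomp Require Import all_boot all_order all_algebra.
From mathcomp Require Import ring lra zify.
Set Implicit Arguments. Unset Strict Implicit. Unset Printing Implicit Defensive.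
Import Order.TTheory GRing.Theory Num.Theory.
Local Open Scope ring_scope.

(** Letting leaves coincide makes the mass a homogeneous polynomial in the weights, so a maximizer
    exists and stationarity becomes an identity at each vertex; [gam k l] is the natural unit of
    mass. Unless T is already below OPT, the value of OPT near alpha = 1/(m + 1) forces the stars
    through a vertex to weigh at least [theta m] in this unit, per unit of weight, and the
    structural bounds are comparisons with [theta m] >= 5/14. At m = 6 the margins are thin, hence
    the exact evaluations there. The obstacle is l = 1. Two adjacent in-neighbours of a center then
    destroy no star, since there is only one in-leaf, so adjacent pairs among vertices of B pointing
    to almost all of A go unpunished. These vertices form [B2], controlled from two sides: nearly
    all stars through them use them as the in-leaf, so [B2] weighs little more than A; and as
    centers with leaves in A they fall short by a factor 2, having almost no in-neighbours in A.
    This shortfall pays for the stars inside [B2]. *)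

(** * Extremal constants and elementary inequalities *)

Section Constants.
Variable R : realFieldType.
Implicit Types (k l m n j : nat) (p q r s : R).

(* gam k l is the maximum of p^k q^l over p + q = 1, and 1 / Lam m that of D (1 - D)^(m-1). *)
Definition gam k l : R := k%:R ^+ k * l%:R ^+ l / (k + l)%:R ^+ (k + l).
Definition Lam m : R := m%:R ^+ m / m.-1%:R ^+ m.-1.
Definition theta m : R := (m%:R / m.+1%:R) ^+ m.

Lemma exprnn_gt0 n : 0 < n%:R ^+ n :> R.
Proof. by case: n => [|n]; rewrite ?expr0 ?ltr01 // exprn_gt0 ?ltr0n. Qed.

Lemma gam_gt0 k l : 0 < gam k l.
Proof. by rewrite divr_gt0 ?mulr_gt0 ?exprnn_gt0. Qed.

Lemma gam_ge0 k l : 0 <= gam k l. Proof. exact: ltW (gam_gt0 k l). Qed.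

Lemma gamC k l : gam k l = gam l k.
Proof. by rewrite /gam [X in X / _]mulrC addnC. Qed.

Lemma Lam_gt0 m : 0 < Lam m.
Proof. by rewrite divr_gt0 ?exprnn_gt0. Qed.

(** AM-GM for k copies of p/k and l copies of q/l. The cases k = 0 and l = 0, where these quotients
    make no sense, stand apart; there 0^0 = 1 gives [gam] the value 1. *)
Lemma amgm k l p q : 0 <= p -> 0 <= q ->
  p ^+ k * q ^+ l <= gam k l * (p + q) ^+ (k + l).
Proof.
move=> p0 q0.
case: k => [|k].
  rewrite /gam !expr0 !mul1r add0n divff ?gt_eqF ?exprnn_gt0 // mul1r.
  by rewrite lerXn2r ?nnegrE ?addr_ge0 ?lerDr // addr_ge0.
case: l => [|l].
  rewrite /gam !expr0 !mulr1 addn0 divff ?gt_eqF ?exprnn_gt0 // mul1r.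
  by rewrite lerXn2r ?nnegrE ?addr_ge0 ?lerDl // addr_ge0.
pose E (i : 'I_k.+1 + 'I_l.+1) := if i is inl _ then p / k.+1%:R else q / l.+1%:R.
have cardE : #|{: 'I_k.+1 + 'I_l.+1}| = (k.+1 + l.+1)%N by rewrite card_sum !card_ord.
have E0 i : 0 <= E i by rewrite /E; case: i => i; rewrite divr_ge0.
have /= := @leif_AGM_scaled R ('I_k.+1 + 'I_l.+1)%type predT E.
rewrite cardE => /(_ (fun i _ => mulrn_wge0 _ (E0 i))) [+ _].
rewrite !big_sumType /= !prodr_const !sumr_const !card_ord.
have divn (x : R) n : x / n.+1%:R *+ n.+1 = x by rewrite -[_ *+ n.+1]mulr_natr divfK ?pnatr_eq0.
rewrite !divn -[p / _ *+ _]mulr_natr -[q / _ *+ _]mulr_natr => h.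
rewrite /gam mulrAC ler_pdivlMr ?exprnn_gt0 //.
have := ler_wpM2l (ltW (mulr_gt0 (exprnn_gt0 k.+1) (exprnn_gt0 l.+1))) h.
apply: le_trans; rewrite !exprMn !exprVn exprD.
set a := k.+1%:R ^+ _; set b := l.+1%:R ^+ _.
have a0 : a != 0 by rewrite gt_eqF ?exprnn_gt0.
have b0 : b != 0 by rewrite gt_eqF ?exprnn_gt0.
set c := (k.+1 + l.+1)%:R ^+ k.+1; set d := (k.+1 + l.+1)%:R ^+ l.+1.
set e := p ^+ _; set f := q ^+ _.
suff -> : e * f * (c * d) = a * b * (e * a^-1 * c * (f * b^-1 * d)) by [].
by field; rewrite b0.
Qed.

Lemma amgm_le k l p q r : 0 <= p -> 0 <= q -> p + q <= r ->
  p ^+ k * q ^+ l <= gam k l * r ^+ (k + l).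
Proof.
move=> p0 q0 pqr; apply: le_trans (amgm _ _ p0 q0) _.
by rewrite ler_pM2l ?gam_gt0 // lerXn2r ?nnegrE ?addr_ge0 // (le_trans _ pqr) ?addr_ge0.
Qed.

(** Both sides share the factor l^l / (k + l - 1)^(k + l - 1); what remains is (k - 1)^(k - 1) <=
    k^(k - 1). Together with [gam_predr] it lets one constant serve out-leaves and in-leaves. *)
Lemma gam_pred k l : (0 < k)%N -> k%:R * gam k.-1 l <= Lam (k + l) * gam k l.
Proof.
case: k => // k _; rewrite /gam /Lam /= addSn /=.
have -> : (k + l).+1%:R ^+ (k + l).+1 / (k + l)%:R ^+ (k + l) *
  (k.+1%:R ^+ k.+1 * l%:R ^+ l / (k + l).+1%:R ^+ (k + l).+1) =
  k.+1%:R ^+ k.+1 * (l%:R ^+ l / (k + l)%:R ^+ (k + l)) :> R.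
  by field; rewrite !gt_eqF ?exprnn_gt0.
rewrite -[in leLHS]mulrA [leLHS]mulrA ler_pM2r ?divr_gt0 ?exprnn_gt0 //.
by rewrite exprS ler_pM2l ?ltr0n // lerXn2r ?nnegrE // ler_nat.
Qed.

Lemma gam_predr k l : (0 < l)%N -> l%:R * gam k l.-1 <= Lam (k + l) * gam k l.
Proof. by move=> l0; rewrite gamC [gam k l]gamC addnC gam_pred. Qed.

(* AM-GM for n copies of 1 + 1/n and 20 copies of 19/20, whose mean is 1. *)
Lemma euler_bound n : n.+1%:R ^+ n <= 14 / 5 * n%:R ^+ n :> R.
Proof.
have /= := @amgm n 20 n.+1%:R 19; rewrite /gam !ler0n => /(_ isT isT).
have -> : n.+1%:R + 19 = (n + 20)%:R :> R by rewrite -natrD addSnnS.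
rewrite divfK ?gt_eqF ?exprnn_gt0 // => h.
have h2 : 20 ^+ 20 <= 14 / 5 * 19 ^+ 20 :> R by lra.
have p0 : 0 < 19 ^+ 20 :> R by rewrite exprn_gt0.
rewrite -(ler_pM2r p0) (le_trans h) // mulrAC mulrC ler_pM2r ?exprnn_gt0 //.
Qed.

Lemma theta_ge m : 5 / 14 <= theta m.
Proof.
rewrite /theta expr_div_n ler_pdivlMr ?exprn_gt0 ?ltr0n //.
have := euler_bound m; lra.
Qed.

Lemma theta_gt0 m : 0 < theta m.
Proof. by have := theta_ge m; lra. Qed.

Lemma Lam_le m : (0 < m)%N -> Lam m <= 14 / 5 * m%:R.
Proof.
case: m => // m _; rewrite /Lam /= ler_pdivrMr ?exprnn_gt0 // exprS.
rewrite [leRHS](_ : _ = m.+1%:R * (14 / 5 * m%:R ^+ m)); last by ring.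
by rewrite ler_pM2l ?ltr0n // euler_bound.
Qed.

Lemma bernoulli n p : -1 <= p -> 1 + n%:R * p <= (1 + p) ^+ n.
Proof.
move=> p1; elim: n => [|n IH]; first by rewrite expr0 mul0r addr0.
rewrite exprS; apply: (@le_trans _ _ ((1 + p) * (1 + n%:R * p))).
  by rewrite mulrDl mul1r -natr1; have := mulr_ge0 (ler0n R n) (sqr_ge0 p); nra.
by apply: ler_wpM2l IH; lra.
Qed.

Lemma Lam_ge m : (1 < m)%N -> 2 * m%:R <= Lam m.
Proof.
case: m => // n n0; rewrite /Lam /= ler_pdivlMr ?exprnn_gt0 //.
have nz : n%:R != 0 :> R by rewrite pnatr_eq0 -lt0n.
have i0 : 0 <= n%:R^-1 :> R by rewrite invr_ge0.
have := @bernoulli n (n%:R^-1); rewrite mulfV // => /(_ _)/wrap [|h]; first lra.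
have e : n.+1%:R = (1 + n%:R^-1) * n%:R :> R by rewrite mulrDl mulVf // mul1r -natr1 addrC.
rewrite [n.+1%:R ^+ _]exprS {3}e exprMn.
have hh := ler_wpM2r (ltW (exprnn_gt0 n)) h.
have := ler_wpM2l (ler0n R n.+1) hh; lra.
Qed.

Lemma Lam_mul m D s : (0 < m)%N -> 0 <= D <= s -> Lam m * (D * (s - D) ^+ m.-1) <= s ^+ m.
Proof.
case: m => // m _ /andP[D0 Ds].
have sD : 0 <= s - D by rewrite subr_ge0.
have := amgm 1 m D0 sD.
rewrite expr1 [D + _]addrC subrK add1n => h.
have e : Lam m.+1 * gam 1 m = 1.
  by rewrite /Lam /gam /= expr1 mul1r add1n; field; rewrite !gt_eqF ?exprnn_gt0.
by rewrite -[leRHS]mul1r -e -mulrA ler_pM2l ?Lam_gt0.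
Qed.

(** The ratio c ((M + 1)/M)^j of consecutive terms decreases with M, so a check at m0 settles all m
    >= m0. Most numerical estimates below are reduced to m = 6 or m = 7 in this way. *)
Lemma pexp_dec j c m0 m : (0 < m0)%N -> 0 <= c -> c * m0.+1%:R ^+ j <= m0%:R ^+ j ->
  (m0 <= m)%N -> m%:R ^+ j * c ^+ m <= m0%:R ^+ j * c ^+ m0 :> R.
Proof.
move=> m00 c0 hc /subnK <-; elim: (m - m0)%N => [|n IH]; first by rewrite add0n.
apply: le_trans IH; rewrite addSn exprS mulrA ler_wpM2r ?exprn_ge0 // mulrC.
have p0 : 0 < m0%:R ^+ j :> R by rewrite exprn_gt0 ?ltr0n.
rewrite -(ler_pM2r p0) mulrAC; set M := (n + m0)%N.
have : m0%:R * M.+1%:R <= m0.+1%:R * M%:R :> R.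
  rewrite -!natrM ler_nat; rewrite /M; lia.
move/(@lerXn2r _ j _ _ _ _); rewrite !nnegrE -!natrM => /(_ (ler0n _ _) (ler0n _ _)).
rewrite !natrM !exprMn => h.
have := ler_wpM2l c0 h; have := ler_wpM2l (exprn_ge0 j (ler0n R M)) hc; lra.
Qed.

End Constants.

(** * Exclusion of intermediate degrees *)

Section DegreeDichotomy.
Variable R : realFieldType.
Implicit Types (k l m n j : nat) (p q r s : R).
Local Notation Lam := (@Lam R).
Local Notation theta := (@theta R).
Local Notation gam := (@gam R).

Lemma Lam6 : Lam 6 = 6 ^+ 6 / 5 ^+ 5.
Proof. by []. Qed.

Lemma theta6 : theta 6 = 6 ^+ 6 / 7 ^+ 6.
Proof. by rewrite /theta expr_div_n. Qed.

Lemma pexp_dec1 j (c : R) m0 m : (0 < m0)%N -> 0 < c -> c * m0.+1%:R ^+ j <= m0%:R ^+ j ->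
  (m0 <= m)%N -> m%:R ^+ j * c ^+ m.-1 <= m0%:R ^+ j * c ^+ m0.-1 :> R.
Proof.
move=> m00 c0 hc m0m; rewrite -(ler_pM2r c0) -!mulrA -!exprSr !prednK ?(leq_trans m00) //.
exact: pexp_dec m00 (ltW c0) hc m0m.
Qed.

Lemma lerX_le1 p m n : 0 <= p <= 1 -> (m <= n)%N -> p ^+ n <= p ^+ m.
Proof. by move=> /andP[p0 p1] mn; apply: ler_wiXn2l. Qed.

(** Interval bound: each factor takes its value at the worse endpoint, D and 1 - D being treated as
    independent. *)
Lemma seg_le m (D a b : R) : 0 <= a -> a <= D <= b -> b <= 1 ->
  D ^+ m + Lam m * (D * (1 - D) ^+ m.-1) <= b ^+ m + Lam m * (b * (1 - a) ^+ m.-1).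
Proof.
move=> a0 /andP[aD Db] b1.
apply: lerD; first by rewrite lerXn2r ?nnegrE; lra.
rewrite ler_pM2l ?Lam_gt0 // ler_pM ?exprn_ge0 //; try lra.
by rewrite lerXn2r ?nnegrE; lra.
Qed.

(** The condition a >= 1/8 makes m (1 - a)^(m - 1) nonincreasing from m = 7 on; 98/5 is 7 times the
    bound 14/5 on [Lam m] / m. *)
Lemma seg_le7 m (a b : R) : (7 <= m)%N -> 1 / 8 <= a -> 0 <= b -> a < 1 -> b <= 1 ->
  b ^+ m + Lam m * (b * (1 - a) ^+ m.-1) <= b ^+ 7 + 98 / 5 * (b * (1 - a) ^+ 6).
Proof.
move=> m7 a8 b0 a1 b1; apply: lerD; first by rewrite lerX_le1 ?b0.
have h : m%:R ^+ 1 * (1 - a) ^+ m.-1 <= 7%:R ^+ 1 * (1 - a) ^+ 6.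
  by apply: (@pexp_dec1 1 _ 7) => //; rewrite ?expr1; lra.
have L : Lam m <= 14 / 5 * m%:R by apply: Lam_le; lia.
have e0 : 0 <= b * (1 - a) ^+ m.-1 by rewrite mulr_ge0 ?exprn_ge0 //; lra.
apply: le_trans (ler_wpM2r e0 L) _; rewrite !expr1 in h.
have := ler_wpM2l b0 h; lra.
Qed.

(** In units of [gam k l] and per unit of weight, D^m bounds the stars centered at a vertex of
    degree D and the second term those having it as a leaf. The sum stays below [theta m] in the
    middle range, which is cut into five intervals short enough for [seg_le]. *)
Lemma dichotomy m (D : R) : (6 <= m)%N -> 0 <= D <= 1 ->
  theta m <= D ^+ m + Lam m * (D * (1 - D) ^+ m.-1) -> D <= 11 / 25 \/ 17 / 20 <= D.
Proof.
move=> m6 /andP[D0 D1] h.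
case: (leP D (11 / 25)) => Da; first by left.
case: (leP (17 / 20) D) => Db; first by right.
exfalso.
(* At m = 6 the exact values of [theta] and [Lam] are compared, because 5/14 is too weak on the
   first interval; it suffices for m >= 7. *)
have key (a b : R) : 1 / 8 <= a -> b <= 1 -> a <= D <= b ->
    b ^+ 6 + 6 ^+ 6 / 5 ^+ 5 * (b * (1 - a) ^+ 5) < 6 ^+ 6 / 7 ^+ 6 ->
    b ^+ 7 + 98 / 5 * (b * (1 - a) ^+ 6) < 5 / 14 -> False.
  move=> a8 b1 /andP[aD Db'] h6 h7.
  have a0 : 0 <= a by lra.
  have b0 : 0 <= b by lra.
  have aDb : a <= D <= b by rewrite aD.
  have hm := le_trans h (seg_le m a0 aDb b1).
  move: m6; rewrite leq_eqVlt => /orP[/eqP e|m7].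
    by move: hm; rewrite -e Lam6 theta6 /=; lra.
  have a1 : a < 1 by lra.
  by have := seg_le7 m7 a8 b0 a1 b1; have := @theta_ge R m; lra.
case: (leP D (23 / 50)) => D1'; first by apply: (key (11/25) (23/50)); rewrite ?D1' ?(ltW Da); lra.
case: (leP D (1 / 2)) => D2; first by apply: (key (23/50) (1/2)); rewrite ?D2 ?(ltW D1'); lra.
case: (leP D (3 / 5)) => D3; first by apply: (key (1/2) (3/5)); rewrite ?D3 ?(ltW D2); lra.
case: (leP D (3 / 4)) => D4; first by apply: (key (3/5) (3/4)); rewrite ?D4 ?(ltW D3); lra.
by apply: (key (3/4) (17/20)); rewrite ?(ltW D4) ?(ltW Db); lra.
Qed.

End DegreeDichotomy.

(** * Numerical bounds behind the two degree classes *)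

Section LowDegree.
Variable R : realFieldType.
Implicit Types (k l m n j : nat) (p q r s : R).
Local Notation Lam := (@Lam R).
Local Notation theta := (@theta R).
Local Notation gam := (@gam R).

Lemma invm_le m : (6 <= m)%N -> 0 < (m%:R^-1 : R) <= 6^-1.
Proof.
move=> m6; rewrite invr_gt0 ltr0n lef_pV2 ?posrE ?ltr0n ?ler_nat ?m6 ?andbT //; lia.
Qed.

(** 3/20 = 1 - 17/20 bounds the weight of the non-neighbours of a high-degree vertex, so [Lam m]
    (3/20)^(m - 1) measures the stars having such a vertex as a leaf. *)
Lemma Lam_delta m : (6 <= m)%N -> m%:R ^+ 2 * (Lam m * (3 / 20) ^+ m.-1) <= 1 / 20.
Proof.
move=> m6.
have h : m%:R ^+ 3 * (3 / 20) ^+ m.-1 <= 6%:R ^+ 3 * (3 / 20) ^+ 5 :> R.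
  by apply: (@pexp_dec1 R 3 _ 6) => //; lra.
have L : Lam m <= 14 / 5 * m%:R by apply: Lam_le; lia.
have p0 : 0 <= m%:R ^+ 2 * (3 / 20) ^+ m.-1 :> R.
  by apply: mulr_ge0; rewrite exprn_ge0 //; lra.
have := ler_wpM2r p0 L; lra.
Qed.

Lemma Lam_delta_le m : (6 <= m)%N -> m%:R * (Lam m * (3 / 20) ^+ m.-1) <= 1 / 120.
Proof.
move=> m6; have h := Lam_delta m6.
have m6' : 6 <= m%:R :> R by rewrite ler_nat.
have p0 : 0 <= Lam m * (3 / 20) ^+ m.-1.
  by rewrite mulr_ge0 ?exprn_ge0 ?ltW ?Lam_gt0 //; lra.
have := mulr_ge0 (ler0n R m) p0; nra.
Qed.

Lemma theta_delta m : (6 <= m)%N -> 7 / 20 <= theta m - 2 * (Lam m * (3 / 20) ^+ m.-1).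
Proof.
move=> m6; have h := Lam_delta_le m6.
have m6' : 6 <= m%:R :> R by rewrite ler_nat.
have p0 : 0 <= Lam m * (3 / 20) ^+ m.-1.
  by rewrite mulr_ge0 ?exprn_ge0 ?ltW ?Lam_gt0 //; lra.
have := theta_ge R m; nra.
Qed.

(** m/(m + 1) = (1 - 1/m)(1 + 1/(m^2 - 1)), and Bernoulli bounds the m-th power of the second factor
    below by 1 + 1/m. *)
Lemma theta_succ m : (1 < m)%N -> (1 - m%:R^-1) ^+ m * (1 + m%:R^-1) <= theta m.
Proof.
move=> m1; rewrite /theta.
have m2 : 2 <= m%:R :> R by rewrite ler_nat.
have mne : m%:R != 0 :> R by rewrite gt_eqF //; lra.
set x : R := m%:R in m2 mne *.
have xp : m.+1%:R = x + 1 by rewrite -natr1.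
have := @bernoulli R m ((x ^+ 2 - 1)^-1).
have d0 : 0 < x ^+ 2 - 1 by nra.
have i0 : 0 < (x ^+ 2 - 1)^-1 by rewrite invr_gt0.
move=> /(_ _)/wrap [|h]; first lra.
have -> : x / m.+1%:R = (1 - x^-1) * (1 + (x ^+ 2 - 1)^-1).
  by rewrite xp; field; apply/and3P; split=> //; rewrite gt_eqF //; lra.
rewrite exprMn; apply: ler_wpM2l.
  by rewrite exprn_ge0 // subr_ge0 invf_le1 //; lra.
apply: le_trans h; rewrite lerD2l -/x -[leLHS]mul1r ler_pdivlMr // -mulrA.
rewrite mul1r mulrC ler_pdivrMr; nra.
Qed.

(** For a low-degree vertex whose low-degree neighbours weigh v, the terms bound the stars it
    centers, those where it is a leaf of a high-degree center, and those where it is a leaf of a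
    low-degree center. Near v = 1/m the middle term almost reaches [theta m]; [theta_succ] supplies
    the gap. *)
Lemma low_degree m (v : R) : (6 <= m)%N -> m%:R^-1 <= v <= 11 / 25 ->
  (11 / 25) ^+ m + (1 - v) ^+ m + Lam m * (v * (11 / 25) ^+ m.-1) < theta m.
Proof.
move=> m6 /andP[mv v1].
have m_gt0 : (0 < m)%N by lia.
have m_gt1 : (1 < m)%N by lia.
have im := invm_le m6; case/andP: im => im0 im6.
have key (a b : R) : 0 <= a -> a <= v <= b ->
   (11 / 25) ^+ m + (1 - a) ^+ m + Lam m * (b * (11 / 25) ^+ m.-1) < theta m ->
   (11 / 25) ^+ m + (1 - v) ^+ m + Lam m * (v * (11 / 25) ^+ m.-1) < theta m.
  move=> a0 /andP[av vb]; apply: le_lt_trans; apply: lerD.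
    by rewrite lerD2l lerXn2r ?nnegrE //; lra.
  by rewrite ler_pM2l ?Lam_gt0 // ler_wpM2r ?exprn_ge0 //; lra.
case: (leP v (1 / 5)) => v5.
  apply: (key m%:R^-1 (1 / 5)); rewrite ?mv ?v5 ?(ltW im0) //.
  move: m6; rewrite leq_eqVlt => /orP[/eqP <-|m7]; first by rewrite Lam6 theta6 /=; lra.
  have h2 : m%:R ^+ 2 * (11 / 25) ^+ m.-1 <= 7%:R ^+ 2 * (11 / 25) ^+ 6 :> R.
    by apply: (@pexp_dec1 R 2 _ 7) => //; lra.
  have h1 : m%:R ^+ 1 * (11 / 25) ^+ m.-1 <= 7%:R ^+ 1 * (11 / 25) ^+ 6 :> R.
    by apply: (@pexp_dec1 R 1 _ 7) => //; lra.
  have L : Lam m <= 14 / 5 * m%:R by exact: Lam_le.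
  have t := theta_ge R m.
  have ts : (1 - m%:R^-1) ^+ m * (1 + m%:R^-1) <= theta m by exact: theta_succ.
  have -> : (11 / 25) ^+ m = 11 / 25 * (11 / 25) ^+ m.-1 :> R.
    by rewrite -exprS prednK.
  set X := (1 - _) ^+ m in ts *; set c := (11 / 25) ^+ m.-1 in h2 h1 *.
  have c0 : 0 <= c by rewrite exprn_ge0 //; lra.
  have m7' : 7 <= m%:R :> R by rewrite ler_nat.
  have Lc : Lam m * c <= 14 / 5 * m%:R * c by apply: ler_wpM2r.
  have mi : m%:R * m%:R^-1 = 1 :> R by rewrite mulfV //; lra.
  have ts' : X * (m%:R + 1) <= theta m * m%:R.
    have := ler_wpM2r (ler0n R m) ts.
    by rewrite -mulrA mulrDl mul1r mulVf ?lt0r_neq0 //; lra.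
  have mp : 0 < m%:R + 1 :> R by lra.
  rewrite -(ltr_pM2r mp).
  have Lc2 := ler_wpM2r (ltW mp) Lc.
  nra.
apply: (key (1 / 5) (11 / 25)); rewrite ?v1 ?(ltW v5) //; first lra.
move: m6; rewrite leq_eqVlt => /orP[/eqP <-|m7]; first by rewrite Lam6 theta6 /=; lra.
have h1 : m%:R ^+ 1 * (11 / 25) ^+ m.-1 <= 7%:R ^+ 1 * (11 / 25) ^+ 6 :> R.
  by apply: (@pexp_dec1 R 1 _ 7) => //; lra.
have h0 : (11 / 25) ^+ m <= (11 / 25) ^+ 7 :> R by apply: lerX_le1 => //; apply/andP; split; lra.
have h3 : (1 - 1 / 5) ^+ m <= (1 - 1 / 5) ^+ 7 :> R by apply: lerX_le1 => //; apply/andP; split; lra.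
have L : Lam m <= 14 / 5 * m%:R by exact: Lam_le.
have c0 : 0 <= (11 / 25) ^+ m.-1 :> R by rewrite exprn_ge0 //; lra.
have := ler_wpM2r c0 L; have := theta_ge R m; lra.
Qed.

Lemma Xinv_le j m : (j <= 6)%N -> (6 <= m)%N ->
  m%:R ^+ j * m%:R^-1 ^+ m <= 6^-1 ^+ (6 - j) :> R.
Proof.
move=> j6 m6; have /andP[i0 i6] := invm_le m6.
have -> : m%:R^-1 ^+ m = m%:R^-1 ^+ j * m%:R^-1 ^+ (m - j) :> R.
  by rewrite -exprD subnKC //; lia.
rewrite mulrA -exprMn mulfV ?expr1n ?mul1r; last by rewrite pnatr_eq0; lia.
apply: (@le_trans _ _ (6^-1 ^+ (m - j))); first by rewrite lerXn2r ?nnegrE; lra.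
by apply: lerX_le1; [apply/andP; split; lra | lia].
Qed.

(** In units of [gam k l], the last factor bounds the stars not centered in [A]; the inequality
    makes their mass at most T/(30 m), the defect in [al_ge]. *)
Lemma alpha_num m : (6 <= m)%N ->
  30 * m%:R * (m%:R + 1) * (Lam m * (3 / 20) ^+ m.-1 / m%:R + m%:R^-1 ^+ m) <= theta m.
Proof.
move=> m6; have h1 := Lam_delta m6; have h2 := @Xinv_le 2 m isT m6; have t := theta_ge R m.
have m6' : 6 <= m%:R :> R by rewrite ler_nat.
have p0 : 0 <= Lam m * (3 / 20) ^+ m.-1.
  by rewrite mulr_ge0 ?exprn_ge0 ?ltW ?Lam_gt0 //; lra.
have q0 : 0 <= m%:R^-1 ^+ m :> R by rewrite exprn_ge0 // invr_ge0 ler0n.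
have -> : 30 * m%:R * (m%:R + 1) * (Lam m * (3 / 20) ^+ m.-1 / m%:R + m%:R^-1 ^+ m) =
  30 * (m%:R + 1) * (Lam m * (3 / 20) ^+ m.-1) + 30 * m%:R * (m%:R + 1) * m%:R^-1 ^+ m.
  set e := m%:R^-1 ^+ m; field; lra.
have a1 : (m%:R + 1) * (Lam m * (3 / 20) ^+ m.-1) <= 7 / 36 * (1 / 20).
  apply: le_trans (_ : 7 / 36 * (m%:R ^+ 2 * (Lam m * (3 / 20) ^+ m.-1)) <= _); last lra.
  by rewrite [leRHS]mulrA; apply: ler_wpM2r => //; nra.
have a2 : m%:R * (m%:R + 1) * m%:R^-1 ^+ m <= 7 / 6 * (6^-1 ^+ (6 - 2)) :> R.
  apply: le_trans (_ : 7 / 6 * (m%:R ^+ 2 * m%:R^-1 ^+ m) <= _); last lra.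
  by rewrite [leRHS]mulrA; apply: ler_wpM2r => //; nra.
lra.
Qed.

(** On the right is the gain from each pair in A x B not joined by a single arc; on the left are the
    mixed stars such pairs allow and the correction they cause when adjacent pairs in B are
    counted. *)
Lemma mixed_num m : (6 <= m)%N ->
  Lam m * Lam m.-1 * (3 / 20) ^+ (m - 2) + 2 / m%:R * (7 / 20) <= 7 / 20.
Proof.
move=> m6; have /andP[i0 i6] := invm_le m6.
have L : Lam m <= 14 / 5 * m%:R by apply: Lam_le; lia.
have L' : Lam m.-1 <= 14 / 5 * m%:R.
  apply: le_trans (_ : 14 / 5 * m.-1%:R <= _); first by apply: Lam_le; lia.
  by rewrite ler_pM2l ?ler_nat ?leq_pred //; lra.
have LL : Lam m * Lam m.-1 <= 14 / 5 * m%:R * (14 / 5 * m%:R).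
  by apply: ler_pM => //; apply: ltW; apply: Lam_gt0.
have h : m%:R ^+ 2 * (3 / 20) ^+ m.-1 <= 6%:R ^+ 2 * (3 / 20) ^+ 5 :> R.
  by apply: (@pexp_dec1 R 2 _ 6) => //; lra.
have e : (3 / 20) ^+ m.-1 = 3 / 20 * (3 / 20) ^+ (m - 2) :> R.
  by rewrite -exprS; congr (_ ^+ _); lia.
rewrite e in h.
have c0 : 0 <= (3 / 20) ^+ (m - 2) :> R by rewrite exprn_ge0 //; lra.
have := ler_wpM2r c0 LL; lra.
Qed.

(** Per adjacent pair in B, the left side bounds the stars it creates and the right side those
    centered in A that it destroys. *)
Lemma kill_num m (al : R) : (6 <= m)%N -> 1 - (30 * m%:R)^-1 <= al * (m%:R + 1) ->
  (1 + Lam m) / 2 * m%:R^-1 ^+ m.-1 <= 7 / 20 * ((6 * (m%:R - 1))^-1 * al).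
Proof.
move=> m6 hal; have /andP[i0 i6] := invm_le m6.
have m6' : 6 <= m%:R :> R by rewrite ler_nat.
have L : Lam m <= 14 / 5 * m%:R by apply: Lam_le; lia.
have q0 : 0 <= m%:R^-1 ^+ m :> R by rewrite exprn_ge0 // invr_ge0 ler0n.
have -> : m%:R^-1 ^+ m.-1 = m%:R * m%:R^-1 ^+ m :> R.
  by rewrite -[in RHS](@prednK m) ?exprS ?mulrA ?mulfV ?mul1r ?prednK //; lia || lra.
have h2 := @Xinv_le 4 m isT m6.
have al0 : 179 / 180 <= al * (m%:R + 1).
  by apply: le_trans hal; rewrite invfM; lra.
have w0 : 0 < m%:R - 1 :> R by lra.
have w1 : 0 < m%:R + 1 :> R by lra.
rewrite [leRHS](_ : _ = 7 / 120 * (al * (m%:R + 1)) / ((m%:R - 1) * (m%:R + 1))); last by field; lra.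
rewrite ler_pdivlMr ?mulr_gt0 //.
apply: le_trans (_ : (3 / 2 * m%:R) * (m%:R * m%:R^-1 ^+ m) * ((m%:R - 1) * (m%:R + 1)) <= _).
  rewrite ler_wpM2r ?mulr_ge0 //; try lra.
  by rewrite ler_wpM2r ?mulr_ge0 //; lra.
set e := m%:R^-1 ^+ m in q0 h2 *.
apply: le_trans (_ : 3 / 2 * (m%:R ^+ 4 * e) <= _).
  have := mulr_ge0 (exprn_ge0 2 (ler0n R m)) q0; nra.
lra.
Qed.

End LowDegree.

(** * Weights of the leaf sets of a center *)

Section LeafWeights.
Variable R : realFieldType.
Implicit Types (k l m n j : nat) (p q r s : R).
Local Notation Lam := (@Lam R).
Local Notation theta := (@theta R).
Local Notation gam := (@gam R).

(** The half-plane is bounded by the tangent at (x0, y0) to the level curve of x^k y^l; AM-GM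
    applied to k x/x0 and l y/y0 keeps the product below that level. *)
Lemma amgm_point k l (x y x0 y0 : R) : (0 < k)%N -> (0 < l)%N -> 0 <= x -> 0 <= y -> 0 < x0 -> 0 < y0 ->
  k%:R * (x / x0) + l%:R * (y / y0) <= (k + l)%:R -> x ^+ k * y ^+ l <= x0 ^+ k * y0 ^+ l.
Proof.
move=> k0 l0 hx hy hx0 hy0 h.
have p0 : 0 <= k%:R * (x / x0) by rewrite mulr_ge0 ?divr_ge0 // ltW.
have q0 : 0 <= l%:R * (y / y0) by rewrite mulr_ge0 ?divr_ge0 // ltW.
have := amgm_le k l p0 q0 h; rewrite /gam divfK ?gt_eqF ?exprnn_gt0 //.
rewrite !exprMn mulrACA -[leRHS]mulr1 ler_pM2l ?mulr_gt0 ?exprnn_gt0 //.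
by rewrite !exprVn mulrACA -invfM ler_pdivrMr ?mul1r // mulr_gt0 ?exprn_gt0.
Qed.

(** For smaller y, even x = 1 gives a product of at most (14/25)^2 [gam k l], and (14/25)^2 <
    7/20. *)
Lemma ylow_ge2 k l (x y : R) : (2 <= l)%N -> (l <= k)%N -> (6 <= k + l)%N ->
  0 <= x <= 1 -> 0 <= y -> 7 / 20 * gam k l <= x ^+ k * y ^+ l ->
  2 / ((k + l)%:R * ((k + l)%:R - 1)) <= y.
Proof.
move=> l2 lk m6 /andP[x0 x1] y0; apply: contraLR; rewrite -!ltNge => hy.
set m := (k + l)%N in m6 hy *.
have m6' : 6 <= m%:R :> R by rewrite ler_nat.
have l2' : 2 <= l%:R :> R by rewrite ler_nat.
have k0 : 0 < k%:R :> R by rewrite ltr0n; lia.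
have i0 : 0 < k%:R^-1 :> R by rewrite invr_gt0.
(* (1 + l/k)^k <= (1 + 1/k)^(k l) <= (14/5)^l. *)
have mk : m%:R ^+ k <= (14 / 5) ^+ l * k%:R ^+ k :> R.
  have h1 : 1 + l%:R * k%:R^-1 <= (1 + k%:R^-1) ^+ l :> R.
    by apply: bernoulli; lra.
  have h2 : (m%:R / k%:R) ^+ k <= ((1 + k%:R^-1) ^+ k) ^+ l :> R.
    have z0 : 0 <= 1 + k%:R^-1 :> R by lra.
    rewrite -exprM mulnC exprM lerXn2r ?nnegrE ?divr_ge0 ?exprn_ge0 //.
    apply: le_trans h1.
    by rewrite /m natrD mulrDl mulfV ?gt_eqF.
  have h3 : (1 + k%:R^-1) ^+ k <= 14 / 5 :> R.
    rewrite -(ler_pM2r (exprnn_gt0 R k)) -exprMn mulrDl mulVf ?gt_eqF // mul1r natr1.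
    exact: euler_bound.
  have h4 : ((1 + k%:R^-1) ^+ k) ^+ l <= (14 / 5) ^+ l :> R.
    have z0 : 0 <= 1 + k%:R^-1 :> R by lra.
    by rewrite lerXn2r ?nnegrE ?exprn_ge0 //; lra.
  have := le_trans h2 h4; rewrite expr_div_n ler_pdivrMr ?exprnn_gt0 //.
have b0 : 0 <= 2 / (l%:R * (m%:R - 1)) :> R by rewrite divr_ge0 ?mulr_ge0 //; lra.
have b5 : 2 / (l%:R * (m%:R - 1)) <= 1 / 5 :> R.
  rewrite ler_pdivrMr ?mulr_gt0; nra.
have hyl : (y * m%:R) ^+ l <= (2 / (l%:R * (m%:R - 1))) ^+ l * l%:R ^+ l :> R.
  have u0 : 0 <= y * m%:R by rewrite mulr_ge0.
  have v0 := mulr_ge0 b0 (ler0n R l).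
  rewrite -exprMn lerXn2r ?nnegrE //.
  have -> : 2 / (l%:R * (m%:R - 1)) * l%:R = 2 / (m%:R * (m%:R - 1)) * m%:R :> R.
    by field; rewrite ?gt_eqF //; lra.
  by rewrite ler_wpM2r // ltW.
have e1 : ((2 / (l%:R * (m%:R - 1))) * (14 / 5)) ^+ l <= (14 / 25) ^+ 2 :> R.
  apply: le_trans (_ : (14 / 25) ^+ l <= _).
    by rewrite lerXn2r ?nnegrE; nra.
  by apply: ler_wiXn2l => //; lra.
have mm0 : 0 < m%:R ^+ m :> R by rewrite exprnn_gt0.
rewrite -(ltr_pM2r mm0) /gam -/m -[ltRHS]mulrA divfK ?gt_eqF //.
have -> : x ^+ k * y ^+ l * m%:R ^+ m = x ^+ k * (m%:R ^+ k * (y * m%:R) ^+ l).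
  by rewrite /m exprD exprMn; ring.
have g0 : 0 < k%:R ^+ k * l%:R ^+ l :> R by rewrite mulr_gt0 ?exprnn_gt0.
apply: le_lt_trans (_ : (14 / 25) ^+ 2 * (k%:R ^+ k * l%:R ^+ l) < _); last by rewrite ltr_pM2r //; lra.
apply: le_trans (_ : 1 * (((14 / 5) ^+ l * k%:R ^+ k) * ((2 / (l%:R * (m%:R - 1))) ^+ l * l%:R ^+ l)) <= _).
  have u0 : 0 <= y * m%:R by rewrite mulr_ge0.
  apply: ler_pM; [by rewrite exprn_ge0|by rewrite mulr_ge0 ?exprn_ge0|by rewrite exprn_ile1|].
  by apply: ler_pM; rewrite ?exprn_ge0.
rewrite mul1r mulrACA ler_pM2r // [X in X <= _]mulrC -exprMn; exact: e1.
Qed.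

(** With t = u/al this follows from (1 - t)^n (1 + n t) <= 1. In the application u is the weight of
    the neighbours of a vertex inside [A]: as extra centers they gain no more than their exclusion
    as leaves costs. *)
Lemma T1_num n (y al u : R) : (0 < n)%N -> 0 <= u <= al -> al / n%:R <= y ->
  (y + u) * (al - u) ^+ n <= y * al ^+ n.
Proof.
move=> n0 /andP[u0 ual] hy.
have np : 0 < n%:R :> R by rewrite ltr0n.
have [al0|al_gt0] := leP al 0.
  have -> : u = 0 by lra.
  by rewrite addr0 subr0.
have hy' : al <= y * n%:R by rewrite -ler_pdivrMr.
set t := u / al.
have ut : u = t * al by rewrite divfK ?gt_eqF.
have t0 : 0 <= t by rewrite divr_ge0 // ltW.
have t1 : t <= 1 by rewrite ler_pdivrMr // mul1r.
have t_1 : -1 <= t by lra.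
have b := bernoulli n t_1.
have c1 : (1 - t) ^+ n * (1 + n%:R * t) <= 1.
  apply: le_trans (_ : (1 - t) ^+ n * (1 + t) ^+ n <= _).
    by rewrite ler_wpM2l ?exprn_ge0 //; lra.
  by rewrite -exprMn exprn_ile1 //; nra.
have -> : al - u = al * (1 - t) by rewrite ut; ring.
have y0 : 0 <= y by nra.
set X := (1 - t) ^+ n in c1 *.
have X0 : 0 <= X by rewrite exprn_ge0 //; lra.
suff h : (y + u) * X <= y.
  by have := ler_wpM2l (exprn_ge0 n (ltW al_gt0)) h; rewrite exprMn -/X; lra.
have h1 : y + u <= y * (1 + n%:R * t) by rewrite ut; nra.
by have := ler_wpM2r X0 h1; have := ler_wpM2l y0 c1; lra.
Qed.

End LeafWeights.

(** * Numerical bounds for a single in-leaf *)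

Section TailBounds.
Variable R : realFieldType.
Implicit Types (k l m n j : nat) (p q r s : R).
Local Notation Lam := (@Lam R).
Local Notation theta := (@theta R).
Local Notation gam := (@gam R).

(** For l = 1 the estimate x <= 1 is too lossy; x + y <= b is used instead, where the bound on b
    will come from the lower bound on the weight of [A]. *)
Lemma ylow1 k (x y b : R) : (5 <= k)%N -> 0 <= x -> 0 <= y -> x + y <= b ->
  b * (k%:R + 2) <= k%:R + 1 + (30 * (k%:R + 1))^-1 ->
  7 / 20 * gam k 1 <= x ^+ k * y -> 2 / ((k%:R + 1) * k%:R) <= y.
Proof.
move=> k5 x0 y0 xyb hb; apply: contraLR; rewrite -!ltNge => hy.
have e1 : gam k 1 = k%:R ^+ k / k.+1%:R ^+ k.+1 by rewrite /gam expr1 mulr1 addn1.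
have aux (x1 y1 : R) : 0 < x1 -> 0 < y1 -> k%:R * (x / x1) + 1 * (y / y1) <= (k + 1)%:R ->
    x1 ^+ k * y1 < 7 / 20 * gam k 1 -> x ^+ k * y < 7 / 20 * gam k 1.
  move=> x1p y1p h; apply: le_lt_trans; rewrite -(expr1 y) -(expr1 y1).
  by apply: amgm_point => //; lia.
have k5' : 5 <= k%:R :> R by rewrite ler_nat.
have hy' : y * ((k%:R + 1) * k%:R) < 2 by rewrite -ltr_pdivlMr // mulr_gt0; lra.
have i180 : (30 * (k%:R + 1))^-1 <= 180^-1 :> R by rewrite lef_pV2 ?posrE; lra.
move: (k5); rewrite leq_eqVlt => /orP[/eqP ek|k6].
  (* The second coordinate is 2/(k (k + 1)), the first a fraction just above the largest possible b
     minus the second; likewise for k = 6. *)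
  subst k; apply: (aux (4 / 5) (1 / 15)); rewrite ?e1; lra.
move: (k6); rewrite leq_eqVlt => /orP[/eqP ek|k7].
  subst k; apply: (aux (5 / 6) (1 / 21)); rewrite ?e1; lra.
have k7' : 7 <= k%:R :> R by rewrite ler_nat.
have kp : 0 < k%:R :> R by lra.
rewrite e1 -[k.+1%:R]natr1; set K : R := k%:R in k7' kp hb hy *.
(* Since (K + 1)^2 = K (K + 2) + 1, the bound on b barely exceeds K/(K + 1). The excess costs at
   most a factor 113/100 in x^k, and 113/100 * 2/7 < 7/20. *)
have b1 : b <= (1 + (31 / 30) / (K * (K + 2))) * (K / (K + 1)).
  rewrite (_ : (1 + (31 / 30) / (K * (K + 2))) * (K / (K + 1)) = (K + 1 + (30 * (K + 1))^-1) / (K + 2)).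
    by rewrite ler_pdivlMr //; lra.
  by field; rewrite ?gt_eqF //; lra.
set d := (31 / 30) / (K * (K + 2)) in b1.
have d0 : 0 < d by rewrite divr_gt0 ?mulr_gt0 //; lra.
have Kd : K * d <= 31 / 270.
  have -> : K * d = (31 / 30) / (K + 2) by rewrite /d; field; rewrite ?gt_eqF //; lra.
  by rewrite ler_pdivrMr; lra.
have d1 : d <= 1 by nra.
have hd : (1 + d) ^+ k <= 113 / 100.
  have b2 : 1 + K * - d <= (1 + - d) ^+ k by apply: bernoulli; lra.
  have b3 : (1 + d) ^+ k * (1 - d) ^+ k <= 1.
    have dd : 0 <= d * d by rewrite mulr_ge0 // ltW.
    have dd1 : d * d <= 1 * 1 by apply: ler_pM => //; exact: ltW.
    by rewrite -exprMn exprn_ile1 //; clear -dd dd1; lra.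
  have p0 : 0 <= (1 + d) ^+ k by rewrite exprn_ge0 //; clear -d0; lra.
  by have := ler_wpM2l p0 b2; clear -p0 b3 Kd; nra.
have xk : x ^+ k <= 113 / 100 * (K / (K + 1)) ^+ k.
  have q0 : 0 <= K / (K + 1) by rewrite divr_ge0; clear -k7'; lra.
  apply: le_trans (_ : ((1 + d) * (K / (K + 1))) ^+ k <= _).
    have r0 : 0 <= (1 + d) * (K / (K + 1)) by apply: mulr_ge0 => //; clear -d0; lra.
    by rewrite lerXn2r ?nnegrE // (le_trans _ b1) //; clear -x0 y0 xyb; lra.
  by rewrite exprMn ler_wpM2r ?exprn_ge0.
have y1 : y <= 2 / 7 / (K + 1).
  apply: ltW; apply: lt_le_trans hy _.
  rewrite ler_pdivrMr ?mulr_gt0 //; last by clear -kp; lra.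
  by rewrite [leRHS](_ : _ = 2 / 7 * K); [clear -k7'; lra | field; clear -k7'; lra].
have Y : 0 < (K / (K + 1)) ^+ k by rewrite exprn_gt0 // divr_gt0 //; clear -kp; lra.
apply: le_lt_trans (_ : 113 / 100 * (K / (K + 1)) ^+ k * (2 / 7 / (K + 1)) < _).
  by apply: ler_pM => //; rewrite exprn_ge0.
have -> : K ^+ k / (K + 1) ^+ k.+1 = (K / (K + 1)) ^+ k / (K + 1).
  by rewrite expr_div_n exprS invfM mulrA mulrAC.
have Y1 : 0 < (K / (K + 1)) ^+ k / (K + 1) by rewrite divr_gt0 //; clear -kp; lra.
rewrite [ltLHS](_ : _ = 113 / 350 * ((K / (K + 1)) ^+ k / (K + 1))); last by field; clear -k7'; lra.
by clear -Y1; lra.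
Qed.

(** Here q <= al/(6 (n + 1)), while 1/(6 (n + 1)) <= [gam n 1] / 2 because 5/28 > 1/6. The result is
    half of what AM-GM gives for all leaves but one. *)
Lemma slack_num n (al p q : R) : (4 <= n)%N -> 0 <= q -> p + q <= al -> 0 <= al ->
  (1 - (6 * (n%:R + 1))^-1) * al <= p ->
  p ^+ n.+1 * q <= gam n 1 / 2 * al ^+ n.+1 * p.
Proof.
move=> n4 q0 pq al0 hp.
have n4' : 4 <= n%:R :> R by rewrite ler_nat.
have i1 : (6 * (n%:R + 1))^-1 <= 30^-1 :> R by rewrite lef_pV2 ?posrE; lra.
have p0 : 0 <= p by nra.
have pa : p <= al by lra.
have q1 : q <= (6 * (n%:R + 1))^-1 * al by lra.
have h1 : p ^+ n * q <= al ^+ n * ((6 * (n%:R + 1))^-1 * al).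
  by apply: ler_pM => //; rewrite ?exprn_ge0 // lerXn2r ?nnegrE.
have e1 : gam n 1 = n%:R ^+ n / n.+1%:R ^+ n.+1 by rewrite /gam expr1 mulr1 addn1.
have g1 : (6 * (n%:R + 1))^-1 <= gam n 1 / 2.
  rewrite e1; have := theta_ge R n; rewrite /theta expr_div_n => t.
  have -> : n%:R ^+ n / n.+1%:R ^+ n.+1 = (n%:R ^+ n / n.+1%:R ^+ n) / n.+1%:R :> R.
    by rewrite exprSr invfM mulrA.
  set X := n%:R ^+ n / _ in t *; rewrite -[n.+1%:R]natr1 invfM.
  have w : 0 < (n%:R + 1)^-1 :> R by rewrite invr_gt0; lra.
  nra.
rewrite exprSr -mulrA [p * q]mulrC mulrA ler_wpM2r // (le_trans h1) // exprSr.
have a1 : 0 <= al ^+ n * al by rewrite mulr_ge0 ?exprn_ge0.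
have := ler_wpM2r a1 g1; lra.
Qed.

Lemma tail_rest m (r := (6 * m%:R - 7)^-1 + Lam m * (m%:R^-1 * (2 / m%:R) ^+ m.-1)
     + (2 / m%:R) ^+ m : R) : (6 <= m)%N ->
  0 <= r /\ m%:R * r <= 6 / 29 + 14 / 5 * (2 / 81) + 2 / 243.
Proof.
move=> m6; have m0 : (0 < m)%N by lia.
have e2 : (m.-1 = m.-2.+1)%N by lia.
have e4 : (4 <= m.-2)%N by lia.
have m6' : 6 <= m%:R :> R by rewrite ler_nat.
have mp : 0 < m%:R :> R by lra.
have L := @Lam_le R m m0.
have i3 : 2 / m%:R <= 3^-1 :> R by rewrite ler_pdivrMr //; lra.
have i0 : 0 <= 2 / m%:R :> R by rewrite divr_ge0.
have c2 : m%:R * (2 / m%:R) ^+ m.-1 <= 2 / 81 :> R.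
  have -> : m%:R * (2 / m%:R) ^+ m.-1 = 2 * (2 / m%:R) ^+ m.-2 :> R.
    by rewrite e2 exprS mulrA [m%:R * _]mulrC divfK ?gt_eqF.
  have : (2 / m%:R) ^+ m.-2 <= (3^-1) ^+ m.-2 :> R.
    by rewrite lerXn2r ?nnegrE // invr_ge0.
  have : (3^-1) ^+ m.-2 <= (3^-1) ^+ 4 :> R by apply: lerX_le1 => //; apply/andP; split; lra.
  lra.
have c1 : 0 <= (2 / m%:R) ^+ m.-1 :> R by rewrite exprn_ge0.
have c3 : m%:R * (2 / m%:R) ^+ m <= 2 / 243 :> R.
  by rewrite -[X in _ ^+ X](prednK m0) exprS; nra.
have d0 : 0 < 6 * m%:R - 7 :> R by lra.
split.
  have L0 := ltW (Lam_gt0 R m).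
  by rewrite /r !addr_ge0 ?mulr_ge0 ?invr_ge0 ?exprn_ge0 ?(ltW d0) // ltW.
rewrite /r !mulrDr; apply: lerD => //; apply: lerD; first by rewrite ler_pdivrMr //; lra.
rewrite mulrCA [m%:R * _]mulrA mulfV ?gt_eqF // mul1r.
have := ler_wpM2r c1 L; lra.
Qed.

(** This 17/20 is not the degree threshold: it is chosen so that 17/20 - 1/30, times 5/14, exceeds
    the bound on m r in [tail_rest]; the 1/30 is the defect in the weight of [A]. *)
Lemma tail_pow m : (6 <= m)%N ->
  1 <= Lam m / 4 * (1 - (6 * (m%:R - 1))^-1) * (1 - 17 / 20 * m%:R^-1) ^+ m.
Proof.
move=> m6; have m0 : (0 < m)%N by lia.
have m1 : (1 < m)%N by lia.
have m6' : 6 <= m%:R :> R by rewrite ler_nat.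
have mp : 0 < m%:R :> R by lra.
have L2 := @Lam_ge R m m1.
have i6 : m%:R^-1 <= 6^-1 :> R by rewrite lef_pV2 ?posrE //; lra.
have ip : 0 < m%:R^-1 :> R by rewrite invr_gt0.
have q0 : 0 <= 1 - 17 / 20 * m%:R^-1 :> R by lra.
have i1 : (6 * (m%:R - 1))^-1 <= 30^-1 :> R by rewrite lef_pV2 ?posrE; lra.
have b1 : 29 / 60 * m%:R <= Lam m / 4 * (1 - (6 * (m%:R - 1))^-1) by nra.
apply: le_trans (ler_wpM2r (exprn_ge0 m q0) b1).
move: (m6); rewrite leq_eqVlt => /orP[/eqP e|m7]; first by rewrite -e; lra.
have m7' : 7 <= m%:R :> R by rewrite ler_nat.
have t1 : (1 - m%:R^-1) * (5 / 14) <= (1 - m%:R^-1) ^+ m :> R.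
  rewrite -[X in _ ^+ X](prednK m0) exprS ler_wpM2l //; first by clear -i6; lra.
  have := theta_ge R m.-1; rewrite /theta prednK //.
  have pm : m.-1%:R = m%:R - 1 :> R by rewrite -[in RHS](prednK m0) -natr1 addrK.
  by rewrite pm mulrBl mulfV ?mul1r // gt_eqF.
have t2 : (1 - m%:R^-1) ^+ m <= (1 - 17 / 20 * m%:R^-1) ^+ m :> R.
  by clear -i6 ip; rewrite lerXn2r ?nnegrE //; lra.
have t3 : m%:R * (1 - m%:R^-1) = m%:R - 1 :> R by rewrite mulrBr mulr1 mulfV ?gt_eqF.
have := ler_wpM2l (ltW mp) (le_trans t1 t2).
rewrite mulrA t3; clear -m7'; lra.
Qed.

(** s will be the weight of [B2]. It exceeds al by a factor 1 + O(1/m) at most, whose m-th power is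
    absorbed by [Lam m] / 4. *)
Lemma tail_num m (al s t : R) : (6 <= m)%N -> 0 <= s -> 0 <= al -> theta m <= t ->
  s * (m%:R + 1) * (t - ((6 * m%:R - 7)^-1 + Lam m * (m%:R^-1 * (2 / m%:R) ^+ m.-1)
     + (2 / m%:R) ^+ m)) <= t ->
  1 - (30 * m%:R)^-1 <= al * (m%:R + 1) ->
  s ^+ m <= Lam m / 4 * (1 - (6 * (m%:R - 1))^-1) * al ^+ m.
Proof.
move=> m6 s0 al0 tt hs hal; have [r0 mr] := tail_rest m6; have big := tail_pow m6.
set r := _ + _ + _ in hs r0 mr; clearbody r.
have m6' : 6 <= m%:R :> R by rewrite ler_nat.
have mp : 0 < m%:R :> R by lra.
have Th := theta_ge R m; have tp : 0 < t by lra.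
have ip : 0 < m%:R^-1 :> R by rewrite invr_gt0.
have i6 : m%:R^-1 <= 6^-1 :> R by rewrite lef_pV2 ?posrE.
have i30 : (30 * m%:R)^-1 = 30^-1 * m%:R^-1 :> R by rewrite invfM.
have im : m%:R * m%:R^-1 = 1 :> R by rewrite mulfV // gt_eqF.
(* s (m+1) <= t/(t-r) while al (m+1) >= 1 - 1/(30m), hence s (1 - 17/(20m)) <= al *)
have key : s * (1 - 17 / 20 * m%:R^-1) <= al.
  have w : 0 < m%:R + 1 :> R by rewrite addr_gt0.
  rewrite -(ler_pM2r w); apply: le_trans hal.
  have rt : r <= (17 / 20 - 1 / 30) * m%:R^-1 * t.
    rewrite -(ler_pM2l mp); apply: le_trans mr _.
    rewrite [leRHS](_ : _ = (17 / 20 - 1 / 30) * t); first by clear -tt Th; lra.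
    by rewrite mulrA [m%:R * _]mulrCA im mulr1.
  rewrite i30 mulrAC; set S := s * (m%:R + 1) in hs *; set v := m%:R^-1 in i6 ip rt *.
  have S0 : 0 <= S by rewrite mulr_ge0 // ltW.
  have h1 : S * (1 - (17 / 20 - 1 / 30) * v) <= 1.
    rewrite -(ler_pM2r tp) [leRHS]mul1r; apply: le_trans hs.
    by have := ler_wpM2l S0 rt; clear; lra.
  have h2 : S * (1 - 17 / 20 * v) <= S * (1 - (17 / 20 - 1 / 30) * v) * (1 - 30^-1 * v).
    by rewrite -[leRHS]mulrA; apply: ler_wpM2l => //; clear -ip; nra.
  have h3 : S * (1 - (17 / 20 - 1 / 30) * v) * (1 - 30^-1 * v) <= 1 * (1 - 30^-1 * v).
    by apply: ler_wpM2r => //; clear -i6; lra.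
  by rewrite -[leRHS]mul1r; exact: le_trans h2 h3.
have k2 : (s * (1 - 17 / 20 * m%:R^-1)) ^+ m <= al ^+ m.
  by rewrite lerXn2r ?nnegrE ?mulr_ge0 //; clear -i6; lra.
have f0 : 0 <= Lam m / 4 * (1 - (6 * (m%:R - 1))^-1).
  apply: mulr_ge0; first exact: divr_ge0 (ltW (Lam_gt0 R m)) _.
  by rewrite subr_ge0 invf_le1; clear -m6'; lra.
have := ler_wpM2l f0 k2; apply: le_trans.
by rewrite exprMn mulrCA -[leLHS]mulr1; apply: ler_wpM2l => //; exact: exprn_ge0.
Qed.

End TailBounds.

(** * Mass of stars under vertex weights *)

Lemma prod_option (R : comNzRingType) (T : finType) (F : option T -> R) :
  \prod_u F u = F None * \prod_t F (Some t).
Proof.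
rewrite (bigD1 None) //=; congr (_ * _).
rewrite (reindex_omap Some id) /=; last by case.
by apply: eq_bigl => t; rewrite eqxx.
Qed.

Section StarMass.
Variables (R : realFieldType) (k l : nat) (V : finType) (E : rel V) (w : V -> R).
Hypothesis w_ge0 : forall x, 0 <= w x.
Local Notation leaf := ('I_k + 'I_l)%type.
Local Notation star := {ffun star_vertex k l -> V}.
Implicit Types (phi : star) (P Q : pred star) (A S Z : pred V) (t : leaf) (c v x : V).

(** A digraph may contain both arcs between two vertices. Such vertices are adjacent, yet neither is
    an out- or in-neighbour of the other in the sense of induced stars. *)
Definition out c x := E c x && ~~ E x c.
Definition inn c x := E x c && ~~ E c x.
Definition adj x y := E x y || E y x.
Definition nb c t : pred V := if t is inl _ then out c else inn c.

(* Unlike star_copy, several out-leaves (or several in-leaves) may share a vertex. *)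
Definition valid phi := [forall u, forall v, E (phi u) (phi v) == star_arc u v].
Definition mass phi := \prod_u w (phi u).
Definition M P := \sum_(phi | valid phi && P phi) mass phi.
Definition wt A := \sum_(x | A x) w x.

Lemma wtE A : wt A = \sum_(x | A x) w x. Proof. by []. Qed.

Lemma mass_ge0 phi : 0 <= mass phi. Proof. exact: prodr_ge0. Qed.
Lemma M_ge0 P : 0 <= M P. Proof. by apply: sumr_ge0 => *; exact: mass_ge0. Qed.
Lemma wt_ge0 A : 0 <= wt A. Proof. exact: sumr_ge0. Qed.

Lemma adjC x y : adj x y = adj y x. Proof. by rewrite /adj orbC. Qed.

Lemma valid_arc phi u u' : valid phi -> E (phi u) (phi u') = star_arc u u'.
Proof. by move=> /forallP /(_ u) /forallP /(_ u') /eqP. Qed.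

Lemma valid_nb phi t : valid phi -> nb (phi None) t (phi (Some t)).
Proof. by move=> h; case: t => i; rewrite /nb /out /inn !valid_arc. Qed.

Lemma valid_nadj phi t t' : valid phi -> ~~ adj (phi (Some t)) (phi (Some t')).
Proof. by move=> h; rewrite /adj !valid_arc //; case: t t' => i [j|j]. Qed.

Lemma nb_adj c t x : nb c t x -> adj c x.
Proof. by case: t => i; rewrite /nb /out /inn /adj => /andP[-> _]; rewrite ?orbT. Qed.

Lemma eq_M P Q : (forall phi, valid phi -> P phi = Q phi) -> M P = M Q.
Proof. by move=> h; apply: eq_bigl => phi; case: (boolP (valid phi)) => //= /h. Qed.

Lemma le_M P Q : (forall phi, valid phi -> P phi -> Q phi) -> M P <= M Q.
Proof.
move=> h; rewrite /M [leRHS]big_mkcond [leLHS]big_mkcond; apply: ler_sum => phi _.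
case: (boolP (valid phi)) => //= hv; case: (boolP (P phi)) => [/(h _ hv) ->//|_].
by case: ifP => // _; exact: mass_ge0.
Qed.

Lemma M_part (I : finType) (f : star -> I) P :
  M P = \sum_i M [pred phi : star | P phi && (f phi == i)].
Proof.
rewrite /M (partition_big f xpredT) //=; apply: eq_bigr => i _.
by apply: eq_bigl => phi; rewrite andbA.
Qed.

Lemma M_part_in (I : finType) (f : star -> I) (D : pred I) P :
  (forall phi, valid phi -> P phi -> D (f phi)) ->
  M P = \sum_(i | D i) M [pred phi : star | P phi && (f phi == i)].
Proof.
move=> h; rewrite (M_part f) [RHS]big_mkcond /=; apply: eq_bigr => i _.
case: ifP => // Di; rewrite /M big1 // => phi /and3P[hv hP /eqP e].
by move: (h _ hv hP); rewrite e Di.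
Qed.

Lemma M_exists (I : finType) (D : pred I) (Q : I -> pred star) P :
  (forall phi, valid phi -> P phi -> exists2 i, D i & Q i phi) ->
  M P <= \sum_(i | D i) M (Q i).
Proof.
move=> h; rewrite /M (exchange_big_dep predT) //= big_mkcond /=.
apply: ler_sum => phi _; case: ifP => [/andP[hv hP]|_]; last first.
  by apply: sumr_ge0 => *; exact: mass_ge0.
have [i Di Qi] := h _ hv hP.
rewrite (bigD1 i) ?hv ?Di //= lerDl; apply: sumr_ge0 => *; exact: mass_ge0.
Qed.

Lemma M_or P Q1 Q2 : (forall phi, valid phi -> P phi -> Q1 phi || Q2 phi) ->
  M P <= M Q1 + M Q2.
Proof.
move=> h; have := @M_exists bool predT (fun b => if b then Q1 else Q2) P.
rewrite big_bool; apply=> phi hv /(h _ hv) /orP[q|q]; by [exists true|exists false].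
Qed.

(** Expanded by distributivity, the product on the right is the sum over all maps sending each u
    into [G u], valid or not; the stars of P are among them. *)
Lemma M_prod (G : star_vertex k l -> pred V) P :
  (forall phi, valid phi -> P phi -> forall u, G u (phi u)) ->
  M P <= wt (G None) * \prod_t wt (G (Some t)).
Proof.
move=> h; rewrite -(prod_option (fun u => wt (G u))).
under eq_bigr do rewrite /wt big_mkcond.
rewrite bigA_distr_bigA /= /M big_mkcond /=; apply: ler_sum => phi _.
have nn : 0 <= \prod_u (if G u (phi u) then w (phi u) else 0).
  by apply: prodr_ge0 => u _; case: ifP.
case: ifP => // /andP[hv hP]; rewrite /mass.
by under eq_bigr => u _ do rewrite -[w _]/(if true then _ else 0) -(h _ hv hP u).
Qed.

Lemma wt_pred1 v : wt (pred1 v) = w v.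
Proof. by rewrite /wt big_pred1_eq. Qed.

Lemma le_wt A S : (forall x, A x -> S x) -> wt A <= wt S.
Proof.
move=> h; rewrite /wt [leRHS]big_mkcond [leLHS]big_mkcond; apply: ler_sum => x _.
by case: (boolP (A x)) => [/h -> //|_]; case: ifP.
Qed.

Lemma wtID A S : wt A = wt [predI A & S] + wt [predI A & [predC S]].
Proof. by rewrite /wt (bigID S). Qed.

Lemma eq_wt A S : A =1 S -> wt A = wt S.
Proof. by move=> h; apply: eq_bigl. Qed.

Lemma le_wtD A S Z : (forall x, Z x -> A x || S x) -> wt Z <= wt A + wt S.
Proof.
move=> h; rewrite (wtID Z A); apply: lerD; apply: le_wt => x /andP[] //= + nA.
by move=> /h /orP[hA|//]; case/negP: nA.
Qed.

Lemma wt_disjoint A S Z : (forall x, A x -> Z x) -> (forall x, S x -> Z x) ->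
  (forall x, A x -> S x -> False) -> wt A + wt S <= wt Z.
Proof.
move=> AZ SZ dis; rewrite (wtID Z A); apply: lerD; apply: le_wt => x hx; apply/andP; split=> //.
- exact: AZ.
- exact: SZ.
- by apply/negP => /dis /(_ hx).
Qed.

Lemma prod_leaf (f : leaf -> R) p q : (forall i, f (inl i) = p) -> (forall j, f (inr j) = q) ->
  \prod_t f t = p ^+ k * q ^+ l.
Proof.
move=> hp hq; rewrite big_sumType /=.
by under eq_bigr do rewrite hp; under [X in _ * X]eq_bigr do rewrite hq;
  rewrite !prodr_const !card_ord.
Qed.

Lemma prodD1_const n (i : 'I_n) (p : R) : \prod_(j < n | j != i) p = p ^+ n.-1.
Proof.
rewrite prodr_const; congr (_ ^+ _).
by have := cardC1 i; rewrite card_ord => <-; apply: eq_card => j; rewrite !inE.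
Qed.

Lemma prod_leaf_l (f : leaf -> R) p q i0 : (forall i, f (inl i) = p) -> (forall j, f (inr j) = q) ->
  \prod_(t | t != inl i0) f t = p ^+ k.-1 * q ^+ l.
Proof.
move=> hp hq; rewrite big_sumType /=; congr (_ * _).
  rewrite -(prodD1_const i0 p); apply: eq_big => [i|i _]; last by rewrite hp.
  by rewrite (inj_eq (@inl_inj _ _)).
by under eq_bigr do rewrite hq; rewrite prodr_const card_ord.
Qed.

Lemma prod_leaf_r (f : leaf -> R) p q j0 : (forall i, f (inl i) = p) -> (forall j, f (inr j) = q) ->
  \prod_(t | t != inr j0) f t = p ^+ k * q ^+ l.-1.
Proof.
move=> hp hq; rewrite big_sumType /=; congr (_ * _); last first.
  rewrite -(prodD1_const j0 q); apply: eq_big => [i|i _]; last by rewrite hq.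
  by rewrite (inj_eq (@inr_inj _ _)).
by under eq_bigr do rewrite hp; rewrite prodr_const card_ord.
Qed.

Lemma star_center_le c S :
  M [pred phi : star | (phi None == c) && [forall t, S (phi (Some t))]] <=
  w c * (wt [predI out c & S] ^+ k * wt [predI inn c & S] ^+ l).
Proof.
apply: le_trans (M_prod (G := fun u => if u is Some t then [predI nb c t & S] else pred1 c) _) _.
  move=> phi hv /andP[/eqP ec /forallP hS] [t|]; rewrite /= ?ec ?eqxx //.
  by apply/andP; split; [rewrite -ec; exact: valid_nb | exact: hS].
by rewrite wt_pred1 (prod_leaf (p := wt [predI out c & S]) (q := wt [predI inn c & S])).
Qed.

(** Leaves of an induced star are pairwise nonadjacent, so once t0 sits at v the other leaves avoid
    the neighbours of v. *)
Lemma star_leaf_le c v t0 (Q : leaf -> pred V) :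
  M [pred phi : star | [&& phi None == c, phi (Some t0) == v & [forall t, (t != t0) ==> Q t (phi (Some t))]]] <=
  if nb c t0 v then w c * w v * \prod_(t | t != t0) wt [pred x | [&& nb c t x, Q t x & ~~ adj v x]] else 0.
Proof.
set P := [pred phi : star | _]; case: ifP => hn; last first.
  rewrite /M big1 // => phi /andP[hv /and3P[/eqP e1 /eqP e2 _]].
  by move: (valid_nb t0 hv); rewrite e1 e2 hn.
pose G (u : star_vertex k l) : pred V := if u is Some t then
  if t == t0 then pred1 v else [pred x | [&& nb c t x, Q t x & ~~ adj v x]] else pred1 c.
apply: le_trans (M_prod (G := G) _) _.
  move=> phi hv /and3P[/eqP e1 /eqP e2 /forallP hQ] [t|]; rewrite /G /= ?e1 ?eqxx //.
  case: eqP => [->|/eqP ne] /=; first by rewrite e2 eqxx.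
  apply/and3P; split; [by rewrite -e1; exact: valid_nb | | by rewrite -e2; exact: valid_nadj].
  by move: (hQ t); rewrite ne.
rewrite /G wt_pred1 (bigD1 t0) //= eqxx wt_pred1 mulrA.
by rewrite (eq_bigr (fun t => wt [pred x | [&& nb c t x, Q t x & ~~ adj v x]])) // => t /negbTE ->.
Qed.

End StarMass.

(** * Stars through a prescribed leaf *)

Section LeafMass.
Variables (R : realFieldType) (k l : nat) (V : finType) (E : rel V) (w : V -> R).
Hypothesis w_ge0 : forall x, 0 <= w x.
Hypotheses (k_gt0 : (0 < k)%N) (l_gt0 : (0 < l)%N).
Local Notation leaf := ('I_k + 'I_l)%type.
Local Notation star := {ffun star_vertex k l -> V}.
Local Notation m := (k + l)%N.
Local Notation out := (out E). Local Notation inn := (inn E).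
Local Notation adj := (adj E). Local Notation nb := (nb E).
Local Notation valid := (valid E). Local Notation M := (M E w).
Local Notation wt := (wt w).
Local Notation Lam := (@Lam R). Local Notation gam := (@gam R).
Implicit Types (phi : star) (P Q : pred star) (A S Z : pred V) (t : leaf) (c v x : V).

Let wt0 A : 0 <= wt A := wt_ge0 w_ge0 A.

Lemma out_inn c v : out c v -> inn c v = false.
Proof. by rewrite /out /inn => /andP[-> /negbTE ->]. Qed.

Lemma out_adj c v : out c v -> adj c v.
Proof. by rewrite /out /adj => /andP[-> _]. Qed.

Lemma inn_adj c v : inn c v -> adj c v.
Proof. by rewrite /inn /adj => /andP[-> _]; rewrite orbT. Qed.

Lemma wt_out_inn c S : wt [predI out c & S] + wt [predI inn c & S] <= wt [predI adj c & S].
Proof.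
apply: wt_disjoint => // x /andP[h sx]; first by apply/andP; split=> //; exact: out_adj.
  by apply/andP; split=> //; exact: inn_adj.
by move=> /andP[h' _]; have /negP := negbT (out_inn h); apply.
Qed.

Definition rest c v S := [predI adj c & [predI S & [pred x | ~~ adj v x]]].

Lemma leaf_prod_le c v t0 S : nb c t0 v ->
  \prod_(t | t != t0) wt [pred x | [&& nb c t x, S x & ~~ adj v x]] <=
  (if t0 is inl _ then gam k.-1 l else gam k l.-1) * wt (rest c v S) ^+ m.-1.
Proof.
set S' := [predI S & [pred x | ~~ adj v x]] => h.
have hs := wt_out_inn c S'.
case: t0 h => i0 h.
  rewrite (prod_leaf_l (p := wt [predI out c & S']) (q := wt [predI inn c & S'])) //.
  have -> : (m.-1 = k.-1 + l)%N by lia.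
  exact: amgm_le.
rewrite (prod_leaf_r (p := wt [predI out c & S']) (q := wt [predI inn c & S'])) //.
have -> : (m.-1 = k + l.-1)%N by lia.
exact: amgm_le.
Qed.

Definition leaves_in S phi := [forall t, S (phi (Some t))].

Lemma star_leaf_center c v t0 S :
  M [pred phi : star | [&& phi (Some t0) == v, leaves_in S phi & phi None == c]] <=
  if nb c t0 v then w v * (if t0 is inl _ then gam k.-1 l else gam k l.-1) *
    (w c * wt (rest c v S) ^+ m.-1) else 0.
Proof.
have hl := star_leaf_le E w_ge0 c v t0 (fun=> S).
apply: le_trans (le_trans _ hl) _.
  apply: le_M => // phi _ /and3P[e1 /forallP hS e2]; apply/and3P; split=> //.
  by apply/forallP => t; apply/implyP => _; exact: hS.
case: ifP => // h.
have := ler_wpM2l (mulr_ge0 (w_ge0 c) (w_ge0 v)) (leaf_prod_le S h); lra.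
Qed.

(** A center joined to v by a single arc uses it only as an out-leaf or only as an in-leaf; the
    number k or l of positions is absorbed by [gam_pred] or [gam_predr]. *)
Lemma star_leaf_sum v Z S :
  \sum_t M [pred phi : star | [&& phi (Some t) == v, leaves_in S phi & Z (phi None)]] <=
  w v * (Lam m * gam k l) * \sum_(c | Z c && adj c v) w c * wt (rest c v S) ^+ m.-1.
Proof.
under eq_bigr => t _.
  rewrite (M_part_in w (f := fun phi => phi None) (D := Z)); last by move=> phi _ /and3P[].
  over.
rewrite exchange_big /= mulr_sumr big_mkcondr /=; apply: ler_sum => c Zc.
have W0 : 0 <= w v * (w c * wt (rest c v S) ^+ m.-1) by rewrite !mulr_ge0 ?exprn_ge0.
apply: le_trans (_ : \sum_t (if nb c t v then w v * (if t is inl _ then gam k.-1 l else gam k l.-1) *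
    (w c * wt (rest c v S) ^+ m.-1) else 0) <= _).
  apply: ler_sum => t _; apply: le_trans (star_leaf_center c v t S).
  by apply: le_M => // phi _ /andP[/and3P[e1 e2 _] e3]; apply/and3P.
rewrite big_sumType /=.
case: (boolP (out c v)) => ho.
  rewrite (out_inn ho) big1_eq addr0 sumr_const card_ord.
  rewrite (out_adj ho).
  have := ler_wpM2r W0 (gam_pred R l k_gt0); rewrite -mulr_natr; lra.
rewrite big1_eq add0r.
case: (boolP (inn c v)) => hi; last first.
  rewrite big1_eq; case: ifP => // _.
  by have := mulr_ge0 (mulr_ge0 (ltW (Lam_gt0 R m)) (gam_ge0 R k l)) W0; lra.
rewrite sumr_const card_ord.
rewrite (inn_adj hi).
have := ler_wpM2r W0 (gam_predr R k l_gt0); rewrite -mulr_natr; lra.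
Qed.

(** Restricting to one out-leaf position keeps the constant [gam k.-1 l], exactly that of the second
    term of [OPT] for k > l. *)
Lemma star_out_leaf (i0 : 'I_k) v Z S :
  M [pred phi : star | [&& phi (Some (inl i0)) == v, leaves_in S phi & Z (phi None)]] <=
  w v * gam k.-1 l * \sum_(c | Z c && out c v) w c * wt (rest c v S) ^+ m.-1.
Proof.
rewrite (M_part_in w (f := fun phi => phi None) (D := Z)); last by move=> phi _ /and3P[].
rewrite mulr_sumr big_mkcondr /=; apply: ler_sum => c Zc.
apply: le_trans (star_leaf_center c v (inl i0) S).
by apply: le_M => // phi _ /andP[/and3P[e1 e2 _] e3]; apply/and3P.
Qed.

Lemma star_center_pow c S :
  M [pred phi : star | (phi None == c) && leaves_in S phi] <= w c * (gam k l * wt [predI adj c & S] ^+ m).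
Proof.
have h := star_center_le k l E w_ge0 c S.
apply: le_trans h _.
by rewrite ler_wpM2l //; apply: amgm_le => //; apply: wt_out_inn.
Qed.

End LeafMass.

(** * Stars lost to adjacent pairs of potential leaves *)

Section AdjacentPairs.
Variables (R : realFieldType) (k l : nat) (V : finType) (E : rel V) (w : V -> R).
Hypothesis w_ge0 : forall x, 0 <= w x.
Hypotheses (k_gt0 : (0 < k)%N) (l_gt0 : (0 < l)%N).
Local Notation leaf := ('I_k + 'I_l)%type.
Local Notation star := {ffun star_vertex k l -> V}.
Local Notation m := (k + l)%N.
Local Notation out := (out E). Local Notation inn := (inn E).
Local Notation adj := (adj E). Local Notation nb := (nb E).
Local Notation valid := (valid E). Local Notation M := (M E w).
Local Notation wt := (wt w).
Local Notation Lam := (@Lam R). Local Notation gam := (@gam R).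
Implicit Types (phi : star) (P Q : pred star) (A S Z : pred V) (t : leaf) (c v x : V).

Let wt0 A : 0 <= wt A := wt_ge0 w_ge0 A.

Local Notation leaves_in := (@leaves_in k l V).

Lemma prodD2_const n (i1 i2 : 'I_n) (p : R) : i1 != i2 ->
  \prod_(j < n | (j != i1) && (j != i2)) p = p ^+ (n - 2).
Proof.
move=> ne; rewrite prodr_const; congr (_ ^+ _).
have h := cardC (pred2 i1 i2); rewrite card_ord card2 ne in h.
have e : #|[pred j | (j != i1) && (j != i2)]| = #|[predC (pred2 i1 i2)]|.
  by apply: eq_card => j; rewrite !inE negb_or.
by move: e h; set a := #|_| => -> <-; rewrite addKn.
Qed.

Lemma prod_leaf_ll (f : leaf -> R) p q i1 i2 : i1 != i2 ->
  (forall i, f (inl i) = p) -> (forall j, f (inr j) = q) ->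
  \prod_(t | (t != inl i1) && (t != inl i2)) f t = p ^+ (k - 2) * q ^+ l.
Proof.
move=> ne hp hq; rewrite big_sumType /=; congr (_ * _); last first.
  by under eq_bigr do rewrite hq; rewrite prodr_const card_ord.
rewrite -(prodD2_const p ne); apply: eq_big => [i|i _]; last by rewrite hp.
by rewrite !(inj_eq (@inl_inj _ _)).
Qed.

Lemma prod_leaf_rr (f : leaf -> R) p q i1 i2 : i1 != i2 ->
  (forall i, f (inl i) = p) -> (forall j, f (inr j) = q) ->
  \prod_(t | (t != inr i1) && (t != inr i2)) f t = p ^+ k * q ^+ (l - 2).
Proof.
move=> ne hp hq; rewrite big_sumType /=; congr (_ * _).
  by under eq_bigr do rewrite hp; rewrite prodr_const card_ord.
rewrite -(prodD2_const q ne); apply: eq_big => [i|i _]; last by rewrite hq.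
by rewrite !(inj_eq (@inr_inj _ _)).
Qed.

Lemma prod_leaf_lr (f : leaf -> R) p q i1 i2 :
  (forall i, f (inl i) = p) -> (forall j, f (inr j) = q) ->
  \prod_(t | (t != inl i1) && (t != inr i2)) f t = p ^+ k.-1 * q ^+ l.-1.
Proof.
move=> hp hq; rewrite big_sumType /=; congr (_ * _).
  rewrite -(prodD1_const i1 p); apply: eq_big => [i|i _]; last by rewrite hp.
  by rewrite (inj_eq (@inl_inj _ _)) andbT.
rewrite -(prodD1_const i2 q); apply: eq_big => [i|i _]; last by rewrite hq.
by rewrite (inj_eq (@inr_inj _ _)).
Qed.

Definition pair A S := \sum_(x | A x) w x * wt [pred x' | S x' && adj x x'].
Definition npair A S := \sum_(x | A x) w x * wt [pred x' | S x' && ~~ adj x x'].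

Lemma npairE A S : npair A S = wt A * wt S - pair A S.
Proof.
apply/eqP; rewrite eq_sym subr_eq; apply/eqP.
rewrite /npair /pair -big_split /= [wt A]wtE mulr_suml; apply: eq_bigr => x _.
by rewrite -mulrDr addrC; congr (_ * _); exact: wtID.
Qed.

Lemma pairC A S : pair A S = pair S A.
Proof.
rewrite /pair /wt; under eq_bigr do rewrite mulr_sumr.
rewrite (exchange_big_dep S) /=; last by move=> x y _ /andP[].
apply: eq_bigr => y Sy; rewrite mulr_sumr; apply: eq_big => [x|x _]; last by rewrite mulrC.
by rewrite Sy /= adjC.
Qed.

(** The two leaves t1 and t2 must be nonadjacent, so their joint weight is [npair] instead of a
    product of two weights. *)
Lemma star_pair_le c S t1 t2 : t1 != t2 ->
  M [pred phi : star | (phi None == c) && leaves_in S phi] <=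
  w c * npair [predI nb c t1 & S] [predI nb c t2 & S] *
   \prod_(t | (t != t1) && (t != t2)) wt [predI nb c t & S].
Proof.
move=> ne; set P := [pred phi : star | _].
rewrite (M_part_in w (f := fun phi => phi (Some t1)) (D := [predI nb c t1 & S])); last first.
  by move=> phi hv /andP[/eqP <- /forallP hS]; apply/andP; split; [exact: valid_nb | exact: hS].
rewrite -mulrA mulrCA /npair mulr_suml; apply: ler_sum => x hx.
rewrite (M_part_in w (f := fun phi => phi (Some t2))
   (D := [pred x' | [predI nb c t2 & S] x' && ~~ adj x x'])); last first.
  move=> phi hv /andP[/andP[/eqP <- /forallP hS] /eqP <-]; apply/andP; split; last exact: valid_nadj.
  by apply/andP; split; [exact: valid_nb | exact: hS].
rewrite {1}/wt mulr_sumr mulr_suml; apply: ler_sum => x' hx'.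
pose G (u : star_vertex k l) : pred V := if u is Some t then
  if t == t1 then pred1 x else if t == t2 then pred1 x' else [predI nb c t & S] else pred1 c.
apply: le_trans (M_prod (G := G) _ _) _ => //.
  move=> phi hv /andP[/andP[/andP[/eqP e1 /forallP hS] /eqP e2] /eqP e3] [t|]; rewrite /G /= ?e1 ?eqxx //.
  case: eqP => [->|_]; first by rewrite /= e2.
  case: eqP => [->|_]; first by rewrite /= e3.
  by apply/andP; split; [rewrite -e1; exact: valid_nb | exact: hS].
have ne' : (t2 == t1) = false by rewrite eq_sym (negbTE ne).
rewrite /G wt_pred1 (bigD1 t1) //= eqxx wt_pred1 (bigD1 t2) ?ne' //=.
rewrite eqxx wt_pred1.
rewrite (eq_bigr (fun t => wt [predI nb c t & S])); last by move=> t /andP[/negbTE -> /negbTE ->].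
rewrite le_eqVlt; apply/orP; left; apply/eqP; ring.
Qed.

(* For l = 1 a star has a single in-leaf, so two adjacent in-neighbours of its center are harmless. *)
Definition bad c x x' := adj x x' && ~~ [&& l == 1%N, inn c x & inn c x'].
Definition single c x := out c x || inn c x.
Definition badsum c S := \sum_(x | single c x && S x)
  w x * wt [pred x' | [&& single c x', S x' & bad c x x']].

Lemma badsum_le c S : badsum c S <= pair [predI out c & S] [predI out c & S] +
  2 * pair [predI out c & S] [predI inn c & S] +
  (if l == 1%N then 0 else pair [predI inn c & S] [predI inn c & S]).
Proof.
set O := [predI out c & S]; set I := [predI inn c & S].
have -> : badsum c S = \sum_(x | O x) w x * wt [pred x' | [&& single c x', S x' & bad c x x']]
   + \sum_(x | I x) w x * wt [pred x' | [&& single c x', S x' & bad c x x']].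
  rewrite /badsum (bigID (out c)) /=; congr (_ + _); apply: eq_bigl => x.
    by rewrite -[RHS]/(out c x && S x) /single; case: (out c x); rewrite /= ?andbT ?andbF.
  rewrite -[RHS]/(inn c x && S x) /single; case: (boolP (out c x)) => ho; last by rewrite /= andbT.
  by rewrite (out_inn ho) andbF.
set X := (if _ then _ else _).
have -> : pair O O + 2 * pair O I + X = (pair O O + pair O I) + (pair I O + X).
  by rewrite [pair I O]pairC; ring.
rewrite /X; apply: lerD.
  rewrite /pair -big_split /=; apply: ler_sum => x _; rewrite -mulrDr ler_wpM2l //.
  apply: le_wtD => // y /and3P[/orP[h|h] Sy /andP[hadj _]]; apply/orP; [left|right]; by apply/andP; split=> //; apply/andP.
case: (boolP (l == 1%N)) => l1.
  rewrite addr0 /pair; apply: ler_sum => x /andP[xi _]; rewrite ler_wpM2l //.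
  apply: le_wt => // y /and3P[hs Sy /andP[hadj]]; rewrite l1 /= => nn.
  apply/andP; split=> //; apply/andP; split=> //.
  by case/orP: hs => // yi; move: nn; rewrite (_ : inn c x = true) // yi.
rewrite /pair -big_split /=; apply: ler_sum => x _; rewrite -mulrDr ler_wpM2l //.
apply: le_wtD => // y /and3P[/orP[h|h] Sy /andP[hadj _]]; apply/orP; [left|right]; by apply/andP; split=> //; apply/andP.
Qed.

(** [star_pair_le] is applied to two out-leaves, to an out-leaf and an in-leaf and, if l > 1, to two
    in-leaves; the bounds are then combined as in (p + q)^2 = p^2 + 2 p q + q^2. *)
Lemma star_kill_sq c S (p := wt [predI out c & S]) (q := wt [predI inn c & S]) :
  (1 < k)%N ->
  M [pred phi : star | (phi None == c) && leaves_in S phi] * (p + q) ^+ 2 <=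
  w c * (p ^+ k * q ^+ l) * ((p + q) ^+ 2 - badsum c S).
Proof.
move=> k1; set MM := M _.
have p0 : 0 <= p by exact: wt0.
have q0 : 0 <= q by exact: wt0.
have hb := badsum_le c S.
set O := [predI out c & S] in hb *; set I := [predI inn c & S] in hb *.
have F0 : 0 <= w c * (p ^+ k * q ^+ l) by rewrite !mulr_ge0 ?exprn_ge0.
have base : MM <= w c * (p ^+ k * q ^+ l) by exact: star_center_le.
set F := w c * _ in F0 base *.
pose i0 : 'I_k := Ordinal k_gt0; pose i1 : 'I_k := Ordinal k1; pose j0 : 'I_l := Ordinal l_gt0.
have oo : MM * p ^+ 2 <= F * (p ^+ 2 - pair O O).
  have := @star_pair_le c S (inl i0) (inl i1) isT.
  rewrite (prod_leaf_ll (p := p) (q := q)) // -/MM -[npair _ _]/(npair O O) npairE -[wt O]/p -expr2 => h.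
  have := ler_wpM2r (exprn_ge0 2 p0) h; have e2 : p ^+ k = p ^+ 2 * p ^+ (k - 2) by rewrite -exprD subnKC.
  rewrite /F e2; lra.
have oi : MM * (p * q) <= F * (p * q - pair O I).
  have := @star_pair_le c S (inl i0) (inr j0) isT.
  rewrite (prod_leaf_lr (p := p) (q := q)) // -/MM -[npair _ _]/(npair O I) npairE -[wt O]/p -[wt I]/q => h.
  have := ler_wpM2r (mulr_ge0 p0 q0) h.
  have e1 : p ^+ k = p * p ^+ k.-1 by rewrite -exprS prednK.
  have e2 : q ^+ l = q * q ^+ l.-1 by rewrite -exprS prednK.
  rewrite /F e1 e2; lra.
have ii : MM * q ^+ 2 <= F * (q ^+ 2 - if l == 1%N then 0 else pair I I).
  case: eqP => l1.
    by rewrite subr0 ler_wpM2r // exprn_ge0.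
  have l2 : (1 < l)%N by case: (l) l1 l_gt0 => [|[|]].
  have := @star_pair_le c S (inr j0) (inr (Ordinal l2)) isT.
  rewrite (prod_leaf_rr (p := p) (q := q)) // -/MM -[npair _ _]/(npair I I) npairE -[wt I]/q -expr2 => h.
  have := ler_wpM2r (exprn_ge0 2 q0) h; have e2 : q ^+ l = q ^+ 2 * q ^+ (l - 2) by rewrite -exprD subnKC.
  rewrite /F e2; lra.
have := ler_wpM2l F0 hb; lra.
Qed.

Lemma badsum_ge0 c S : 0 <= badsum c S.
Proof. by apply: sumr_ge0 => *; rewrite mulr_ge0. Qed.

Lemma star_kill c S (p := wt [predI out c & S]) (q := wt [predI inn c & S]) :
  (1 < k)%N -> p + q <= 1 ->
  M [pred phi : star | (phi None == c) && leaves_in S phi] <=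
  w c * (p ^+ k * q ^+ l) * (1 - badsum c S).
Proof.
move=> k1 pq1; have tot := star_kill_sq c S k1; move: tot; rewrite -/p -/q.
have p0 : 0 <= p by exact: wt0.
have q0 : 0 <= q by exact: wt0.
have F0 : 0 <= w c * (p ^+ k * q ^+ l) by rewrite !mulr_ge0 ?exprn_ge0.
have := star_center_le k l E w_ge0 c S; rewrite -/p -/q; set F := w c * _ in F0 *.
set MM := M _ => base tot.
have [d0|d0] := eqVneq (p + q) 0.
  have pz : p = 0 by lra.
  have -> : F * (1 - badsum c S) = 0.
    by rewrite /F pz expr0n gt_eqF //= mul0r mulr0 mul0r.
  by apply: le_trans base _; rewrite /F pz expr0n gt_eqF //= mul0r mulr0.
have d1 : 0 < (p + q) ^+ 2 by rewrite exprn_gt0 // lt0r d0 addr_ge0.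
have b0 := badsum_ge0 c S.
rewrite -(ler_pM2r d1); apply: le_trans tot _.
have d2 : (p + q) ^+ 2 <= 1 by rewrite exprn_ile1 // addr_ge0.
have := mulr_ge0 F0 b0; nra.
Qed.

End AdjacentPairs.

(** * Stars with two prescribed leaves *)

Section MixedLeaves.
Variables (R : realFieldType) (k l : nat) (V : finType) (E : rel V) (w : V -> R).
Hypothesis w_ge0 : forall x, 0 <= w x.
Hypotheses (k_gt0 : (0 < k)%N) (l_gt0 : (0 < l)%N).
Local Notation leaf := ('I_k + 'I_l)%type.
Local Notation star := {ffun star_vertex k l -> V}.
Local Notation m := (k + l)%N.
Local Notation out := (out E). Local Notation inn := (inn E).
Local Notation adj := (adj E). Local Notation nb := (nb E).
Local Notation valid := (valid E). Local Notation M := (M E w).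
Local Notation wt := (wt w).
Local Notation Lam := (@Lam R). Local Notation gam := (@gam R).
Implicit Types (phi : star) (P Q : pred star) (A S Z : pred V) (t : leaf) (c v x : V).

Let wt0 A : 0 <= wt A := wt_ge0 w_ge0 A.

Let Lam0 n : 0 <= Lam n. Proof. exact: ltW (Lam_gt0 R n). Qed.
Let gam0 i j : 0 <= gam i j. Proof. exact: gam_ge0. Qed.

Ltac pos := repeat first [exact: Lam0 | exact: gam0 | done | apply: mulr_ge0].

Lemma predDl i j : (0 < i)%N -> (i.-1 + j = (i + j).-1)%N.
Proof. by case: i. Qed.

Lemma predDr i j : (0 < j)%N -> (i + j.-1 = (i + j).-1)%N.
Proof. by case: j => // j _; rewrite addnS. Qed.

Lemma sumrD1_const n (i : 'I_n) (p : R) : \sum_(j < n | j != i) p = n.-1%:R * p.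
Proof.
rewrite sumr_const mulr_natl; congr (_ *+ _).
by have := cardC1 i; rewrite card_ord => <-; apply: eq_card => j; rewrite !inE.
Qed.

(** The left side is the partial derivative in p of the leaf product; AM-GM is followed by
    [gam_pred]. *)
Lemma gam_amgm_l k' l' p q r : 0 <= p -> 0 <= q -> p + q <= r ->
  k'%:R * (p ^+ k'.-1 * q ^+ l') <= Lam (k' + l') * gam k' l' * r ^+ (k' + l').-1.
Proof.
move=> p0 q0 pqr; have r0 : 0 <= r by apply: le_trans pqr; rewrite addr_ge0.
have X0 := exprn_ge0 (k' + l').-1 r0.
case: k' X0 => [|k'] X0.
  by rewrite mul0r; pos.
have h1 := ler_wpM2r X0 (gam_pred R (k := k'.+1) l' isT).
have h2 := ler_wpM2l (ler0n R k'.+1) (amgm_le k' l' p0 q0 pqr).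
by apply: le_trans h2 _; apply: le_trans h1; rewrite mulrA.
Qed.

Lemma gam_amgm_r k' l' p q r : 0 <= p -> 0 <= q -> p + q <= r ->
  l'%:R * (p ^+ k' * q ^+ l'.-1) <= Lam (k' + l') * gam k' l' * r ^+ (k' + l').-1.
Proof.
move=> p0 q0 pqr; rewrite [p ^+ _ * _]mulrC gamC addnC.
by apply: gam_amgm_l => //; rewrite addrC.
Qed.

(** Fixing one leaf at a costs a factor [Lam m], placing a second one in a set of weight z a factor
    [Lam m.-1], and the other m - 2 leaves lie among the non-neighbours of a. It will be applied
    with [B] as the set. *)
Lemma star_mixed a A (r z : R) : wt predT <= 1 ->
  wt [pred x | ~~ adj a x] <= r -> wt [pred x | A x && ~~ adj a x] <= z ->
  \sum_t \sum_(t' | t' != t) M [pred phi : star | (phi (Some t) == a) && A (phi (Some t'))] <=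
  w a * (Lam m * Lam m.-1 * gam k l * r ^+ m.-2 * z).
Proof.
move=> wT hr hz.
have r0 : 0 <= r by exact: le_trans (wt0 _) hr.
have z0 : 0 <= z by exact: le_trans (wt0 _) hz.
have X0 := exprn_ge0 m.-2 r0.
pose Q t' t'' : pred V := if t'' == t' then A else predT.
pose f c t := wt [pred x | nb c t x && ~~ adj a x].
pose g c t := wt [pred x | [&& nb c t x, A x & ~~ adj a x]].
pose L2 := Lam m.-1 * r ^+ m.-2 * z.
have L20 : 0 <= L2 by pos.
have fl c i : f c (inl i) = f c (inl (Ordinal k_gt0)) by [].
have fr c j : f c (inr j) = f c (inr (Ordinal l_gt0)) by [].
have f0 c t : 0 <= f c t by exact: wt0.
have g0 c t : 0 <= g c t by exact: wt0.
have split_le c (T : pred V) (S := [pred x | T x && ~~ adj a x]) :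
    wt [pred x | out c x && S x] + wt [pred x | inn c x && S x] <= wt S.
  apply: wt_disjoint => // x /andP[] // h1 _ /andP[h2 _].
  by move: (out_inn h1); rewrite h2.
have fs c : f c (inl (Ordinal k_gt0)) + f c (inr (Ordinal l_gt0)) <= r.
  by apply: le_trans hr; apply: (le_trans (split_le c predT)); exact: lexx.
have gs c : g c (inl (Ordinal k_gt0)) + g c (inr (Ordinal l_gt0)) <= z.
  by apply: le_trans hz; apply: (le_trans (split_le c A)); exact: lexx.
have step c t : \sum_(t' | t' != t) (g c t' * \prod_(t'' | (t'' != t) && (t'' != t')) f c t'') <=
    L2 * (if t is inl _ then gam k.-1 l else gam k l.-1).
  set p := f c (inl (Ordinal k_gt0)) in fl fs.
  set q := f c (inr (Ordinal l_gt0)) in fr fs.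
  set pA := g c (inl (Ordinal k_gt0)) in gs; set qA := g c (inr (Ordinal l_gt0)) in gs.
  have pA0 : 0 <= pA by exact: g0. have qA0 : 0 <= qA by exact: g0.
  have p0 : 0 <= p by exact: f0. have q0 : 0 <= q by exact: f0.
  rewrite big_sumType /=; case: t => i0.
    rewrite (eq_bigr (fun=> pA * (p ^+ (k - 2) * q ^+ l))); last first.
      move=> i; rewrite (inj_eq (@inl_inj _ _)) => ne.
      by congr (_ * _); rewrite (prod_leaf_ll (p := p) (q := q)) 1?eq_sym.
    rewrite (eq_bigl (fun i => i != i0)); last by move=> i; rewrite (inj_eq (@inl_inj _ _)).
    rewrite sumrD1_const (eq_bigr (fun=> qA * (p ^+ k.-1 * q ^+ l.-1))); last first.
      by move=> j _; congr (_ * _); rewrite (prod_leaf_lr (p := p) (q := q)).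
    rewrite sumr_const card_ord -mulr_natl.
    have h1 := gam_amgm_l k.-1 l p0 q0 (fs c).
    have h2 := gam_amgm_r k.-1 l p0 q0 (fs c).
    rewrite predDl // in h1 h2; rewrite subn2 /L2.
    have := ler_wpM2l pA0 h1; have := ler_wpM2l qA0 h2.
    have : (pA + qA) * (Lam m.-1 * gam k.-1 l * r ^+ m.-2) <= z * (Lam m.-1 * gam k.-1 l * r ^+ m.-2).
      by apply: ler_wpM2r (gs c); pos.
    lra.
  rewrite addrC (eq_bigr (fun=> qA * (p ^+ k * q ^+ (l - 2)))); last first.
    move=> i; rewrite (inj_eq (@inr_inj _ _)) => ne.
    by congr (_ * _); rewrite (prod_leaf_rr (p := p) (q := q)) 1?eq_sym.
  rewrite (eq_bigl (fun i => i != i0)); last by move=> i; rewrite (inj_eq (@inr_inj _ _)).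
  rewrite sumrD1_const (eq_bigr (fun=> pA * (p ^+ k.-1 * q ^+ l.-1))); last first.
    move=> j _; congr (_ * _); rewrite -(prod_leaf_lr (f := f c) (p := p) (q := q) j i0) //.
    by apply: eq_bigl => t; rewrite andbC.
  rewrite sumr_const card_ord -mulr_natl.
  have h1 := gam_amgm_l k l.-1 p0 q0 (fs c).
  have h2 := gam_amgm_r k l.-1 p0 q0 (fs c).
  rewrite predDr // in h1 h2; rewrite subn2 /L2.
  have := ler_wpM2l pA0 h1; have := ler_wpM2l qA0 h2.
  have : (pA + qA) * (Lam m.-1 * gam k l.-1 * r ^+ m.-2) <= z * (Lam m.-1 * gam k l.-1 * r ^+ m.-2).
    by apply: ler_wpM2r (gs c); pos.
  lra.
have cell c t : \sum_(t' | t' != t) M [pred phi : star |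
      ((phi (Some t) == a) && A (phi (Some t'))) && (phi None == c)] <=
    if nb c t a then w c * w a * (L2 * (if t is inl _ then gam k.-1 l else gam k l.-1)) else 0.
  apply: le_trans (_ : \sum_(t' | t' != t) (if nb c t a then w c * w a *
      (g c t' * \prod_(t'' | (t'' != t) && (t'' != t')) f c t'') else 0) <= _).
    apply: ler_sum => t' ne.
    have hl := star_leaf_le E w_ge0 c a t (Q t').
    apply: le_trans (le_trans _ hl) _.
      apply: le_M => // phi _ /andP[/andP[e1 hA] e2]; apply/and3P; split=> //.
      by apply/forallP => t''; apply/implyP => _; rewrite /Q; case: eqP => // ->.
    case: ifP => // _; apply: ler_wpM2l; first by rewrite mulr_ge0.
    rewrite (bigD1 t') //= {1}/Q eqxx; apply: ler_wpM2l => //.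
    rewrite le_eqVlt; apply/orP; left; apply/eqP; apply: eq_bigr => t'' /andP[_ /negbTE e].
    by apply: eq_wt => x; rewrite /= /Q e.
  case: ifP => _; last by rewrite big1_eq.
  by rewrite -mulr_sumr ler_wpM2l ?mulr_ge0 // step.
apply: le_trans (_ : \sum_t \sum_c (if nb c t a then w c * w a * (L2 * (if t is inl _ then gam k.-1 l else gam k l.-1)) else 0) <= _).
  apply: ler_sum => t _.
  under eq_bigr do rewrite (M_part E w (fun phi => phi None)).
  by rewrite exchange_big /=; apply: ler_sum => c _; exact: cell.
rewrite exchange_big /=.
apply: le_trans (_ : \sum_c w c * (w a * (Lam m * gam k l * L2)) <= _).
  apply: ler_sum => c _; rewrite big_sumType /=.
  have W0 : 0 <= w c * w a * L2 by pos.
  case: (boolP (out c a)) => ho.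
    rewrite (out_inn ho) big1_eq addr0 sumr_const card_ord.
    have := ler_wpM2r W0 (gam_pred R l k_gt0); rewrite -mulr_natr; lra.
  rewrite big1_eq add0r; case: (boolP (inn c a)) => hi; last first.
    by rewrite big1_eq; pos.
  rewrite sumr_const card_ord.
  have := ler_wpM2r W0 (gam_predr R k l_gt0); rewrite -mulr_natr; lra.
rewrite -mulr_suml.
have Y0 : 0 <= w a * (Lam m * gam k l * L2).
  by pos.
by apply: le_trans (ler_wpM2r Y0 wT) _; rewrite mul1r /L2; lra.
Qed.

End MixedLeaves.

Lemma sum_option (R : nmodType) (T : finType) (F : option T -> R) :
  \sum_u F u = F None + \sum_t F (Some t).
Proof.
rewrite (bigD1 None) //=; congr (_ + _).
rewrite (reindex_omap Some id) /=; last by case.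
by apply: eq_bigl => t; rewrite eqxx.
Qed.

(** * Degrees and side weights at a maximizer *)

Section Upper.
Variables (R : realFieldType) (k l : nat) (V : finType) (E : rel V) (w : V -> R).
Hypothesis w_ge0 : forall x, 0 <= w x.
Hypotheses (l_gt0 : (0 < l)%N) (lk : (l <= k)%N) (m6 : (6 <= k + l)%N).
Local Notation leaf := ('I_k + 'I_l)%type.
Local Notation star := {ffun star_vertex k l -> V}.
Local Notation m := (k + l)%N.
Local Notation out := (out E). Local Notation inn := (inn E).
Local Notation adj := (adj E). Local Notation nb := (nb E).
Local Notation valid := (valid E). Local Notation M := (M E w).
Local Notation wt := (wt w).
Local Notation leaves_in := (@leaves_in k l V).
Local Notation rest := (rest E).
Local Notation T := (M (@predT star)).
Local Notation L := (@Lam R m). Local Notation g := (@gam R k l).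
Local Notation th := (@theta R m).
Local Notation Ld := (L * (3 / 20) ^+ m.-1).
Local Notation mR := (m%:R : R).
Implicit Types (phi : star) (S Z : pred V) (t : leaf) (a b c v x : V).
Hypothesis wT : wt predT = 1.
Hypothesis first_order : forall v, \sum_u M [pred phi : star | phi u == v] = (mR + 1) * T * w v.
(** If this fails, [OPT_ge] alone bounds T by OPT, so only this case calls for structure. *)
Hypothesis T_ge : th * g <= (mR + 1) * T.

Let wt0 S : 0 <= wt S := wt_ge0 w_ge0 S.
Let k_gt0 : (0 < k)%N. Proof. exact: leq_trans l_gt0 lk. Qed.
Let m_gt0 : (0 < m)%N. Proof. by rewrite addn_gt0 k_gt0. Qed.
Let L0 : 0 < L. Proof. exact: Lam_gt0. Qed.
Let g0 : 0 < g. Proof. exact: gam_gt0. Qed.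
Let wLg v : 0 <= w v * (L * g).
Proof. exact: mulr_ge0 (w_ge0 v) (mulr_ge0 (ltW L0) (ltW g0)). Qed.
Let m6R : 6 <= mR. Proof. by rewrite ler_nat. Qed.

Lemma ler_exp n (p q : R) : 0 <= p -> p <= q -> p ^+ n <= q ^+ n.
Proof. by move=> p0 pq; rewrite lerXn2r ?nnegrE // (le_trans p0). Qed.

Lemma wt_exp n S q : wt S <= q -> wt S ^+ n <= q ^+ n.
Proof. by apply: ler_exp; exact: wt0. Qed.

Lemma wt_le1 S : wt S <= 1.
Proof. by rewrite -wT; apply: le_wt. Qed.

Lemma wtC S : wt [pred x | ~~ S x] = 1 - wt S.
Proof. by rewrite -wT (wtID w predT S) /= addrC addKr. Qed.

Lemma ler_sumw S (F G : V -> R) : (forall x, S x -> 0 < w x -> F x <= G x) ->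
  \sum_(x | S x) w x * F x <= \sum_(x | S x) w x * G x.
Proof.
move=> h; apply: ler_sum => x Sx; have := w_ge0 x; rewrite le_eqVlt => /orP[/eqP <-|w0].
  by rewrite !mul0r.
by rewrite ler_pM2l // h.
Qed.

Lemma T_gt0 : 0 < T.
Proof.
have h : 0 < (mR + 1) * T by apply: lt_le_trans T_ge; exact: mulr_gt0 (theta_gt0 R m) g0.
by move: h; rewrite pmulr_rgt0 //; have := m6R; lra.
Qed.

Definition deg v := wt (adj v).
Definition leafmass v := \sum_t M [pred phi : star | phi (Some t) == v].
Definition A : pred V := fun v => 17 / 20 <= deg v.
Definition B : pred V := fun v => ~~ A v.
Arguments A : simpl never.
Arguments B : simpl never.
Definition al := wt A.
Definition be := wt B.

Lemma be_al : be = 1 - al. Proof. exact: wtC. Qed.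

Lemma deg01 v : 0 <= deg v <= 1.
Proof. by rewrite /deg wt0 wt_le1. Qed.

Lemma fo v : M [pred phi : star | phi None == v] + leafmass v = (mR + 1) * T * w v.
Proof. by rewrite -first_order sum_option. Qed.

Lemma leafmass_sum v :
  leafmass v <= w v * (L * g) * \sum_(c | adj c v) w c * wt (rest c v predT) ^+ m.-1.
Proof.
apply: le_trans (star_leaf_sum E w_ge0 k_gt0 l_gt0 v predT predT) => //.
apply: ler_sum => t _; apply: le_M => // phi _ h; apply/and3P; split=> //; exact/forallP.
Qed.

Lemma rest_le c v S : wt (rest c v S) <= wt [pred x | S x && ~~ adj v x].
Proof. by apply: le_wt => // x /and3P[_ h1 h2]; apply/andP. Qed.

Lemma rest_le_deg c v S : wt (rest c v S) <= wt [pred x | adj c x && S x].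
Proof. by apply: le_wt => // x /and3P[h h1 h2]; apply/andP. Qed.

Lemma nadj_wt v : wt [pred x | ~~ adj v x] = 1 - deg v.
Proof. exact: wtC. Qed.

Lemma sum_adj c : \sum_(x | adj x c) w x = deg c.
Proof. by apply: eq_bigl => x; rewrite adjC. Qed.

Lemma leafmass_le v : leafmass v <= w v * (L * g) * (deg v * (1 - deg v) ^+ m.-1).
Proof.
apply: le_trans (leafmass_sum v) _; apply: ler_wpM2l; first exact: wLg.
rewrite -{1}sum_adj mulr_suml; apply: ler_sum => c _; apply: ler_wpM2l => //.
have := rest_le c v predT; rewrite nadj_wt => h.
exact: wt_exp.
Qed.

Lemma center_le v : M [pred phi : star | phi None == v] <= w v * (g * deg v ^+ m).
Proof.
apply: le_trans (_ : M [pred phi : star | (phi None == v) && leaves_in predT phi] <= _).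
  by apply: le_M => // phi _ h; apply/andP; split=> //; exact/forallP.
apply: le_trans (star_center_pow k l E w_ge0 v predT) _.
by rewrite (eq_wt w (S := adj v)) // => x; rewrite /= andbT.
Qed.

Lemma dich v : 0 < w v -> ~~ A v -> deg v <= 11 / 25.
Proof.
move=> w0 nA; case: (@dichotomy R m (deg v) m6 (deg01 v)) => //; last first.
  by move=> h; case/negP: nA.
have h : (mR + 1) * T * w v <= w v * (g * (deg v ^+ m + L * (deg v * (1 - deg v) ^+ m.-1))).
  by rewrite -fo; have := center_le v; have := leafmass_le v; lra.
rewrite mulrC ler_pM2l // in h.
by have := le_trans T_ge h; rewrite mulrC ler_pM2l.
Qed.

Let Ld0 : 0 <= Ld. Proof. by apply: mulr_ge0; [exact: ltW | apply: exprn_ge0; lra]. Qed.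

Lemma degA a : A a -> 0 <= 1 - deg a <= 3 / 20.
Proof. by move=> h; have := deg01 a; rewrite /A /= in h; lra. Qed.

Lemma leafmassA a : A a -> leafmass a <= w a * (g * Ld).
Proof.
move=> Aa; apply: le_trans (leafmass_le a) _.
have /andP[d0 d1] := degA Aa; have /andP[D0 D1] := deg01 a.
have h : (1 - deg a) ^+ m.-1 <= (3 / 20) ^+ m.-1 by apply: ler_exp => //; lra.
have h0 := exprn_ge0 m.-1 d0.
have h2 : deg a * (1 - deg a) ^+ m.-1 <= 1 * (3 / 20) ^+ m.-1 by apply: ler_pM.
have := ler_wpM2l (mulr_ge0 (w_ge0 a) (mulr_ge0 (ltW L0) (ltW g0))) h2; lra.
Qed.

Lemma center_ge a : A a -> w a * ((mR + 1) * T - g * Ld) <= M [pred phi : star | phi None == a].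
Proof. by move=> Aa; have := fo a; have := leafmassA Aa; lra. Qed.

Lemma Ld_le : g * ((mR + 1) * Ld) <= (mR + 1) * T.
Proof.
apply: le_trans T_ge; rewrite [leRHS]mulrC ler_pM2l //.
have := @Lam_delta_le R m m6; have := theta_ge R m; have := m6R; have := Ld0; nra.
Qed.

Lemma gLd_le_T : g * Ld <= T.
Proof.
have := Ld_le; rewrite mulrCA ler_pM2l //; have := m6R; lra.
Qed.

Lemma sum_center S : \sum_(a | S a) M [pred phi : star | phi None == a] = M [pred phi : star | S (phi None)].
Proof.
rewrite [RHS](M_part_in w (f := fun phi => phi None) (D := S)) //.
apply: eq_bigr => a Sa; apply: eq_M => // phi _ /=.
by case: eqP => [->|]; rewrite ?Sa ?andbF.
Qed.

Lemma al_ge0 : 0 <= al. Proof. exact: wt0. Qed.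

(** A vertex a of [A] is mostly a center: its mass as a leaf is at most T w(a), so it centers mass
    at least m T w(a). Summed over [A], this is at most T. *)
Lemma al_le : al * mR <= 1.
Proof.
have h : al * ((mR + 1) * T - g * Ld) <= T.
  rewrite /al /wt mulr_suml.
  apply: le_trans (ler_sum _ (fun a Aa => center_ge Aa)) _.
  by rewrite sum_center; apply: le_M.
have := T_gt0; have := gLd_le_T; have := al_ge0 => a0 h1 T0.
have : al * (mR * T) <= T by apply: le_trans h; apply: ler_wpM2l => //; lra.
by rewrite mulrA -[leRHS]mul1r ler_pM2r.
Qed.

Definition vB b := wt [pred x | adj b x && B x].

Lemma sum_wt_le (S : pred V) (F : V -> R) r : (forall c, S c -> 0 < w c -> F c <= r) ->
  \sum_(c | S c) w c * F c <= wt S * r.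
Proof. by move=> h; rewrite /wt mulr_suml; exact: ler_sumw. Qed.

Lemma deg_split v : deg v = wt [pred x | adj v x && A x] + vB v.
Proof. exact: wtID. Qed.

(** Centers in [A] having b as a leaf contribute at most DA (1 - vB - DA)^(m - 1), up to a constant;
    optimizing over DA by [Lam_mul] leaves exactly the inequality refuted by [low_degree]. *)
Lemma vB_le b : 0 < w b -> B b -> vB b * mR <= 1.
Proof.
move=> wb Bb; rewrite leNgt; apply/negP => hv.
have Db := dich wb Bb; have := deg_split b; set DA := wt _ => Ds.
have DA0 : 0 <= DA by exact: wt0.
have v0 : 0 <= vB b by exact: wt0.
have mp : 0 < mR by have := m6R; lra.
have v1 : mR^-1 <= vB b <= 11 / 25.
  by rewrite -div1r ler_pdivrMr // (ltW hv) /=; lra.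
have := @low_degree R m (vB b) m6 v1; apply/negP; rewrite -leNgt.
have c0 : 0 <= (11 / 25) ^+ m.-1 :> R by apply: exprn_ge0; lra.
have d0 : 0 <= (1 - deg b) ^+ m.-1 by apply: exprn_ge0; lra.
have hs : \sum_(c | adj c b) w c * wt (rest c b predT) ^+ m.-1 <=
    DA * (1 - deg b) ^+ m.-1 + vB b * (11 / 25) ^+ m.-1.
  rewrite (bigID A) /=; apply: lerD.
    apply: le_trans (sum_wt_le (S := [pred c | adj c b && A c]) (r := (1 - deg b) ^+ m.-1) _) _.
      move=> c _ _; have := rest_le c b predT; rewrite nadj_wt => h.
      exact: wt_exp.
    rewrite le_eqVlt; apply/orP; left; apply/eqP; congr (_ * _).
    by apply: eq_wt => x; rewrite /= adjC.
  apply: le_trans (sum_wt_le (S := [pred c | adj c b && B c]) (r := (11 / 25) ^+ m.-1) _) _.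
    move=> c /andP[_ Bc] wc; have := rest_le_deg c b predT => h.
    have h2 := dich wc Bc.
    have h3 : wt [pred x | adj c x && predT x] = deg c by apply: eq_wt => x; rewrite /= andbT.
    by apply: wt_exp; rewrite h3 in h; lra.
  rewrite le_eqVlt; apply/orP; left; apply/eqP; congr (_ * _).
  by apply: eq_wt => x; rewrite /= adjC.
have h : (mR + 1) * T * w b <=
  w b * (g * (deg b ^+ m + L * (DA * (1 - deg b) ^+ m.-1 + vB b * (11 / 25) ^+ m.-1))).
  rewrite -fo.
  have := center_le b; have := leafmass_sum b.
  have := ler_wpM2l (mulr_ge0 (w_ge0 b) (mulr_ge0 (ltW L0) (ltW g0))) hs; lra.
rewrite mulrC ler_pM2l // in h.
have := le_trans T_ge h; rewrite mulrC ler_pM2l // => h'.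
have dm : deg b ^+ m <= (11 / 25) ^+ m by apply: ler_exp => //; lra.
have : L * (DA * (1 - vB b - DA) ^+ m.-1) <= (1 - vB b) ^+ m.
  by apply: Lam_mul; [exact: m_gt0 | apply/andP; split; lra].
have -> : 1 - vB b - DA = 1 - deg b by lra.
lra.
Qed.

Lemma degB_le b : 0 < w b -> B b -> deg b <= 2 / mR.
Proof.
move=> wb Bb; rewrite ler_pdivlMr; last by have := m6R; lra.
have h1 := vB_le wb Bb; have h2 := al_le.
have h3 : wt [pred x | adj b x && A x] <= al by apply: le_wt => // x /andP[].
rewrite deg_split; have := m6R; nra.
Qed.

Lemma leaves_inA_or phi : [exists t, A (phi (Some t))] || leaves_in B phi.
Proof. by rewrite /leaves_in -negb_exists orbN. Qed.

Lemma someleafA : M [pred phi : star | [exists t, A (phi (Some t))]] <= al * (g * Ld).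
Proof.
apply: le_trans (M_exists w_ge0 (D := A) (Q := fun a => [pred phi : star | [exists t, phi (Some t) == a]]) _) _.
  by move=> phi _ /existsP[t At]; exists (phi (Some t)) => //; apply/existsP; exists t.
rewrite /al /wt mulr_suml; apply: ler_sum => a Aa; apply: le_trans (leafmassA Aa).
apply: le_trans (M_exists w_ge0 (D := predT) (Q := fun t => [pred phi : star | phi (Some t) == a]) _) _ => //.
by move=> phi _ /existsP[t At]; exists t.
Qed.

(** By stationarity the stars centered in [A] have mass at most (m + 1) T al. Any other star has a
    leaf in [A], which [someleafA] makes rare, or lies entirely in [B], where [vB_le] leaves at most
    g m^(-m). *)
Lemma al_ge : 1 - (30 * mR)^-1 <= al * (mR + 1).
Proof.
have T0 := T_gt0; have mp : 0 < mR by have := m6R; lra.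
have h0 : T <= M [pred phi : star | A (phi None)] + M [pred phi : star | B (phi None)].
  by apply: M_or => // phi _ _ /=; rewrite orbN.
have h1 : M [pred phi : star | A (phi None)] <= (mR + 1) * T * al.
  rewrite -sum_center /al /wt mulr_sumr; apply: ler_sum => a _.
  by rewrite -fo lerDl; apply: sumr_ge0 => *; exact: M_ge0.
have h2 : M [pred phi : star | B (phi None)] <= M [pred phi : star | [exists t, A (phi (Some t))]] +
    M [pred phi : star | leaves_in B phi && B (phi None)].
  apply: M_or => // phi _ h /=; move: (leaves_inA_or phi) => /orP[->//|hl].
  by rewrite hl orbC; move: h => /= ->.
have h3 : M [pred phi : star | leaves_in B phi && B (phi None)] <= g * mR^-1 ^+ m.
  rewrite (M_part_in w (f := fun phi => phi None) (D := B)); last by move=> phi _ /andP[].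
  apply: le_trans (_ : \sum_(b | B b) w b * (g * vB b ^+ m) <= _).
    apply: ler_sum => b Bb; apply: le_trans (star_center_pow k l E w_ge0 b B).
    by apply: le_M => // phi _ /andP[/andP[h1' _] h2']; apply/andP.
  have im0 : 0 <= mR^-1 by rewrite invr_ge0 ltW.
  apply: le_trans (_ : wt B * (g * mR^-1 ^+ m) <= _).
    apply: sum_wt_le => // b Bb wb; rewrite ler_pM2l //; apply: wt_exp.
    by rewrite -div1r ler_pdivlMr // vB_le.
  by rewrite -[leRHS]mul1r ler_wpM2r ?wt_le1 //; exact: mulr_ge0 (ltW g0) (exprn_ge0 m im0).
have h4 := someleafA.
have h5 : al * (g * Ld) <= g * (Ld / mR).
  have ai : al <= mR^-1 by rewrite -div1r ler_pdivlMr //; exact: al_le.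
  have := ler_wpM2r (mulr_ge0 (ltW g0) Ld0) ai; lra.
have h6 := @alpha_num R m m6.
have h7 : g * (30 * mR * (mR + 1) * (Ld / mR + mR^-1 ^+ m)) <= (mR + 1) * T.
  by apply: le_trans T_ge; rewrite [leRHS]mulrC ler_pM2l.
set q := Ld / mR + mR^-1 ^+ m in h6 h7.
have h8 : g * q <= T * (30 * mR)^-1.
  rewrite ler_pdivlMr; last by lra.
  rewrite -(ler_pM2l (_ : 0 < mR + 1)); lra.
have : T * (1 - (30 * mR)^-1) <= T * (al * (mR + 1)) by rewrite /q in h8; lra.
by rewrite ler_pM2l.
Qed.

Lemma al_gt0 : 0 < al.
Proof.
have h := al_ge; have mp : 0 < mR by have := m6R; lra.
have : (30 * mR)^-1 <= 1 / 2 by rewrite -div1r ler_pdivrMr; have := m6R; lra.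
move=> h2; rewrite -(pmulr_lgt0 _ (_ : 0 < mR + 1)); lra.
Qed.

Definition xo a := wt [predI out a & B].
Definition yi a := wt [predI inn a & B].
Definition f a := xo a ^+ k * yi a ^+ l.

(* Almost all stars centered at a have their leaves in B, and first_order prescribes their mass. *)
Lemma f_ge a : A a -> 0 < w a -> 7 / 20 * g <= f a.
Proof.
move=> Aa wa; have h0 := center_ge Aa.
have h1 : M [pred phi : star | phi None == a] <=
    M [pred phi : star | (phi None == a) && leaves_in B phi] +
    M [pred phi : star | (phi None == a) && [exists t, A (phi (Some t))]].
  apply: M_or => // phi _ /= ->; rewrite /= orbC; exact: leaves_inA_or.
have h2 : M [pred phi : star | (phi None == a) && leaves_in B phi] <= w a * f a.
  exact: star_center_le.
have h3 : M [pred phi : star | (phi None == a) && [exists t, A (phi (Some t))]] <= w a * (g * Ld).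
  apply: le_trans (M_exists w_ge0 (D := A)
    (Q := fun a' => [pred phi : star | [exists t, (phi (Some t) == a') && (phi None == a)]]) _) _.
    move=> phi _ /andP[e /existsP[t At]]; exists (phi (Some t)) => //.
    by apply/existsP; exists t; rewrite eqxx.
  apply: le_trans (_ : \sum_(a' | A a') w a' * (w a * (g * Ld)) <= _); last first.
    by rewrite -mulr_suml -[leRHS]mul1r ler_wpM2r ?wt_le1 //; exact: mulr_ge0 (w_ge0 a) (mulr_ge0 (ltW g0) Ld0).
  apply: ler_sum => a' Aa'.
  apply: le_trans (M_exists w_ge0 (D := predT)
    (Q := fun t => [pred phi : star | [&& phi (Some t) == a', leaves_in predT phi & pred1 a (phi None)]]) _) _.
    move=> phi _ /existsP[t /andP[h h']]; exists t => //; apply/and3P; split=> //; exact/forallP.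
  apply: le_trans (star_leaf_sum E w_ge0 k_gt0 l_gt0 a' (pred1 a) predT) _.
  have hs : \sum_(c | pred1 a c && adj c a') w c * wt (rest c a' predT) ^+ m.-1 <= w a * (3 / 20) ^+ m.-1.
    rewrite big_mkcondr /= big_pred1_eq; have /andP[d0 d1] := degA Aa'.
    have e0 : 0 <= (3 / 20) ^+ m.-1 :> R by apply: exprn_ge0; lra.
    case: ifP => _; last exact: mulr_ge0.
    rewrite ler_wpM2l //; apply: wt_exp.
    by apply: le_trans (rest_le a a' predT) _; rewrite nadj_wt.
  apply: le_trans (ler_wpM2l (wLg a') hs) _; lra.
have h4 : w a * ((mR + 1) * T - 2 * (g * Ld)) <= w a * f a by lra.
rewrite ler_pM2l // in h4; apply: le_trans h4.
have := @theta_delta R m m6 => h5; have := ler_wpM2l (ltW g0) h5; have := T_ge; lra.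
Qed.

(** * Adjacent pairs inside B *)

Local Notation eps := ((6 * (mR - 1))^-1 : R).
Local Notation single := (single E).
Local Notation badsum := (badsum l E w).
Local Notation pair := (pair E w).
Local Notation bad := (bad l E).
Let k_gt1 : (1 < k)%N. Proof. by move: lk m6; clear; lia. Qed.

(* B2 collects the low-degree vertices pointing to almost all of A. For l = 1 the adjacent
   pairs inside B2 destroy too few stars centered in A, and B2 is estimated separately. *)
Definition pb b := wt [predI out b & A].
Definition B2 : pred V := fun b => [&& l == 1%N, B b & (1 - eps) * al <= pb b].
Definition B1 : pred V := fun b => B b && ~~ B2 b.
Arguments B1 : simpl never.
Arguments B2 : simpl never.
(** Vertices of [B] joined to a by no arc or by both, hence never leaves of a star centered at a.
    [Zt], the total weight of such pairs, is the quantity to which mixed stars are charged. *)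
Definition za a := wt [pred b | B b && ~~ single a b].
Definition Zb b := wt [pred a | A a && ~~ single a b].
Definition Zt := \sum_(a | A a) w a * za a.
(** By symmetry of [pair], [E1] + [E2] is the weight of the ordered adjacent pairs of [B] that are
    not inside [B2]. *)
Definition E1 := pair B1 B.
Definition E2 := pair B1 B2.

Lemma B2_B b : B2 b -> B b. Proof. by case/and3P. Qed.

Lemma eps01 : 0 < eps <= 30^-1.
Proof.
have h := m6R; apply/andP; split; first by rewrite invr_gt0; lra.
by rewrite lef_pV2 ?posrE; lra.
Qed.

Lemma vBE b : vB b = wt [pred x | B x && adj b x].
Proof. by apply: eq_wt => x; rewrite /= andbC. Qed.

Lemma ZtE : Zt = \sum_(b | B b) w b * Zb b.
Proof.
rewrite /Zt /za /Zb /wt.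
under eq_bigr do rewrite mulr_sumr.
rewrite (exchange_big_dep B) /=; last by move=> a b _ /andP[].
apply: eq_bigr => b Bb; rewrite mulr_sumr.
by apply: eq_big => [a|a _]; [rewrite Bb | rewrite mulrC].
Qed.

Lemma Zt_ge0 : 0 <= Zt.
Proof. by apply: sumr_ge0 => a _; rewrite mulr_ge0 // wt0. Qed.

(* When b and b' are adjacent and not both in B2, a weight eps * alpha of A, up to the
   exceptional weights Zb, is single-arc joined to both without having both as leaves of a star. *)
Lemma inner b b' : B b -> B b' -> adj b b' ->
  (if B2 b && B2 b' then 0 else eps * al) - Zb b - Zb b' <=
  wt [pred a | [&& A a, single a b, single a b' & bad a b b']].
Proof.
move=> Bb Bb' hadj; set tgt := wt _.
have t0 : 0 <= tgt by exact: wt0.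
have z0 : 0 <= Zb b by exact: wt0.
have z1 : 0 <= Zb b' by exact: wt0.
case: ifP => hB; first by lra.
pose X := [pred a | [&& A a, l == 1%N, inn a b & inn a b']].
have hX : wt X <= (1 - eps) * al.
  have aux c : B c -> ~~ B2 c -> (forall a, X a -> [predI out c & A] a) -> wt X <= (1 - eps) * al.
    move=> Bc nB2; have : ~~ ((l == 1%N) && ((1 - eps) * al <= pb c)).
      by apply: contra nB2 => /andP[h1 h2]; apply/and3P.
    case: eqP => [_|l1] /=.
      by rewrite -ltNge => /ltW h hx; apply: le_trans h; exact: le_wt.
    move=> _ _; apply: le_trans (_ : 0 <= _).
      by rewrite /wt big1 // => a /and3P[_ /eqP].
    have := al_ge0; have := eps01 => /andP[e0 e1] a0; apply: mulr_ge0 => //; lra.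
  move: (negbT hB); rewrite negb_and => /orP[nb|nb].
    by apply: (aux b) => // a /and4P[Aa _ h _]; apply/andP.
  by apply: (aux b') => // a /and4P[Aa _ _ h]; apply/andP.
have : al <= (tgt + wt X) + (Zb b + Zb b').
  pose P1 := [pred a | [&& A a, single a b, single a b' & bad a b b'] || X a].
  pose P2 := [pred a | (A a && ~~ single a b) || (A a && ~~ single a b')].
  have h1 : wt P1 <= tgt + wt X by apply: le_wtD.
  have h2 : wt P2 <= Zb b + Zb b' by apply: le_wtD.
  apply: le_trans (_ : wt P1 + wt P2 <= _); last exact: lerD.
  apply: le_wtD => // a Aa; apply/orP.
  case: (boolP (single a b)) => s1; last by right; apply/orP; left; apply/andP.
  case: (boolP (single a b')) => s2; last by right; apply/orP; right; apply/andP.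
  left; apply/orP; case: (boolP (bad a b b')) => hb; [by left; apply/and4P|right].
  by move: hb; rewrite /bad hadj /= negbK => /and3P[h3 h4 h5]; apply/and4P.
lra.
Qed.

Lemma badsumE a : badsum a B = \sum_(b | B b) \sum_(b' | B b' && adj b b')
  (if [&& single a b, single a b' & bad a b b'] then w b * w b' else 0).
Proof.
rewrite /badsum big_mkcond [RHS]big_mkcond /=; apply: eq_bigr => b _.
case: (boolP (B b)) => Bb; rewrite ?andbT ?andbF //.
case: (boolP (single a b)) => sb /=; last by rewrite big1_eq.
rewrite /wt mulr_sumr big_mkcond [RHS]big_mkcond /=; apply: eq_bigr => b' _.
case: (boolP (B b')) => Bb'; rewrite ?andbF //=.
case: (boolP (adj b b')) => h; first by case: (single a b').
by rewrite /bad (negbTE h) /= andbF.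
Qed.

Lemma pair_mono (S S' Z Z' : pred V) : (forall x, S x -> S' x) -> (forall x, Z x -> Z' x) ->
  pair S Z <= pair S' Z'.
Proof.
move=> h1 h2; rewrite /pair big_mkcond [leRHS]big_mkcond; apply: ler_sum => x _.
case: (boolP (S x)) => [/h1 ->|_].
  by rewrite ler_wpM2l //; apply: le_wt => // y /andP[/h2 h ha]; apply/andP.
by case: ifP => // _; rewrite mulr_ge0.
Qed.

(** Double counting over ordered adjacent pairs (b, b'), each spoiling the centers counted by
    [inner]. The two corrections [Zb] contribute equally by symmetry, each at most [Zt] / m because
    neighbours in [B] of a vertex of [B] weigh at most 1/m. *)
Lemma bad_lower : eps * al * (E1 + E2) - 2 / mR * Zt <= \sum_(a | A a) w a * badsum a B.
Proof.
have ea0 : 0 <= eps * al.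
  by have /andP[e0 _] := eps01; apply: mulr_ge0 al_ge0; exact: ltW.
have -> : \sum_(a | A a) w a * badsum a B = \sum_(b | B b) w b * (\sum_(b' | B b' && adj b b')
    w b' * wt [pred a | [&& A a, single a b, single a b' & bad a b b']]).
  under eq_bigr do rewrite badsumE mulr_sumr.
  rewrite exchange_big /=; apply: eq_bigr => b _; rewrite mulr_sumr.
  under eq_bigr do rewrite mulr_sumr.
  rewrite exchange_big /=; apply: eq_bigr => b' _.
  rewrite /wt !mulr_sumr big_mkcond [RHS]big_mkcond /=; apply: eq_bigr => a _.
  case: (boolP (A a)) => Aa //=; case: ifP => _; last by rewrite mulr0.
  by rewrite mulrC mulrA.
apply: le_trans (_ : \sum_(b | B b) w b * (\sum_(b' | B b' && adj b b')
    w b' * ((if B2 b && B2 b' then 0 else eps * al) - Zb b - Zb b')) <= _); last first.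
  apply: ler_sum => b Bb; rewrite ler_wpM2l //; apply: ler_sum => b' /andP[Bb' h].
  by rewrite ler_wpM2l // inner.
have h1 : eps * al * (E1 + E2) <= \sum_(b | B b) w b * (\sum_(b' | B b' && adj b b')
    w b' * (if B2 b && B2 b' then 0 else eps * al)).
  rewrite (bigID B2) /= addrC mulrDr; apply: lerD.
    rewrite /E1 /pair mulr_sumr le_eqVlt; apply/orP; left; apply/eqP.
    apply: eq_bigr => b /andP[Bb /negbTE nb]; rewrite mulrCA; congr (_ * _).
    by rewrite /wt mulr_sumr; apply: eq_bigr => b' _; rewrite nb mulrC.
  rewrite /E2 pairC /pair mulr_sumr.
  rewrite (eq_bigl B2); last by move=> b /=; apply/idP/idP => [/andP[]//|h]; rewrite (B2_B h).
  apply: ler_sum => b hb; rewrite mulrCA ler_wpM2l // hb /=.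
  rewrite /wt mulr_sumr big_mkcond [leRHS]big_mkcond /=; apply: ler_sum => b' _.
  case: (boolP (B1 b' && adj b b')) => [/andP[/andP[h1 h2] ->]|_].
    by rewrite h1 (negbTE h2) /= [leRHS]mulrC.
  case: ifP => // _; apply: mulr_ge0 => //. case: ifP => _ //.
have h2 : \sum_(b | B b) w b * (\sum_(b' | B b' && adj b b') w b' * Zb b) =
    \sum_(b | B b) w b * (\sum_(b' | B b' && adj b b') w b' * Zb b').
  under eq_bigr do rewrite mulr_sumr; under [RHS]eq_bigr do rewrite mulr_sumr.
  rewrite (exchange_big_dep B) /=; last by move=> x y _ /andP[].
  apply: eq_bigr => b Bb; apply: eq_big => [b'|b' _]; first by rewrite Bb adjC.
  by rewrite mulrCA.
have h3 : \sum_(b | B b) w b * (\sum_(b' | B b' && adj b b') w b' * Zb b) <= mR^-1 * Zt.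
  rewrite ZtE mulr_sumr; have mp : 0 < mR by have := m6R; lra.
  apply: ler_sum => b Bb; rewrite mulrCA.
  have := w_ge0 b; rewrite le_eqVlt => /orP[/eqP <-|wb]; first by rewrite !mul0r.
  rewrite ler_pM2l // -mulr_suml -[X in X * _]/(wt _) -vBE.
  by rewrite ler_wpM2r ?wt0 // -div1r ler_pdivlMr // vB_le.
have -> : \sum_(b | B b) w b * (\sum_(b' | B b' && adj b b')
    w b' * ((if B2 b && B2 b' then 0 else eps * al) - Zb b - Zb b')) =
  \sum_(b | B b) w b * (\sum_(b' | B b' && adj b b') w b' * (if B2 b && B2 b' then 0 else eps * al))
  - \sum_(b | B b) w b * (\sum_(b' | B b' && adj b b') w b' * Zb b)
  - \sum_(b | B b) w b * (\sum_(b' | B b' && adj b b') w b' * Zb b').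
  rewrite -!sumrB; apply: eq_bigr => b _; rewrite -!mulrBr -!sumrB; congr (_ * _).
  by apply: eq_bigr => b' _; rewrite -!mulrBr.
rewrite -h2; lra.
Qed.

Lemma badsum0 a : 0 <= badsum a B. Proof. exact: badsum_ge0. Qed.

Lemma xo_yi a : xo a + yi a <= 1.
Proof. by apply: le_trans (wt_out_inn E w_ge0 a B) _; exact: wt_le1. Qed.

(** * Stars sorted by the sides of their center and leaves *)

Lemma T2_le : M [pred phi : star | leaves_in B phi && A (phi None)] <=
  \sum_(a | A a) w a * f a - 7 / 20 * g * \sum_(a | A a) w a * badsum a B.
Proof.
rewrite (M_part_in w (f := fun phi => phi None) (D := A)); last by move=> phi _ /andP[].
rewrite mulr_sumr -sumrB; apply: le_trans (_ : \sum_(a | A a) w a * (f a * (1 - badsum a B)) <= _).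
  apply: ler_sum => a Aa; rewrite mulrA.
  have hk : M [pred phi : star | (phi None == a) && leaves_in B phi] <= w a * f a * (1 - badsum a B).
    apply: star_kill => //; exact: xo_yi.
  apply: le_trans hk.
  by apply: le_M => // phi _ /andP[/andP[h1 _] h2]; apply/andP.
apply: le_trans (_ : \sum_(a | A a) w a * (f a - 7 / 20 * g * badsum a B) <= _).
  apply: ler_sumw => a Aa wa; have := f_ge Aa wa; have := badsum0 a => b0 h.
  have := ler_wpM2r b0 h; lra.
by rewrite le_eqVlt; apply/orP; left; apply/eqP; apply: eq_bigr => a _; ring.
Qed.

Lemma mp : 0 < mR. Proof. by have := m6R; lra. Qed.
Lemma im0 : 0 <= mR^-1. Proof. by rewrite invr_ge0 ltW // mp. Qed.

Lemma vB_inv b : 0 < w b -> B b -> vB b <= mR^-1.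
Proof. by move=> wb Bb; rewrite -div1r ler_pdivlMr ?mp // vB_le. Qed.

Lemma E2_le : E2 <= E1. Proof. by apply: pair_mono => // x; exact: B2_B. Qed.

(** One of the m factors [vB b] is kept to form the pair weight [E1]; the others are bounded by
    1/m. *)
Lemma T3a_le : M [pred phi : star | leaves_in B phi && B1 (phi None)] <= g * mR^-1 ^+ m.-1 * E1.
Proof.
rewrite (M_part_in w (f := fun phi => phi None) (D := B1)); last by move=> phi _ /andP[].
apply: le_trans (_ : \sum_(b | B1 b) w b * (g * vB b ^+ m) <= _).
  apply: ler_sum => b Bb; apply: le_trans (star_center_pow k l E w_ge0 b B).
  by apply: le_M => // phi _ /andP[/andP[h1' _] h2']; apply/andP.
rewrite /E1 /pair mulr_sumr.
apply: le_trans (_ : \sum_(b | B1 b) w b * (g * mR^-1 ^+ m.-1 * vB b) <= _).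
  apply: ler_sumw => b /andP[Bb _] wb; rewrite -mulrA ler_pM2l // -[X in _ ^+ X](prednK m_gt0) exprSr.
  by rewrite ler_wpM2r ?wt0 //; apply: wt_exp; exact: vB_inv.
by rewrite le_eqVlt; apply/orP; left; apply/eqP; apply: eq_bigr => b _; rewrite vBE; ring.
Qed.

Lemma T3b_le : M [pred phi : star | [&& leaves_in B phi, B2 (phi None) & [exists t, B1 (phi (Some t))]]] <=
  g * mR^-1 ^+ m.-1 * (L * E2).
Proof.
apply: le_trans (M_exists w_ge0 (D := B1) (Q := fun b =>
  [pred phi : star | [exists t, [&& phi (Some t) == b, leaves_in B phi & B2 (phi None)]]]) _) _.
  move=> phi _ /and3P[h1 h2 /existsP[t ht]]; exists (phi (Some t)) => //.
  by apply/existsP; exists t; rewrite eqxx /= h1.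
rewrite /E2 /pair !mulr_sumr; apply: ler_sum => b Bb.
apply: le_trans (M_exists w_ge0 (D := predT) (Q := fun t =>
  [pred phi : star | [&& phi (Some t) == b, leaves_in B phi & B2 (phi None)]]) _) _.
  by move=> phi _ /existsP[t h]; exists t.
apply: le_trans (star_leaf_sum E w_ge0 k_gt0 l_gt0 b B2 B) _.
apply: le_trans (ler_wpM2l (wLg b) (_ : _ <= wt [pred c | B2 c && adj c b] * mR^-1 ^+ m.-1)) _.
  apply: (sum_wt_le (S := [pred c | B2 c && adj c b])) => c /andP[/B2_B Bc _] wc.
  by apply: wt_exp; apply: le_trans (rest_le_deg _ _ _) (vB_inv wc Bc).
rewrite (eq_wt w (S := [pred x | B2 x && adj b x])); last by move=> x; rewrite /= adjC.
by rewrite le_eqVlt; apply/orP; left; apply/eqP; ring.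
Qed.

(** If the neighbours in [B2] of the chosen out-leaf weigh u, the center lies among them and the
    other leaves among the rest of [B2], of weight s - u; then u (s - u)^(m - 1) <= s^m / L. *)
Lemma T33_le : M [pred phi : star | leaves_in B2 phi && B2 (phi None)] <=
  gam R k.-1 l * (wt B2 * (wt B2 ^+ m / L)).
Proof.
pose i0 : 'I_k := Ordinal k_gt0.
have C0 := gam_ge0 R k.-1 l.
apply: le_trans (_ : \sum_(b | B2 b) w b * (gam R k.-1 l * (wt B2 ^+ m / L)) <= _); last first.
  by rewrite -mulr_suml mulrCA.
rewrite (M_part_in w (f := fun phi => phi (Some (inl i0))) (D := B2)); last first.
  by move=> phi _ /andP[/forallP h _]; exact: h.
apply: ler_sum => b Bb.
apply: le_trans (le_trans _ (star_out_leaf E w_ge0 k_gt0 l_gt0 i0 b B2 B2)) _.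
  by apply: le_M => // phi _ /andP[/andP[h1' h2'] h3']; apply/and3P.
rewrite -[leLHS]mulrA ler_wpM2l // ler_wpM2l // ler_pdivlMr //.
set u := wt [pred x | B2 x && adj b x].
have su : wt [pred x | B2 x && ~~ adj b x] = wt B2 - u by rewrite (wtID w B2 (adj b)) addrAC subrr add0r.
have u0 : 0 <= u by exact: wt0.
have us : u <= wt B2 by apply: le_wt => // x /andP[].
have hs : \sum_(c | B2 c && out c b) w c * wt (rest c b B2) ^+ m.-1 <= u * (wt B2 - u) ^+ m.-1.
  apply: le_trans (sum_wt_le (S := [pred c | B2 c && out c b]) (r := (wt B2 - u) ^+ m.-1) _) _.
    by move=> c _ _; apply: wt_exp; rewrite -su; exact: rest_le.
  apply: ler_wpM2r; first by rewrite exprn_ge0 // subr_ge0.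
  by apply: le_wt => // x /andP[h1 h2]; apply/andP; split=> //; rewrite adjC; exact: (out_adj h2).
rewrite mulrC; apply: le_trans (ler_wpM2l (ltW L0) hs) _.
by apply: Lam_mul => //; rewrite u0.
Qed.

Lemma T4_le : M [pred phi : star | [exists t, A (phi (Some t))] && [exists t, B (phi (Some t))]] <=
  g * (L * Lam R m.-1 * (3 / 20) ^+ m.-2) * Zt.
Proof.
apply: le_trans (M_exists w_ge0 (D := A) (Q := fun a =>
  [pred phi : star | [exists t, [exists t', [&& t' != t, phi (Some t) == a & B (phi (Some t'))]]]]) _) _.
  move=> phi _ /andP[/existsP[t ht] /existsP[t' ht']]; exists (phi (Some t)) => //.
  apply/existsP; exists t; apply/existsP; exists t'; rewrite eqxx /= ht' andbT.
  by apply/eqP => e; move: ht'; rewrite e /B /= ht.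
rewrite /Zt mulr_sumr; apply: ler_sum => a Aa.
apply: le_trans (M_exists w_ge0 (D := predT) (Q := fun t =>
  [pred phi : star | [exists t', [&& t' != t, phi (Some t) == a & B (phi (Some t'))]]]) _) _.
  by move=> phi _ /existsP[t h]; exists t.
apply: le_trans (_ : \sum_t \sum_(t' | t' != t) M [pred phi : star | (phi (Some t) == a) && B (phi (Some t'))] <= _).
  apply: ler_sum => t _; apply: (M_exists w_ge0) => phi _ /existsP[t' /and3P[h1 h2 h3]].
  by exists t' => //; apply/andP.
have wT1 : wt predT <= 1 by rewrite wT.
have hr : wt [pred x | ~~ adj a x] <= 3 / 20.
  by rewrite nadj_wt; case/andP: (degA Aa).
have hz : wt [pred x | B x && ~~ adj a x] <= za a.
  apply: le_wt => // x /andP[Bx h]; apply/andP; split=> //; apply: contra h.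
  by case/orP; [exact: out_adj | exact: inn_adj].
apply: le_trans (star_mixed w_ge0 k_gt0 l_gt0 wT1 hr hz) _.
by rewrite le_eqVlt; apply/orP; left; apply/eqP; ring.
Qed.

(** Counting the useless vertices as in-neighbours makes the two arguments add up to [be] ([xyz]);
    the increase over [f] pays for the mixed stars ([ft_ge]). *)
Definition ft a := xo a ^+ k * (yi a + za a) ^+ l.

Lemma xyz a : xo a + (yi a + za a) = be.
Proof.
rewrite /be (wtID w B (single a)) addrA; congr (_ + _).
rewrite (wtID w [predI B & single a] (out a)); congr (_ + _); apply: eq_wt => x.
  rewrite -[LHS]/(out a x && B x) -[RHS]/((B x && single a x) && out a x) /single.
  by case: (out a x); rewrite ?andbF ?andbT.
rewrite -[LHS]/(inn a x && B x) -[RHS]/((B x && single a x) && ~~ out a x) /single.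
case: (boolP (out a x)) => h; first by rewrite (out_inn h) andbF.
by rewrite andbT andbC.
Qed.

Lemma ft_ge a : A a -> 0 < w a -> f a + 7 / 20 * g * za a <= ft a.
Proof.
move=> Aa wa; have hf := f_ge Aa wa.
have x0 : 0 <= xo a by exact: wt0. have y0 : 0 <= yi a by exact: wt0.
have z0 : 0 <= za a by exact: wt0.
have y1 : yi a <= 1 by exact: wt_le1.
have h1 : (yi a * (1 + za a)) ^+ l <= (yi a + za a) ^+ l.
  by apply: ler_exp; [apply: mulr_ge0 => // | ]; nra.
have h2 : 1 + za a <= (1 + za a) ^+ l.
  by rewrite -[X in X <= _]expr1; apply: ler_weXn2l => //; lra.
have f0 : 0 <= f a by apply: mulr_ge0; apply: exprn_ge0.
have h3 : f a * (1 + za a) <= f a * (1 + za a) ^+ l by apply: ler_wpM2l.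
have h4 := ler_wpM2l (exprn_ge0 k x0) h1; rewrite exprMn in h4.
have h5 := ler_wpM2r z0 hf; rewrite /ft; rewrite /f in h3 h5 *; lra.
Qed.

(** Stars with all leaves in [B] and center in [B], except those inside [B2], are charged to the
    loss in [T2_le] through [kill_num]; mixed stars and the error of [bad_lower] are charged to the
    increase from [f] to [ft] through [mixed_num]. *)
Lemma main_split : T <= M [pred phi : star | leaves_in A phi] +
  (\sum_(a | A a) w a * ft a + gam R k.-1 l * (wt B2 * (wt B2 ^+ m / L))).
Proof.
have h0 : T <= M [pred phi : star | leaves_in A phi] + M [pred phi : star | [exists t, B (phi (Some t))]].
  by apply: M_or => // phi _ _; rewrite /= /leaves_in /B /= -negb_forall orbN.
have h1 : M [pred phi : star | [exists t, B (phi (Some t))]] <=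
   M [pred phi : star | [exists t, A (phi (Some t))] && [exists t, B (phi (Some t))]] +
   M [pred phi : star | leaves_in B phi].
  apply: M_or => // phi _ /= ->; rewrite andbT; exact: leaves_inA_or.
have h2 : M [pred phi : star | leaves_in B phi] <= M [pred phi : star | leaves_in B phi && A (phi None)] +
   M [pred phi : star | leaves_in B phi && B (phi None)].
  by apply: M_or => // phi _ /= ->; rewrite /= orbN.
have h3 : M [pred phi : star | leaves_in B phi && B (phi None)] <=
   M [pred phi : star | leaves_in B phi && B1 (phi None)] + M [pred phi : star | leaves_in B phi && B2 (phi None)].
  apply: M_or => // phi _ /andP[h1' h2']; rewrite -[X in X || _]/(_ && (_ && _)) -[X in _ || X]/(_ && _).
  by rewrite h1' h2' /=; case: (B2 _).
have h4 : M [pred phi : star | leaves_in B phi && B2 (phi None)] <=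
   M [pred phi : star | leaves_in B2 phi && B2 (phi None)] +
   M [pred phi : star | [&& leaves_in B phi, B2 (phi None) & [exists t, B1 (phi (Some t))]]].
  apply: M_or => // phi _ /andP[h1' h2']; apply/orP.
  case: (boolP (leaves_in B2 phi)) => [h|hn]; [left|right]; first by apply/andP.
  move: hn; rewrite /leaves_in negb_forall => /existsP[t ht]; apply/and3P; split=> //.
  by apply/existsP; exists t; apply/andP; split=> //; move/forallP: h1'; exact.
have hk := kill_num m6 al_ge; have hm := @mixed_num R m m6.
have m_gt1 : (1 < m)%N by exact: leq_trans m6.
have hL : 1 <= L by have := Lam_ge R m_gt1; have := m6R; lra.
have hE := E2_le; have E20 : 0 <= E2 by apply: sumr_ge0 => *; rewrite mulr_ge0.
have hT2 := T2_le; have hT3a := T3a_le; have hT3b := T3b_le; have hT33 := T33_le; have hT4 := T4_le.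
have hb := bad_lower; have Z0 := Zt_ge0.
have hft : \sum_(a | A a) w a * f a + 7 / 20 * g * Zt <= \sum_(a | A a) w a * ft a.
  rewrite /Zt mulr_sumr -big_split /=.
  apply: le_trans (_ : \sum_(a | A a) w a * (f a + 7 / 20 * g * za a) <= _).
    by rewrite le_eqVlt; apply/orP; left; apply/eqP; apply: eq_bigr => a _; ring.
  apply: ler_sumw; exact: ft_ge.
set q := mR^-1 ^+ m.-1 in hk hT3a hT3b.
have q0 : 0 <= q by exact: exprn_ge0 im0.
set S2 := \sum_(a | A a) w a * badsum a B in hT2 hb.
set zeta := L * Lam R m.-1 * (3 / 20) ^+ m.-2 in hT4.
have hm' : zeta + 2 / mR * (7 / 20) <= 7 / 20 by move: hm; rewrite subn2.
(* [E2] <= [E1] and 1 <= L permit averaging the coefficients 1 and L. *)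
have e1 : g * q * E1 + g * q * (L * E2) <= g * ((1 + L) / 2 * q) * (E1 + E2).
  have : 0 <= g * q * ((L - 1) * (E1 - E2)).
    by apply: mulr_ge0; [exact: mulr_ge0 (ltW g0) q0 | apply: mulr_ge0; lra].
  lra.
have e2 : g * ((1 + L) / 2 * q) * (E1 + E2) <= g * (7 / 20 * (eps * al)) * (E1 + E2).
  by apply: ler_wpM2r; [lra | rewrite ler_pM2l].
have e3 : 7 / 20 * g * (eps * al * (E1 + E2) - 2 / mR * Zt) <= 7 / 20 * g * S2.
  by rewrite ler_pM2l //; have := g0; lra.
have e4 : g * (zeta + 2 / mR * (7 / 20)) * Zt <= g * (7 / 20) * Zt.
  by apply: ler_wpM2r => //; rewrite ler_pM2l.
lra.
Qed.

(** * More out-leaves than in-leaves *)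

Local Notation C := (gam R k.-1 l).
Let C0 : 0 <= C. Proof. exact: gam_ge0. Qed.
Let mpredR : m.-1%:R = mR - 1.
Proof. by rewrite -[in RHS](prednK m_gt0) -natr1 addrK. Qed.

Definition w1 a := wt [predI inn a & B1].
Definition w2 a := wt [predI inn a & B2].
Definition ua a := wt [pred x | A x && adj a x].
Definition P2 := \sum_(b | B2 b) w b * pb b.

Lemma yi_split a : yi a = w1 a + w2 a.
Proof.
rewrite /yi (wtID w _ B2) addrC; congr (_ + _); apply: eq_wt => x.
  by rewrite -[LHS]/((inn a x && B x) && ~~ B2 x) -[RHS]/(inn a x && (B x && ~~ B2 x)) andbA.
rewrite -[LHS]/((inn a x && B x) && B2 x) -[RHS]/(inn a x && B2 x).
by case: (boolP (B2 x)) => [/B2_B ->|_]; rewrite ?andbF ?andbT.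
Qed.

Lemma P2E : P2 = \sum_(a | A a) w a * w2 a.
Proof.
rewrite /P2 /pb /w2 /wt.
under eq_bigr do rewrite mulr_sumr; under [RHS]eq_bigr do rewrite mulr_sumr.
rewrite (exchange_big_dep A) /=; last by move=> x y _ /andP[].
apply: eq_bigr => a Aa; apply: eq_big => [b|b _]; last by rewrite mulrC.
by rewrite -[RHS]/(out b a && B2 b) andbC -[(_ \in out b) && _]/(out b a && A a) Aa andbT.
Qed.

(* Fixing the out-leaf inl i0 at a, the remaining m - 1 leaves lie in A and avoid the
   neighbours of a. *)
Lemma T1_leaf (Zc : pred V) : M [pred phi : star | leaves_in A phi && Zc (phi None)] <=
  \sum_(a | A a) w a * (C * (wt [pred c | Zc c && out c a] * (al - ua a) ^+ m.-1)).
Proof.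
pose i0 : 'I_k := Ordinal k_gt0.
rewrite (M_part_in w (f := fun phi => phi (Some (inl i0))) (D := A)); last first.
  by move=> phi _ /andP[/forallP h _]; exact: h.
apply: ler_sum => a Aa.
apply: le_trans (le_trans _ (star_out_leaf E w_ge0 k_gt0 l_gt0 i0 a Zc A)) _.
  by apply: le_M => // phi _ /andP[/andP[h1' h2'] h3']; apply/and3P.
rewrite -[leLHS]mulrA ler_wpM2l // ler_wpM2l //.
have su : wt [pred x | A x && ~~ adj a x] = al - ua a.
  by rewrite /al (wtID w A (adj a)) addrAC subrr add0r.
apply: (sum_wt_le (S := [pred c | Zc c && out c a])) => c _ _.
by apply: wt_exp; rewrite -su; exact: rest_le.
Qed.

(** The factor 2 is there because [T1_num] will be applied to [w1 a] + [w2 a] / 2, which is only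
    known to be at least half of [yi a]. *)
Lemma yi_low a : (l < k)%N -> A a -> 0 < w a -> 2 * (al / m.-1%:R) <= yi a.
Proof.
move=> ltlk Aa wa; have hf := f_ge Aa wa; have hm := m6R.
have x0 : 0 <= xo a by exact: wt0. have y0 : 0 <= yi a by exact: wt0.
suff h : 2 / (mR * (mR - 1)) <= yi a.
  apply: le_trans h; rewrite mpredR.
  have i1 : 0 < (mR - 1)^-1 by rewrite invr_gt0; lra.
  have h1 : al <= mR^-1 by rewrite -div1r ler_pdivlMr ?mp // al_le.
  rewrite invfM; have := ler_wpM2r (ltW i1) h1; lra.
have [l1|l1] := eqVneq l 1%N.
  have mk : mR = k%:R + 1 by rewrite l1 natrD.
  have hb : be * (k%:R + 2) <= k%:R + 1 + (30 * (k%:R + 1))^-1.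
    rewrite be_al -mk; have := al_ge; rewrite mk; lra.
  have := @ylow1 R k (xo a) (yi a) be.
  rewrite mk (_ : k%:R + 1 - 1 = k%:R); last by ring.
  apply => //.
  - by move: m6; rewrite l1 addn1.
  - by rewrite -(xyz a) addrA lerDl; exact: wt0.
  - by move: hf; rewrite /f l1 expr1.
have l2 : (1 < l)%N by move: l_gt0 l1; case: (l) => [|[|]].
apply: (@ylow_ge2 R k l (xo a)) => //; rewrite x0 /=; exact: wt_le1.
Qed.

Lemma w1_bound a : wt [pred c | ~~ B2 c && out c a] <= w1 a + ua a.
Proof.
apply: le_wtD => // c /andP[nb h]; apply/orP.
case: (boolP (A c)) => Ac; [right|left]; apply/andP; split=> //.
  by rewrite adjC; exact: out_adj h.
by apply/andP.
Qed.

(** A vertex of [B2] points to nearly all of [A], so it has hardly any in-neighbours there and is a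
    poor center; [slack_num] makes this a factor 1/2. *)
Lemma X2_le : M [pred phi : star | leaves_in A phi && B2 (phi None)] <= C / 2 * al ^+ m.-1 * P2.
Proof.
rewrite (M_part_in w (f := fun phi => phi None) (D := B2)); last by move=> phi _ /andP[].
rewrite /P2 mulr_sumr; apply: ler_sum => b Bb.
apply: le_trans (le_trans _ (star_center_le k l E w_ge0 b A)) _.
  by apply: le_M => // phi _ /andP[/andP[h1' h2'] h3']; apply/andP.
rewrite [leRHS]mulrCA ler_wpM2l //.
case/and3P: Bb => /eqP l1 Bb hp.
have k5 : (4 <= k.-1)%N by move: m6; rewrite l1 addn1 ltnS; case: (k).
have mk : mR = k%:R + 1 by rewrite l1 natrD.
have q0 : 0 <= wt [predI inn b & A] by exact: wt0.
have hs : pb b + wt [predI inn b & A] <= al.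
  by apply: le_trans (wt_out_inn E w_ge0 b A) _; apply: le_wt => // x /andP[].
have := @slack_num R k.-1 al (pb b) _ k5 q0 hs al_ge0.
have ek : k.-1%:R + 1 = k%:R :> R by rewrite natr1 prednK.
rewrite ek prednK //; move: hp; rewrite mk addrK => hp /(_ hp).
by rewrite l1 expr1 addn1.
Qed.

(** Stars centered in [B2] are bounded by the average of [T1_leaf] and [X2_le]. The first half turns
    [w2] into [w2] / 2, saving P2/2, and the second costs P2/4; the remaining P2/4 will pay for the
    stars inside [B2]. *)
Lemma T1_gt : (l < k)%N -> M [pred phi : star | leaves_in A phi] <=
  C * al ^+ m.-1 * (\sum_(a | A a) w a * yi a - P2 / 4).
Proof.
move=> ltlk.
have h0 : M [pred phi : star | leaves_in A phi] <=
   M [pred phi : star | leaves_in A phi && ~~ B2 (phi None)] + M [pred phi : star | leaves_in A phi && B2 (phi None)].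
  by apply: M_or => // phi _ h; rewrite /= -andb_orr orNb andbT; exact: h.
have h1 := T1_leaf [pred c | ~~ B2 c]; have h2 := T1_leaf B2; have h3 := X2_le.
rewrite /= in h1.
set S1 := \sum_(a | A a) _ in h1; set S2 := \sum_(a | A a) _ in h2.
have hS : S1 + S2 / 2 <= \sum_(a | A a) w a * (C * ((w1 a + w2 a / 2) * al ^+ m.-1)).
  rewrite /S1 /S2 mulr_suml -big_split /=.
  apply: le_trans (_ : \sum_(a | A a) w a * (C * ((wt [pred c | ~~ B2 c && out c a] + w2 a / 2) * (al - ua a) ^+ m.-1)) <= _).
    rewrite le_eqVlt; apply/orP; left; apply/eqP; apply: eq_bigr => a _.
    have -> : wt [pred c | B2 c && out c a] = w2 a by apply: eq_wt => c; rewrite /= andbC.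
    by ring.
  apply: ler_sumw => a Aa wa; apply: ler_wpM2l => //.
  have uu : 0 <= ua a <= al by apply/andP; split; [exact: wt0 | apply: le_wt => // x /andP[]].
  have w10 : 0 <= w1 a by exact: wt0. have w20 : 0 <= w2 a by exact: wt0.
  have hy := yi_low ltlk Aa wa; rewrite yi_split in hy.
  have m1 : (0 < m.-1)%N by move: m6; case: (m) => [|[|]].
  have := @T1_num R m.-1 (w1 a + w2 a / 2) al (ua a) m1 uu; move=> /(_ _)/wrap[|]; first lra.
  apply: le_trans; rewrite ler_wpM2r //; first by rewrite exprn_ge0 // subr_ge0; case/andP: uu.
  by have := w1_bound a; lra.
have e : \sum_(a | A a) w a * (C * ((w1 a + w2 a / 2) * al ^+ m.-1)) =
   C * al ^+ m.-1 * (\sum_(a | A a) w a * yi a - P2 / 2).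
  rewrite P2E mulr_suml -sumrB mulr_sumr; apply: eq_bigr => a _; rewrite yi_split; lra.
rewrite e in hS; move: h0 h1 h2 h3 hS; set X := C * al ^+ m.-1.
rewrite (_ : C / 2 * al ^+ m.-1 * P2 = X * P2 / 2); last by rewrite /X; lra.
lra.
Qed.

(** Hence eps / (1 - eps) = 1/(6 m - 7): a vertex of [B2] receives single arcs from [A] of at most
    this fraction of the weight it points to. *)
Lemma inv_shift (x : R) : 6 <= x -> (6 * (x - 1))^-1 = (6 * x - 7)^-1 * (1 - (6 * (x - 1))^-1).
Proof. by move=> hx; field; rewrite !gt_eqF //; lra. Qed.

(** [B2] is empty unless l = 1. A vertex of [B2] of positive weight has too small a degree to be a
    center often, and too few in-neighbours in [A] to be an out-leaf often, so nearly all of its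
    mass (m + 1) T w(b) sits at the unique in-leaf. The masses at that position add up to at most
    T. *)
Lemma wtB2_tail : wt B2 ^+ m <= L / 4 * (1 - eps) * al ^+ m.
Proof.
have s0 : 0 <= wt B2 by exact: wt0.
have hm := m6R; have /andP[e0 e1] := eps01.
have [l1|l1] := eqVneq l 1%N; last first.
  have -> : wt B2 = 0 by rewrite /wt big1 // => b /and3P[/eqP h]; rewrite h eqxx in l1.
  rewrite expr0n gtn_eqF ?m_gt0 //=; apply: mulr_ge0; last exact: exprn_ge0 al_ge0.
  by apply: mulr_ge0; [have := L0; lra | lra].
pose j0 : 'I_l := Ordinal l_gt0.
pose t := (mR + 1) * T / g.
have tE : (mR + 1) * T = t * g by rewrite /t divfK // gt_eqF.
have tt : th <= t by rewrite /t ler_pdivlMr.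
pose rho : R := (6 * mR - 7)^-1 + L * (mR^-1 * (2 / mR) ^+ m.-1) + (2 / mR) ^+ m.
apply: (@tail_num R m al (wt B2) t) => //; [exact: al_ge0 | | exact: al_ge].
rewrite -/rho.
have mk : mR = k%:R + 1 by rewrite l1 natrD.
have inleaf b : B2 b -> 0 < w b -> w b * (g * (t - rho)) <= M [pred phi : star | phi (Some (inr j0)) == b].
  move=> hb wb; have Bb := B2_B hb; case/and3P: hb => _ _ hp.
  have hc : M [pred phi : star | phi None == b] <= w b * (g * (2 / mR) ^+ m).
    apply: le_trans (center_le b) _; rewrite ler_pM2l // ler_pM2l //; apply: wt_exp.
    exact: degB_le.
  have hout : \sum_(i < k) M [pred phi : star | phi (Some (inl i)) == b] <=
      w b * (g * ((6 * mR - 7)^-1 + L * (mR^-1 * (2 / mR) ^+ m.-1))).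
    have D2 : 0 <= 2 / mR by rewrite divr_ge0 // ltW // mp.
    have hs : \sum_(c | predT c && out c b) w c * wt (rest c b predT) ^+ m.-1 <=
        wt [pred c | out c b && A c] * (1 - pb b) ^+ m.-1 + mR^-1 * (2 / mR) ^+ m.-1.
      rewrite (bigID A) /=; apply: lerD.
        apply: (sum_wt_le (S := [pred c | out c b && A c])) => c _ _.
        apply: wt_exp; apply: le_trans (rest_le c b predT) _; rewrite nadj_wt lerD2l lerN2.
        by apply: le_wt => // x /andP[h _]; exact: out_adj h.
      apply: le_trans (sum_wt_le (S := [pred c | out c b && B c]) (r := (2 / mR) ^+ m.-1) _) _.
        move=> c /andP[_ Bc] wc; apply: wt_exp; apply: le_trans (rest_le_deg c b predT) _.
        rewrite (eq_wt w (S := adj c)); last by move=> x; rewrite /= andbT.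
        exact: degB_le.
      apply: ler_wpM2r; first exact: exprn_ge0.
      apply: le_trans (vB_inv wb Bb); apply: le_wt => // x /andP[h1 h2]; apply/andP; split=> //.
      by rewrite adjC; exact: out_adj h1.
    have hq : wt [pred c | out c b && A c] <= (6 * mR - 7)^-1 * pb b.
      have : pb b + wt [pred c | out c b && A c] <= al.
        apply: wt_disjoint => // [x /andP[]//|x /andP[]//|x /andP[h1 _] /andP[h2 _]].
        by have := out_inn h1; rewrite /inn => /negP; apply.
      set q := wt _; move=> hpq.
      have i7 : 0 < (6 * mR - 7)^-1 by rewrite invr_gt0; lra.
      have e3 : eps = (6 * mR - 7)^-1 * (1 - eps).
        exact: inv_shift.
      have : eps * al <= (6 * mR - 7)^-1 * pb b.
        by rewrite {1}e3 -mulrA ler_pM2l.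
      lra.
    have p0 : 0 <= pb b by exact: wt0. have p1 : pb b <= 1 by exact: wt_le1.
    have hs2 : L * (wt [pred c | out c b && A c] * (1 - pb b) ^+ m.-1) <= (6 * mR - 7)^-1.
      have i7 : 0 <= (6 * mR - 7)^-1 by rewrite invr_ge0; lra.
      have x0 : 0 <= (1 - pb b) ^+ m.-1 by apply: exprn_ge0; lra.
      have h1 := ler_wpM2l (ltW L0) (ler_wpM2r x0 hq).
      have h2 : L * (pb b * (1 - pb b) ^+ m.-1) <= 1 ^+ m by apply: Lam_mul => //; rewrite p0.
      rewrite expr1n in h2; have := ler_wpM2l i7 h2; lra.
    apply: le_trans (_ : \sum_(i < k) w b * C * (\sum_(c | predT c && out c b) w c * wt (rest c b predT) ^+ m.-1) <= _).
      apply: ler_sum => i _; apply: le_trans (star_out_leaf E w_ge0 k_gt0 l_gt0 i b predT predT).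
      by apply: le_M => // phi _ h; apply/and3P; split=> //; exact/forallP.
    rewrite sumr_const card_ord -[_ *+ k]mulr_natr; set Sg := \sum_(c | _) _ in hs *.
    have Sg0 : 0 <= Sg by apply: sumr_ge0 => c _; apply: mulr_ge0 => //; apply: exprn_ge0; exact: wt0.
    have k1 := ler_wpM2r (mulr_ge0 (w_ge0 b) Sg0) (gam_pred R l k_gt0).
    have k2 := ler_wpM2l (wLg b) hs; have k3 := ler_wpM2l (mulr_ge0 (w_ge0 b) (ltW g0)) hs2.
    move: k1 k2 k3; set i7 := (6 * mR - 7)^-1; set Y := mR^-1 * _; set X := wt _ * _.
    by move=> k1 k2 k3; lra.
  have hin : \sum_(j < l) M [pred phi : star | phi (Some (inr j)) == b] = M [pred phi : star | phi (Some (inr j0)) == b].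
    rewrite (bigD1 j0) //= big1 ?addr0 // => j /eqP; case; apply: val_inj => /=.
    by case: j => j /=; rewrite l1 ltnS leqn0 => /eqP.
  have := fo b; rewrite /leafmass big_sumType /= hin tE /rho; lra.
have h1 : wt B2 * (g * (t - rho)) <= T.
  rewrite /wt mulr_suml.
  apply: le_trans (_ : \sum_(b | B2 b) M [pred phi : star | phi (Some (inr j0)) == b] <= _).
    apply: ler_sum => b hb; have := w_ge0 b; rewrite le_eqVlt => /orP[/eqP e|wb]; last exact: inleaf.
    by rewrite -e mul0r; exact: M_ge0.
  rewrite (_ : \sum_(b | B2 b) _ = M [pred phi : star | B2 (phi (Some (inr j0)))]); first exact: le_M.
  rewrite [RHS](M_part_in w (f := fun phi => phi (Some (inr j0))) (D := B2)) //.
  apply: eq_bigr => b hb; apply: eq_M => // phi _ /=.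
  by case: eqP => [->|]; rewrite ?hb ?andbF.
rewrite -(ler_pM2r g0) -tE; have := ler_wpM2l (_ : 0 <= mR + 1) h1; lra.
Qed.

(** The saving P2/4 of [T1_gt] covers the stars inside [B2]: P2 >= (1 - eps) al * wt B2 by the
    definition of [B2], and [wtB2_tail] bounds their mass accordingly. *)
Lemma T_sum_gt : (l < k)%N ->
  T <= \sum_(a | A a) w a * (xo a ^+ k * (yi a + za a) ^+ l + C * al ^+ m.-1 * (yi a + za a)).
Proof.
move=> ltlk; have h0 := main_split; have h1 := T1_gt ltlk; have h2 := wtB2_tail.
have s0 : 0 <= wt B2 by exact: wt0.
have /andP[e0 e1] := eps01; have a0 := al_ge0.
have hP : (1 - eps) * al * wt B2 <= P2.
  rewrite /wt mulr_sumr; apply: ler_sum => b /and3P[_ _ hb]; rewrite mulrC.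
  by apply: ler_wpM2l.
have em : al ^+ m = al * al ^+ m.-1 by rewrite -exprS prednK // m_gt0.
have X0 : 0 <= al ^+ m.-1 by exact: exprn_ge0.
have h3 : wt B2 ^+ m / L <= (1 - eps) * al ^+ m / 4.
  by rewrite ler_pdivrMr //; move: h2; lra.
have h4 : C * (wt B2 * (wt B2 ^+ m / L)) <= C * al ^+ m.-1 * (P2 / 4).
  rewrite -mulrA; apply: ler_wpM2l => //.
  apply: le_trans (ler_wpM2l s0 h3) _; rewrite em.
  have := ler_wpM2l X0 hP; lra.
have h5 : \sum_(a | A a) w a * ft a + C * al ^+ m.-1 * (\sum_(a | A a) w a * yi a) <=
   \sum_(a | A a) w a * (xo a ^+ k * (yi a + za a) ^+ l + C * al ^+ m.-1 * (yi a + za a)).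
  rewrite mulr_sumr -big_split /=; apply: ler_sum => a _.
  have z0 : 0 <= za a by exact: wt0.
  have := mulr_ge0 (mulr_ge0 (w_ge0 a) z0) (mulr_ge0 C0 X0); rewrite /ft; lra.
lra.
Qed.

Lemma al_le_half : al <= 2^-1.
Proof. by have := al_le; have := m6R; have := al_ge0; nra. Qed.

Lemma upper_gt (O : R) : (l < k)%N ->
  (forall a d : R, 0 <= a <= 2^-1 -> 0 <= d <= 1 ->
    a * (1 - a) ^+ m * d ^+ k * (1 - d) ^+ l + C * (1 - a) * a ^+ m * (1 - d) <= O) -> T <= O.
Proof.
move=> ltlk hO; apply: le_trans (T_sum_gt ltlk) _.
have ap := al_gt0; have a2 := al_le_half.
have bp : 0 < be by rewrite be_al; lra.
apply: le_trans (_ : \sum_(a | A a) w a * (O / al) <= _); last first.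
  by rewrite -mulr_suml -/al mulrC divfK // gt_eqF.
apply: ler_sum => a _; apply: ler_wpM2l => //; rewrite ler_pdivlMr //.
have x0 : 0 <= xo a by exact: wt0.
have y0 : 0 <= yi a + za a by apply: addr_ge0; exact: wt0.
have e := xyz a; set x := xo a in x0 e *; set y := yi a + za a in y0 e *.
(* The bracket at a, multiplied by al, is the objective of [OPT] at the point (al, x / be). *)
have := hO al (x / be) _ _; rewrite (ltW ap) a2 => /(_ isT); rewrite divr_ge0 ?(ltW bp) //=.
rewrite ler_pdivrMr // mul1r -{1}e lerDl y0 => /(_ isT).
have -> : 1 - x / be = y / be by rewrite -[1](divff (lt0r_neq0 bp)) -mulrBl -e addrC addKr.
rewrite -be_al; apply: le_trans.
have em : al ^+ m = al * al ^+ m.-1 by rewrite -exprS prednK // m_gt0.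
rewrite le_eqVlt; apply/orP; left; apply/eqP.
rewrite em exprD !expr_div_n; field.
by rewrite !expf_neq0 ?gt_eqF.
Qed.

(** * Equally many out-leaves and in-leaves *)

(** Adjacent pairs inside [A], of weight U, give centers in [A] at most U g al^(m - 1) and take U g
    al^(m - 2) be from the bound for centers in [B]; the loss prevails because al <= 1/2 <= be. *)
Lemma T1_eq : (1 < l)%N -> M [pred phi : star | leaves_in A phi] <= g * al ^+ m * be.
Proof.
move=> l2; have a0 := al_ge0; have a2 := al_le_half; have b0 : 0 <= be by exact: wt0.
have l1 : (l == 1%N) = false by rewrite gtn_eqF.
have m2 : (m = 2 + m.-2)%N by move: m6; case: (m) => [|[|]].
set U := pair A A.
have hA c : A c -> M [pred phi : star | (phi None == c) && leaves_in A phi] <=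
    w c * wt [pred x | A x && adj c x] * (g * al ^+ m.-1).
  move=> Ac; apply: le_trans (star_center_pow k l E w_ge0 c A) _.
  rewrite -mulrA ler_wpM2l // mulrCA ler_pM2l // -[X in _ ^+ X](prednK m_gt0) exprS.
  rewrite (eq_wt w (S := [pred x | A x && adj c x])); last by move=> x; rewrite /= andbC.
  by rewrite ler_wpM2l ?wt0 //; apply: wt_exp; apply: le_wt => // x /andP[].
have hB c : M [pred phi : star | (phi None == c) && leaves_in A phi] <= w c * (g * al ^+ m.-2 * (al ^+ 2 - U)).
  have sq := star_kill_sq E w_ge0 k_gt0 l_gt0 c A k_gt1.
  have base := star_center_le k l E w_ge0 c A.
  set p := wt [predI out c & A] in sq base; set q := wt [predI inn c & A] in sq base.
  set MM := M _ in sq base *.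
  have p0 : 0 <= p by exact: wt0. have q0 : 0 <= q by exact: wt0.
  have pq : wt [pred x | single c x && A x] = p + q.
    rewrite (wtID w _ (out c)); congr (_ + _); apply: eq_wt => x.
      rewrite -[LHS]/((single c x && A x) && out c x) -[RHS]/(out c x && A x) /single.
      by case: (out c x); rewrite ?andbF ?andbT.
    rewrite -[LHS]/((single c x && A x) && ~~ out c x) -[RHS]/(inn c x && A x) /single.
    case: (boolP (out c x)) => h; first by rewrite (out_inn h) andbF.
    by rewrite andbT.
  have pqa : p + q <= al by rewrite -pq; apply: le_wt => // x /andP[].
  (* For l > 1 every adjacent pair is bad, so both sides are weights of nonadjacent pairs, and these
     grow with the vertex set. *)
  have hbad : (p + q) ^+ 2 - badsum c A <= al ^+ 2 - U.
    have -> : badsum c A = pair [pred x | single c x && A x] [pred x | single c x && A x].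
      apply: eq_bigr => x _; congr (_ * _); apply: eq_wt => y.
      by rewrite /= /bad l1 /= andbT andbA.
    rewrite -pq !expr2 -!npairE //.
    rewrite /npair big_mkcond [leRHS]big_mkcond; apply: ler_sum => x _ /=.
    case: (boolP (A x)) => Ax; rewrite ?andbF // andbT.
    case: ifP => _; last exact: mulr_ge0 (wt0 _).
    by rewrite ler_wpM2l //; apply: le_wt => // y /andP[/andP[_ h] ha]; apply/andP.
  have U0 : 0 <= al ^+ 2 - U.
    rewrite expr2 -npairE; apply: sumr_ge0 => x _; exact: mulr_ge0 (wt0 _).
  have RH0 : 0 <= w c * (g * al ^+ m.-2 * (al ^+ 2 - U)).
    by apply: mulr_ge0 => //; apply: mulr_ge0 => //; exact: mulr_ge0 (ltW g0) (exprn_ge0 _ a0).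
  have [d0|d0] := eqVneq (p + q) 0.
    have pz : p = 0 by lra.
    by apply: le_trans base _; rewrite pz expr0n gtn_eqF ?k_gt0 //= mul0r mulr0.
  have d1 : 0 < (p + q) ^+ 2 by rewrite exprn_gt0 // lt0r d0 addr_ge0.
  rewrite -(ler_pM2r d1); apply: le_trans sq _.
  have fg : p ^+ k * q ^+ l <= g * al ^+ m.-2 * (p + q) ^+ 2.
    apply: le_trans (amgm k l p0 q0) _; rewrite -mulrA ler_pM2l // {1}m2 exprD mulrC.
    by apply: ler_wpM2r; [exact: ltW | apply: ler_exp => //; exact: addr_ge0].
  have F0 : 0 <= w c * (p ^+ k * q ^+ l).
    by apply: mulr_ge0 => //; apply: mulr_ge0; exact: exprn_ge0.
  apply: le_trans (ler_wpM2l F0 hbad) _.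
  have := ler_wpM2r U0 (ler_wpM2l (w_ge0 c) fg); lra.
rewrite (M_part E w (fun phi => phi None)) (bigID A) /=.
have sA : \sum_(c | A c) M [pred phi : star | leaves_in A phi && (phi None == c)] <= U * (g * al ^+ m.-1).
  rewrite /U /pair mulr_suml; apply: ler_sum => c Ac; apply: le_trans (hA c Ac).
  by apply: le_M => // phi _ /andP[h1 h2]; apply/andP.
have sB : \sum_(c | ~~ A c) M [pred phi : star | leaves_in A phi && (phi None == c)] <=
    be * (g * al ^+ m.-2 * (al ^+ 2 - U)).
  rewrite [be]wtE mulr_suml; apply: ler_sum => c Bc; apply: le_trans (hB c).
  by apply: le_M => // phi _ /andP[h1 h2]; apply/andP.
have U0 : 0 <= U by apply: sumr_ge0 => x _; exact: mulr_ge0 (wt0 _).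
have e1 : al ^+ m.-1 = al * al ^+ m.-2 by rewrite {1}m2 exprS.
have e2 : al ^+ m = al ^+ 2 * al ^+ m.-2 by rewrite {1}m2 exprD.
have X0 : 0 <= g * al ^+ m.-2 * U * (be - al).
  apply: mulr_ge0; last by rewrite be_al; lra.
  by apply: mulr_ge0 => //; exact: mulr_ge0 (ltW g0) (exprn_ge0 _ a0).
rewrite e1 in sA; rewrite e2; lra.
Qed.

Lemma upper_eq : (1 < l)%N -> T <= g * (al * be ^+ m + be * al ^+ m).
Proof.
move=> l2; have h0 := main_split; have h1 := T1_eq l2.
have z : wt B2 = 0.
  rewrite /wt big1 // => b /and3P[/eqP h]; by rewrite h in l2.
rewrite z mul0r mulr0 addr0 in h0.
have : \sum_(a | A a) w a * ft a <= al * (g * be ^+ m).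
  apply: sum_wt_le => a _ _; rewrite -(xyz a); apply: amgm; first exact: wt0.
  by apply: addr_ge0; exact: wt0.
lra.
Qed.

End Upper.

(* Existence and stationarity of a maximizer *)
From mathcomp Require Import classical_sets reals boolp topology normedtype derive.
Import numFieldNormedType.Exports.

Lemma continuous_bigsum (R : realType) (T : topologicalType) (J : Type) (s : seq J) (D : pred J)
   (F : J -> T -> R) : (forall j, D j -> continuous (F j)) ->
  continuous (fun x => \sum_(j <- s | D j) F j x).
Proof.
move=> h; elim: s => [|j s IH] x.
  under eq_fun do rewrite big_nil; exact: cvg_cst.
under eq_fun do rewrite big_cons.
by case: ifP => Dj; [apply: cvgD; [exact: h | exact: IH] | exact: IH].
Qed.

Lemma continuous_bigprod (R : realType) (T : topologicalType) (J : Type) (s : seq J)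
   (F : J -> T -> R) : (forall j, continuous (F j)) ->
  continuous (fun x => \prod_(j <- s) F j x).
Proof.
move=> h; elim: s => [|j s IH] x.
  under eq_fun do rewrite big_nil; exact: cvg_cst.
by under eq_fun do rewrite big_cons; apply: cvgM; [exact: h | exact: IH].
Qed.

Section Maximizer.
Variables (R : realType) (k l : nat) (V : finType) (E : rel V).
Local Notation star := {ffun star_vertex k l -> V}.
Local Notation F w := (M E w (@predT star)).

Definition simplex (w : V -> R) := (forall x, 0 <= w x) /\ wt w predT = 1.

Lemma maximizer (v0 : V) : exists2 w, simplex w & forall w', simplex w' -> F w' <= F w.
Proof.
pose n := #|V|.
pose W (r : 'rV[R]_n) (x : V) : R := r ord0 (enum_rank x).
pose S : set 'rV[R]_n := [set r | simplex (W r)]%classic.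
have cW x : continuous (W^~ x) by exact: coord_continuous.
have cS : compact S.
  pose K : set 'rV[R]_n := [set r | forall i, `[0, 1]%classic (r ord0 i : R)]%classic.
  have cK : compact K.
    by apply: (@rV_compact R n (fun=> `[0, 1]%classic)) => _; exact: segment_compact.
  have : closed ([set r : 'rV[R]_n | wt (W r) predT = 1]%classic).
    apply: (@closed_comp _ _ (fun r => wt (W r) predT) [set x | x = 1]%classic).
      by move=> r _; apply: continuous_bigsum.
    exact: closed_eq.
  move=> cl; have := compact_closedI cK cl; congr compact.
  apply/seteqP; split=> r /=.
    move=> [hK e]; split=> // x; have := hK (enum_rank x).
    by rewrite /= in_itv /= => /andP[].
  move=> [h e]; split=> // i.
  have e2 : r ord0 i = W r (enum_val i) by rewrite /W enum_valK.
  rewrite /= in_itv /= e2 h /= -e /wt (bigD1 (enum_val i)) //= lerDl.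
  by apply: sumr_ge0 => *; exact: h.
have S0 : (S !=set0)%classic.
  exists (\row_i (i == enum_rank v0)%:R); split=> [x|].
    by rewrite /W mxE; case: eqP.
  rewrite /wt (bigD1 v0) //= /W mxE eqxx big1 ?addr0 // => x /negbTE hx.
  by rewrite mxE (inj_eq enum_rank_inj) hx.
have cF : continuous (fun r => F (W r)).
  by apply: continuous_bigsum => phi _; apply: continuous_bigprod => u; exact: cW.
have [r rS rmax] := EVT_max_rV S0 cS (continuous_subspaceT cF).
move: rS; rewrite inE => rS.
exists (W r) => // w' [h0 h1].
have e : W (\row_i w' (enum_val i)) = w'.
  by apply: funext => x; rewrite /W mxE enum_rankK.
have := rmax (\row_i w' (enum_val i)); rewrite e; apply.
by rewrite inE; rewrite /S /= e.
Qed.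

Lemma M_scale (c : R) w : F (fun x => c * w x) = c ^+ (k + l).+1 * F w.
Proof.
rewrite /M mulr_sumr; apply: eq_bigr => phi _.
by rewrite /mass big_split /= prodr_const card_option card_sum !card_ord.
Qed.

Lemma exprD1_le2 n : exists2 K : R, 0 <= K & forall z : R, -1 <= z <= 1 -> (1 + z) ^+ n <= 1 + n%:R * z + K * z ^+ 2.
Proof.
elim: n => [|n [K K0 IH]]; first by exists 0 => // z _; rewrite expr0 !mul0r !addr0.
exists (n%:R + 2 * K) => [|z hz]; first by rewrite addr_ge0 ?mulr_ge0.
have /andP[z0 z1] := hz; have z2 := sqr_ge0 z.
have z10 : 0 <= 1 + z by lra.
rewrite exprS; apply: le_trans (ler_wpM2l z10 (IH z hz)) _.
have := mulr_ge0 (mulr_ge0 K0 z2) (_ : 0 <= 1 - z); rewrite subr_ge0 => /(_ z1).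
rewrite -natr1; lra.
Qed.

(* Only the multiplicative perturbations [w v *= 1 + r] are used, so that vertices of
   weight 0 need no separate treatment. *)
Lemma maximizer_first_order w : simplex w -> (forall w', simplex w' -> F w' <= F w) ->
  forall v, \sum_u M E w [pred phi : star | phi u == v] = ((k + l)%:R + 1) * F w * w v.
Proof.
move=> [w0 w1] wmax v; set S := \sum_u _; set T := F w.
have T0 : 0 <= T by exact: M_ge0.
have wv : 0 <= w v <= 1 by rewrite w0 /= -w1 /wt (bigD1 v) //= lerDl; apply: sumr_ge0 => *.
(* The perturbed mass is at least T + r S by Bernoulli on each star, and at most the right side by
   homogeneity and maximality. *)
have key (r : R) : -1 < r -> T + r * S <= T * (1 + r * w v) ^+ (k + l).+1.
  move=> r1; pose u x := w x * (1 + r * (x == v)%:R).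
  have ru x : 0 <= 1 + r * (x == v)%:R by case: (x == v); rewrite /=; lra.
  have u0 x : 0 <= u x by rewrite mulr_ge0.
  have su : wt u predT = 1 + r * w v.
    rewrite -w1 /wt /u; under eq_bigr do rewrite mulrDr mulr1.
    rewrite big_split /=; congr (_ + _); rewrite (bigD1 v) //= eqxx mulr1 big1 ?addr0 1?mulrC //.
    by move=> x /negbTE ->; rewrite !mulr0.
  have s0 : 0 < 1 + r * w v.
    have /andP[wv0 wv1] := wv; have [h|h] := leP (w v) 0.
      by have e : w v = 0; [lra | rewrite e mulr0 addr0].
    have : 0 < w v * (1 + r) by rewrite mulr_gt0 //; lra.
    lra.
  have Fu : F u <= T * (1 + r * w v) ^+ (k + l).+1.
    have s1 : simplex (fun x => (1 + r * w v)^-1 * u x).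
      split=> [x|]; first by rewrite mulr_ge0 // invr_ge0 ltW.
      by rewrite /wt -mulr_sumr -[X in _ * X]/(wt u predT) su mulVf // gt_eqF.
    have := wmax _ s1; rewrite M_scale exprVn ler_pdivrMl ?exprn_gt0 //.
    by rewrite mulrC.
  apply: le_trans Fu; rewrite /T /S /M mulr_sumr.
  rewrite (eq_bigr (fun u => \sum_(phi | valid E phi) r * (phi u == v)%:R * mass w phi)); last first.
    move=> i _; rewrite mulr_sumr big_mkcondr /=; apply: eq_bigr => phi _.
    by case: (phi i == v); rewrite /= ?mulr1 ?mulr0 ?mul0r.
  rewrite exchange_big /=; under eq_bigl do rewrite andbT; under [leRHS]eq_bigl do rewrite andbT.
  rewrite -big_split /=; apply: ler_sum => phi _.
  rewrite -mulr_suml -mulr_sumr /mass big_split /= -[X in X + _]mul1r -mulrDl mulrC.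
  apply: ler_wpM2l; first exact: prodr_ge0.
  rewrite [leRHS](eq_bigr (fun i => (1 + r) ^+ (phi i == v))); last first.
    by move=> i _; case: (phi i == v); rewrite ?mulr1 ?mulr0 ?addr0 ?expr1 ?expr0.
  by rewrite prodrXr -natr_sum mulrC; apply: bernoulli; lra.
have [K K0 hK] := exprD1_le2 (k + l).+1.
have bd (r : R) : -1 < r <= 1 -> r * (S - T * (k + l).+1%:R * w v) <= T * K * r ^+ 2.
  move=> /andP[r1 r2]; have /andP[v0 v1] := wv.
  have rv : -1 <= r * w v <= 1 by apply/andP; split; nra.
  have h1 := key r r1; have h2 := ler_wpM2l T0 (hK _ rv).
  have h3 : T * K * (r * w v) ^+ 2 <= T * K * r ^+ 2.
    rewrite ler_wpM2l ?mulr_ge0 // exprMn -[leRHS]mulr1 ler_wpM2l ?sqr_ge0 //.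
    by rewrite exprn_ile1.
  by have := le_trans h1 h2; lra.
have TK : 0 <= T * K by rewrite mulr_ge0.
(* This plays the role of r -> 0+; used for both signs of the perturbation it yields the two
   inequalities. *)
have lim (d : R) : (forall r, 0 < r <= 1 / 2 -> d <= T * K * r) -> d <= 0.
  move=> h; rewrite leNgt; apply/negP => d0.
  pose r := Num.min (1 / 2) (d / (2 * (T * K + 1))).
  have p1 : 0 < d / (2 * (T * K + 1)) by rewrite divr_gt0 //; lra.
  have r0 : 0 < r by rewrite lt_min p1 andbT; lra.
  have r2 : r <= d / (2 * (T * K + 1)) by rewrite ge_min lexx orbT.
  have := h r _; rewrite r0 ge_min lexx => /(_ isT) h1.
  move: r2; rewrite ler_pdivlMr; last lra.
  by have := mulr_ge0 TK (ltW r0); lra.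
have -> : ((k + l)%:R + 1) * T * w v = T * (k + l).+1%:R * w v by rewrite natr1 [_ * T]mulrC.
apply/eqP; rewrite eq_le; apply/andP; split; rewrite -subr_le0; apply: lim => r /andP[r0 r1].
  have := bd r _; rewrite (_ : -1 < r <= 1); last by apply/andP; split; lra.
  move=> /(_ isT); rewrite expr2 mulrA mulrC ler_pM2r //.
have := bd (- r) _; rewrite (_ : -1 < - r <= 1); last by apply/andP; split; lra.
move=> /(_ isT) h; rewrite -(ler_pM2r r0); move: h; rewrite sqrrN; lra.
Qed.

(** At the uniform weight 1/n the mass is the proportion of valid maps, and star copies are the
    injective ones among them. *)
Lemma s_kl_le w : (forall w', simplex w' -> F w' <= F w) -> s_kl R k l E <= F w.
Proof.
move=> wmax; rewrite /s_kl.
case: (posnP #|V|) => [V0|V0].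
  rewrite V0 exp0n ?addn1 // invr0 mulr0; apply: sumr_ge0 => phi _.
  by have := fintype0 (phi None) V0.
have n0 : 0 < #|V|%:R :> R by rewrite ltr0n.
have hs : simplex (fun=> #|V|%:R^-1).
  split=> [x|]; first by rewrite invr_ge0 ltW.
  by rewrite /wt sumr_const -[_ *+ _]mulr_natr mulVf // gt_eqF.
apply: le_trans (wmax _ hs).
rewrite /M (eq_bigr (fun=> #|V|%:R^-1 ^+ (k + l).+1)); last first.
  by move=> phi _; rewrite /mass prodr_const card_option card_sum !card_ord.
rewrite sumr_const exprVn natrX addn1 -[leRHS]mulr_natl.
rewrite ler_pM2r ?invr_gt0 ?exprn_gt0 // ler_nat; apply: subset_leq_card.
by apply/fintype.subsetP => phi; rewrite inE => /andP[_ h]; rewrite -topredE /= andbT.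
Qed.

End Maximizer.

(** * Upper and lower bounds on OPT *)

Section OPTbounds.
Variable R : realType.
Implicit Types (a d : R).

Lemma gamE k l : (0 < k)%N -> (k.-1 ^ k.-1 * l ^ l)%:R / ((k + l).-1 ^ (k + l).-1)%:R = gam R k.-1 l.
Proof. by move=> k0; rewrite /gam natrM !natrX predDl. Qed.

Lemma expr01 a n : 0 <= a <= 1 -> 0 <= a ^+ n <= 1.
Proof. by move=> /andP[a0 a1]; rewrite exprn_ge0 // exprn_ile1. Qed.

Definition opt_eq n a := a * (1 - a) ^+ n + (1 - a) * a ^+ n.
Definition opt_gt k l a d := a * (1 - a) ^+ (k + l) * d ^+ k * (1 - d) ^+ l
             + gam R k.-1 l * (1 - a) * a ^+ (k + l) * (1 - d).

Lemma OPT_eqE k : OPT R k k = (2 ^+ (2 * k))^-1 *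
  sup [set x : R | exists a : R, 0 <= a <= 1 /\ x = opt_eq (2 * k) a]%classic.
Proof. by rewrite /OPT eqxx. Qed.

Lemma OPT_gtE k l : (l < k)%N -> OPT R k l =
  sup [set x : R | exists a d : R, 0 <= a <= 2^-1 /\ 0 <= d <= k%:R / (k + l)%:R /\ x = opt_gt k l a d]%classic.
Proof.
move=> lk; rewrite /OPT gtn_eqF // gamE //; exact: leq_ltn_trans lk.
Qed.

Lemma opt_eq_ub n a : 0 <= a <= 1 -> opt_eq n a <= 2.
Proof.
move=> ha; have ha' : 0 <= 1 - a <= 1 by lra.
have /andP[h1 h2] := expr01 n ha; have /andP[h3 h4] := expr01 n ha'; rewrite /opt_eq; nra.
Qed.

Lemma prod01 a d : 0 <= a <= 1 -> 0 <= d <= 1 -> 0 <= a * d <= 1.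
Proof. by move=> /andP[a0 a1] /andP[d0 d1]; rewrite mulr_ge0 // mulr_ile1. Qed.

Lemma opt_gt_ub k l a d : 0 <= a <= 1 -> 0 <= d <= 1 -> opt_gt k l a d <= 1 + gam R k.-1 l.
Proof.
move=> ha hd; have ha' : 0 <= 1 - a <= 1 by lra.
have hd' : 0 <= 1 - d <= 1 by lra.
have /andP[_ h1] := prod01 (prod01 (prod01 ha (expr01 (k + l) ha')) (expr01 k hd)) (expr01 l hd').
have /andP[_ h2] := prod01 (prod01 ha' (expr01 (k + l) ha)) hd'.
rewrite /opt_gt; apply: lerD => //.
have := ler_wpM2l (gam_ge0 R k.-1 l) h2; lra.
Qed.

Lemma opt_eq_le k a : 0 <= a <= 1 -> (2 ^+ (2 * k))^-1 * opt_eq (2 * k) a <= OPT R k k.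
Proof.
move=> ha; rewrite OPT_eqE ler_pM2l ?invr_gt0 ?exprn_gt0 //.
apply: ub_le_sup; last by exists a.
by exists 2 => _ [b [hb ->]]; exact: opt_eq_ub.
Qed.

Lemma kml01 k l : (0 < k)%N -> 0 <= (k%:R / (k + l)%:R : R) <= 1.
Proof.
move=> k0; rewrite divr_ge0 //= ler_pdivrMr ?mul1r ?ler_nat ?leq_addr //.
by rewrite ltr0n addn_gt0 k0.
Qed.

Lemma one_sub_kml k l : (0 < k)%N -> 1 - k%:R / (k + l)%:R = l%:R / (k + l)%:R :> R.
Proof.
move=> k0; have m0 : (k + l)%:R != 0 :> R by rewrite pnatr_eq0 addn_eq0 negb_and -lt0n k0.
by apply: (mulIf m0); rewrite mulrBl !divfK // mul1r natrD addrC addKr.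
Qed.

(** d^k (1 - d)^l peaks at k/(k + l) and the second term decreases in d, so the range of d in [OPT]
    can be extended to [0, 1]. *)
Lemma opt_gt_mono k l a d : (0 < k)%N -> 0 <= a <= 1 -> k%:R / (k + l)%:R <= d <= 1 ->
  opt_gt k l a d <= opt_gt k l a (k%:R / (k + l)%:R).
Proof.
move=> k0 ha hd; set e := k%:R / (k + l)%:R in hd *.
have he : 0 <= e <= 1 := kml01 l k0; have ha' : 0 <= 1 - a <= 1 by lra.
have m0 : (k + l)%:R != 0 :> R by rewrite pnatr_eq0 addn_eq0 negb_and -lt0n k0.
have e1 : e ^+ k * (1 - e) ^+ l = gam R k l.
  have -> : 1 - e = l%:R / (k + l)%:R by exact: one_sub_kml.
  by rewrite /e /gam !expr_div_n exprD invfM mulrACA.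
have h : d ^+ k * (1 - d) ^+ l <= e ^+ k * (1 - e) ^+ l.
  rewrite e1; apply: le_trans (amgm _ _ _ _) _; try lra.
  by rewrite addrC subrK expr1n mulr1.
rewrite /opt_gt; apply: lerD.
  rewrite -!mulrA ler_wpM2l ?(andP ha).1 // ler_wpM2l //; by case/andP: (expr01 (k + l) ha').
rewrite ler_wpM2l //; last lra.
have := expr01 (k + l) ha => /andP[x0 _]; have := gam_ge0 R k.-1 l => g0.
by apply: mulr_ge0 => //; apply: mulr_ge0 => //; lra.
Qed.

Lemma opt_gt_le k l a d : (l < k)%N -> 0 <= a <= 2^-1 -> 0 <= d <= 1 -> opt_gt k l a d <= OPT R k l.
Proof.
move=> lk ha hd; have k0 : (0 < k)%N by exact: leq_ltn_trans lk.
have ha1 : 0 <= a <= 1 by lra.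
have [he0 he1] := andP (kml01 l k0).
have key c : 0 <= c <= k%:R / (k + l)%:R -> opt_gt k l a c <= OPT R k l.
  move=> hc; rewrite OPT_gtE //; apply: ub_le_sup; last by exists a, c.
  exists (1 + gam R k.-1 l) => _ [b [c' [hb [hc' ->]]]]; apply: opt_gt_ub; lra.
case: (leP d (k%:R / (k + l)%:R)) => h; first by apply: key; rewrite h andbT; case/andP: hd.
apply: le_trans (key (k%:R / (k + l)%:R) _); last by rewrite he0 lexx.
by apply: opt_gt_mono => //; rewrite (ltW h) /=; case/andP: hd.
Qed.

Lemma gamkk k : (0 < k)%N -> gam R k k = (2 ^+ (2 * k))^-1.
Proof.
move=> k0; have k1 : k%:R != 0 :> R by rewrite pnatr_eq0 -lt0n.
rewrite /gam addnn -mul2n natrM exprMn mul2n -addnn -exprD invfM mulrCA mulfV ?mulr1 //.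
by rewrite expf_neq0.
Qed.

(** The first term of the objective at a = 1/(m + 1), with d = k/m when k > l, already gives this
    value. *)
Lemma OPT_ge k l : (l <= k)%N -> (0 < l)%N -> (1 <= k + l)%N ->
  theta R (k + l) * gam R k l <= ((k + l)%:R + 1) * OPT R k l.
Proof.
move=> lk l0 m0; set m := (k + l)%N.
have mp : 0 < m%:R + 1 :> R by rewrite natr1.
have m1 : 1 <= m%:R :> R by rewrite ler1n.
pose a : R := (m%:R + 1)^-1.
have ap : 0 < a by rewrite invr_gt0.
have ma : (m%:R + 1) * a = 1 by rewrite mulfV // gt_eqF.
have ha : 0 <= a <= 2^-1 by apply/andP; split; [exact: ltW | rewrite lef_pV2 ?posrE //; lra].
have a1 : (1 - a) ^+ m = theta R m.
  rewrite /theta -natr1; congr (_ ^+ _); apply: (mulIf (lt0r_neq0 mp)).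
  by rewrite divfK ?gt_eqF // mulrBl mulrC mulrC [a * _]mulrC ma mul1r addrK.
have am0 : 0 <= a ^+ m by rewrite exprn_ge0 // ltW.
have e : theta R m * gam R k l = (m%:R + 1) * (a * (1 - a) ^+ m * gam R k l).
  by rewrite a1 !mulrA ma mul1r.
rewrite e ler_pM2l //.
move: lk; rewrite leq_eqVlt => /orP[/eqP ekl|ltlk].
  subst l; have mk : m = (2 * k)%N by rewrite /m addnn mul2n.
  apply: le_trans (opt_eq_le k (_ : 0 <= a <= 1)); last lra.
  rewrite gamkk // mulrC /opt_eq -mk ler_pM2l ?invr_gt0 ?exprn_gt0 // lerDl.
  by apply: mulr_ge0 => //; lra.
have k0 : (0 < k)%N by exact: leq_ltn_trans ltlk.
apply: le_trans (opt_gt_le ltlk ha (kml01 l k0)); rewrite /opt_gt -/m.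
have /andP[he0 he1] := kml01 l k0.
have m0' : m%:R != 0 :> R by rewrite pnatr_eq0 -lt0n.
have g1 : (k%:R / m%:R) ^+ k * (1 - k%:R / m%:R) ^+ l = gam R k l.
  have -> : 1 - k%:R / m%:R = l%:R / m%:R :> R by exact: one_sub_kml.
  by rewrite /gam !expr_div_n exprD invfM mulrACA.
rewrite -g1 !mulrA lerDl; have g0 := gam_ge0 R k.-1 l.
apply: mulr_ge0; last by rewrite subr_ge0.
by apply: mulr_ge0 => //; apply: mulr_ge0 => //; lra.
Qed.

End OPTbounds.

Lemma star_density_le_OPT (R : realType) k l (V : finType) (E : rel V) :
  (l <= k)%N -> (1 <= l)%N -> (6 <= k + l)%N -> s_kl R k l E <= OPT R k l.
Proof.
move=> lk l0 m6; have k0 : (0 < k)%N by exact: leq_trans lk.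
have mp : 0 < (k + l)%:R + 1 :> R by rewrite natr1.
have hO := OPT_ge R lk l0 (leq_trans (isT : (1 <= 6)%N) m6).
case: (pickP (@predT V)) => [v0 _|noV]; last first.
  have V0 : #|V| = 0%N by exact: eq_card0.
  (* On the empty digraph the density is 0/0 = 0 by convention, and OPT is nonnegative by
     [OPT_ge]. *)
  rewrite /s_kl V0 exp0n ?addn1 // invr0 mulr0 -(pmulr_rge0 _ mp).
  apply: le_trans hO; exact: mulr_ge0 (ltW (theta_gt0 R _)) (gam_ge0 R k l).
have [w [w0 w1] wmax] := maximizer R k l E v0.
apply: le_trans (s_kl_le wmax) _.
have fo := maximizer_first_order (conj w0 w1) wmax.
set T := M E w _ in fo *.
case: (leP (theta R (k + l) * gam R k l) (((k + l)%:R + 1) * T)) => hT; last first.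
  by rewrite -(ler_pM2l mp); apply: le_trans hO; exact: ltW.
move: (lk); rewrite leq_eqVlt => /orP[/eqP ekl|ltlk].
  have l2 : (1 < l)%N by move: m6; rewrite -ekl; clear; lia.
  apply: le_trans (upper_eq w0 l0 lk m6 w1 fo hT l2) _.
  have hb := be_al E w1; have a0 := al_ge0 E w0; have a1 := al_le_half w0 l0 lk m6 w1 fo hT.
  subst l; rewrite gamkk // hb.
  have mk : (k + k = 2 * k)%N by rewrite addnn mul2n.
  rewrite mk; apply: (@opt_eq_le R k (al E w)); lra.
apply: (upper_gt w0 l0 lk m6 w1 fo hT ltlk) => a d ha hd.
exact: (opt_gt_le ltlk ha hd).
Qed.

(** * Blow-ups approach the weighted mass *)

Lemma prod_sub_le (R : realFieldType) (I : Type) (s : seq I) (a b : I -> R) (e : R) : 0 <= e ->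
  (forall i, 0 <= a i <= 1) -> (forall i, 0 <= b i <= 1) -> (forall i, b i - e <= a i) ->
  \prod_(i <- s) b i - (size s)%:R * e <= \prod_(i <- s) a i.
Proof.
move=> e0 ha hb hab; elim: s => [|i s IH]; first by rewrite !big_nil /= mul0r subr0.
rewrite !big_cons /= -natr1; have /andP[a0 a1] := ha i; have h := hab i.
have p0 : 0 <= \prod_(j <- s) b j by apply: prodr_ge0 => j _; case/andP: (hb j).
have p1 : \prod_(j <- s) b j <= 1 by apply: prodr_ile1 => j _; exact: hb.
have h1 := ler_wpM2l a0 IH; have h2 := ler_wpM2r p0 h; have h3 := ler_wpM2l e0 p1.
have : a i * ((size s)%:R * e) <= (size s)%:R * e.
  by rewrite -[leRHS]mul1r ler_wpM2r // mulr_ge0.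
lra.
Qed.

Section Blowup.
Variables (R : realType) (k l : nat) (V : finType) (E : rel V) (w : V -> R).
Hypotheses (w_ge0 : forall x, 0 <= w x) (wT : wt w predT = 1).
Variable N : nat.
Hypothesis N_gt0 : (0 < N)%N.
Local Notation st := (star_vertex k l).
Local Notation m1 := (k + l).+1.
Local Notation MT := (M (k := k) (l := l) E w predT).

Definition fiber (v : V) : nat := Num.truncn (w v * N%:R).
Definition blowup : finType := {v : V & 'I_(fiber v)}.
Definition blowup_rel : rel blowup := fun x y => E (tag x) (tag y).

Let NR : 0 < N%:R :> R. Proof. by rewrite ltr0n. Qed.

Lemma w_le1 v : w v <= 1.
Proof. by rewrite -wT /wt (bigD1 v) //= lerDl; apply: sumr_ge0. Qed.

Lemma fiber_bounds v : w v * N%:R - 1 <= (fiber v)%:R <= w v * N%:R.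
Proof.
have h : 0 <= w v * N%:R by rewrite mulr_ge0 // ltW.
have := truncn_itv h; rewrite -/(fiber v) -natr1 => /andP[h1 h2].
by rewrite h1 andbT; lra.
Qed.

Lemma card_fiber v : \sum_(p : blowup | tag p == v) 1 = (fiber v)%:R :> R.
Proof.
rewrite (eq_bigl (fun p : blowup => (tag p == v) && true)) => [|p]; last by rewrite andbT.
rewrite -(sig_big_dep (J := fun v => 'I_(fiber v)) (pred1 v) (fun _ => predT) (fun _ _ => 1 : R)) /=.
by rewrite big_pred1_eq sumr_const card_ord.
Qed.

Lemma card_blowup : (#|blowup| <= N)%N.
Proof.
rewrite -(ler_nat R) -sum1_card natr_sum.
rewrite (partition_big (fun p : blowup => tag p) predT) //=.
under eq_bigr do rewrite card_fiber.
apply: le_trans (_ : \sum_v w v * N%:R <= _).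
  by apply: ler_sum => v _; case/andP: (fiber_bounds v).
by rewrite -mulr_suml -[X in X * _]/(wt w predT) wT mul1r.
Qed.

Lemma card_star : #|st| = m1.
Proof. by rewrite card_option card_sum !card_ord. Qed.

(** Validity depends only on the projection to [V], and a map to [V] has as many lifts as the
    product of its fiber sizes. *)
Lemma hom_count : \sum_(phi : {ffun st -> blowup} | valid blowup_rel phi) 1 =
  \sum_(psi : {ffun st -> V} | valid E psi) \prod_u (fiber (psi u))%:R :> R.
Proof.
under [RHS]eq_bigr => psi _.
  under eq_bigr do rewrite -card_fiber big_mkcond.
  rewrite bigA_distr_bigA /=.
  over.
rewrite exchange_big /= big_mkcond /=; apply: eq_bigr => phi _.
pose psi0 : {ffun st -> V} := [ffun u => tag (phi u)].
have z psi : psi != psi0 -> \prod_u (if tag (phi u) == psi u then 1 else 0) = 0 :> R.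
  move=> ne; have [u hu] : exists u, tag (phi u) != psi u.
    apply/existsP; apply: contraNT ne; rewrite negb_exists => /forallP h.
    by apply/eqP/ffunP => u; rewrite ffunE; apply/eqP; rewrite eq_sym -[_ == _]negbK.
  by rewrite (bigD1 u) //= (negbTE hu) mul0r.
have e : valid blowup_rel phi = valid E psi0.
  by apply: eq_forallb => u; apply: eq_forallb => v; rewrite !ffunE.
rewrite e; case: ifP => h.
  rewrite (bigD1 psi0) //= [X in _ + X]big1 ?addr0; last by move=> psi /andP[_]; exact: z.
  by rewrite big1 // => u _; rewrite ffunE eqxx.
rewrite big1 // => psi hp; apply: z; apply: contraTneq hp => ->; by rewrite h.
Qed.

Lemma collision_count (V' : finType) (u u' : st) : u != u' ->
  \sum_(phi : {ffun st -> V'} | phi u == phi u') 1 <= #|V'|%:R ^+ (k + l) :> R.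
Proof.
move=> ne.
apply: le_trans (_ : \sum_(p : V') \sum_(phi : {ffun st -> V'})
   \prod_x (if (x == u) || (x == u') then (if phi x == p then 1 else 0) else 1) <= _).
  rewrite exchange_big big_mkcond /=; apply: ler_sum => phi _.
  have nn p : 0 <= \prod_x (if (x == u) || (x == u') then (if phi x == p then 1 else 0) else 1) :> R.
    by apply: prodr_ge0 => x _; do 2 case: ifP => //.
  case: ifP => [/eqP h|_]; last by apply: sumr_ge0.
  rewrite (bigD1 (phi u)) //= big1 ?lerDl; first exact: sumr_ge0.
  move=> x _; case: ifP => // /orP[/eqP ->|/eqP ->]; first by rewrite eqxx.
  by rewrite h eqxx.
rewrite (eq_bigr (fun=> #|V'|%:R ^+ (k + l).-1)); last first.
  move=> p _; rewrite -(bigA_distr_bigA (fun x y => if (x == u) || (x == u') then (if y == p then 1 else 0) else 1)).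
  rewrite (bigID (fun x => (x == u) || (x == u'))) /= big1 ?mul1r; last first.
    by move=> x ->; rewrite -big_mkcond big_pred1_eq.
  rewrite (eq_bigr (fun=> #|V'|%:R)); last first.
    by move=> x /negbTE ->; rewrite sumr_const.
  rewrite prodr_const; congr (_ ^+ _).
  have := cardC (pred2 u u'); rewrite card2 ne card_star => /eqP.
  rewrite addSn addSn add0n !eqSS => /eqP; case: (k + l)%N => // n [<-].
  by apply: eq_card => x; rewrite !inE.
rewrite sumr_const -[_ *+ _]mulr_natr -exprSr.
case: (posnP (k + l)%N) => [h|h]; last by rewrite prednK.
exfalso; move: ne; have := card_star; rewrite h => /eqP; rewrite eqn_leq => /andP[/card_le1_eqP hc _].
by rewrite (hc u u') ?inE ?eqxx.
Qed.

(** The first error term is the rounding in each of the m + 1 factors, for every map to [V]; the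
    second bounds the non-injective maps, at most N^m for each ordered pair of star vertices. *)
Lemma blowup_density : #|blowup| != 0%N ->
  MT - ((#|{ffun st -> V}| * m1)%:R + (m1 * m1)%:R) / N%:R <= s_kl R k l blowup_rel.
Proof.
move=> n0; have np : 0 < #|blowup|%:R :> R by rewrite ltr0n lt0n.
rewrite /s_kl addn1 natrX.
set cp := #|_|%:R.
have cp0 : 0 <= cp by rewrite /cp.
have nN : #|blowup|%:R <= N%:R :> R by rewrite ler_nat card_blowup.
apply: le_trans (_ : cp / N%:R ^+ m1 <= _); last first.
  apply: ler_wpM2l => //; rewrite lef_pV2 ?posrE ?exprn_gt0 //.
  by rewrite lerXn2r ?nnegrE ?ler0n.
rewrite ler_pdivlMr ?exprn_gt0 //.
have hcp : \sum_(phi : {ffun st -> blowup} | valid blowup_rel phi) 1 -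
   (m1 * m1)%:R * N%:R ^+ (k + l) <= cp.
  rewrite lerBlDr /cp -sum1_card natr_sum.
  apply: le_trans (_ : \sum_(phi : {ffun st -> blowup}
      | star_copy blowup_rel phi) 1 +
     \sum_(u : st) \sum_(u' | u' != u) \sum_(phi : {ffun st -> blowup} | phi u == phi u') 1 <= _).
    rewrite big_mkcond [X in _ <= X + _]big_mkcond /=.
    under [X in _ <= _ + X]eq_bigr do under eq_bigr do rewrite big_mkcond.
    under [X in _ <= _ + X]eq_bigr do rewrite exchange_big.
    rewrite exchange_big /= -big_split /=; apply: ler_sum => phi _.
    have s0 : 0 <= \sum_(u : st) \sum_(u' | u' != u) (if phi u == phi u' then 1 else 0) :> R.
      by apply: sumr_ge0 => u _; apply: sumr_ge0 => u' _; case: ifP.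
    case: ifP => hv; last by rewrite addr_ge0 //; case: ifP.
    case: (boolP (injectiveb phi)) => hi.
      by rewrite /star_copy hi -[X in _ && X]/(valid blowup_rel phi) hv lerDl.
    case/injectivePn: hi => u [u' ne e].
    rewrite ler_wpDl //; first by case: ifP.
    rewrite (bigD1 u) //= (bigD1 u') 1?eq_sym //= -e eqxx -addrA lerDl.
    apply: addr_ge0; first by apply: sumr_ge0 => x _; case: ifP.
    by apply: sumr_ge0 => x _; apply: sumr_ge0 => y _; case: ifP.
  apply: lerD.
    rewrite big_mkcond [leRHS]big_mkcond; apply: ler_sum => phi _.
    by case: (boolP (phi \in _)) => [|/negP]; rewrite inE => h; [rewrite h|case: ifP].
  apply: le_trans (_ : \sum_(u : st) \sum_(u' : st) N%:R ^+ (k + l) <= _).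
    apply: ler_sum => u _; rewrite big_mkcond; apply: ler_sum => u' _.
    case: ifP => [ne|_]; last by rewrite exprn_ge0.
    apply: le_trans (collision_count _ _) _; first by rewrite eq_sym.
    by rewrite lerXn2r ?nnegrE ?ler0n.
  by rewrite !sumr_const card_star -mulrnA -[_ *+ _]mulr_natl.
apply: le_trans hcp; rewrite hom_count.
have hh : MT - (#|{ffun st -> V}| * m1)%:R / N%:R <=
    (\sum_(psi : {ffun st -> V} | valid E psi) \prod_u (fiber (psi u))%:R) / N%:R ^+ m1.
  rewrite mulr_suml /M.
  apply: le_trans (_ : \sum_(psi : {ffun st -> V} | valid E psi) (mass w psi - m1%:R * N%:R^-1) <= _).
    rewrite sumrB; apply: lerB; first by rewrite le_eqVlt; apply/orP; left; apply/eqP; apply: eq_bigl => psi; rewrite andbT.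
    rewrite sumr_const -[_ *+ _]mulr_natl natrM -mulrA ler_wpM2r ?mulr_ge0 ?invr_ge0 //.
    by rewrite ler_nat max_card.
  apply: ler_sum => psi _.
  rewrite -card_star -prodr_const -prodf_div.
  have e0 : 0 <= N%:R^-1 :> R by rewrite invr_ge0 ltW.
  have := @prod_sub_le R st (index_enum st) (fun u => (fiber (psi u))%:R / N%:R) (fun u => w (psi u)) N%:R^-1 e0.
  rewrite (_ : size _ = #|st|); last by rewrite cardT enumT.
  rewrite /mass => h.
  apply: h => [u|u|u].
  - have /andP[h1 h2] := fiber_bounds (psi u); rewrite divr_ge0 ?ler0n //= ler_pdivrMr // mul1r.
    apply: le_trans h2 _; rewrite -[leRHS]mul1r ler_wpM2r ?ler0n //; exact: w_le1.
  - by rewrite w_ge0 w_le1.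
  - have /andP[h1 h2] := fiber_bounds (psi u); rewrite ler_pdivlMr // mulrBl mulVf //.
    by rewrite gt_eqF.
move: hh; rewrite ler_pdivlMr ?exprn_gt0 // => hh.
have e1 : N%:R ^+ m1 = N%:R * N%:R ^+ (k + l) :> R by rewrite exprS.
have e2 : (m1 * m1)%:R / N%:R * N%:R ^+ m1 = (m1 * m1)%:R * N%:R ^+ (k + l) :> R.
  by rewrite e1 mulrA divfK // gt_eqF.
rewrite [X in _ - X]mulrDl opprD addrA mulrBl e2; lra.
Qed.

End Blowup.

Lemma blowup_irreflexive (R : realType) (V : finType) (E : rel V) (w : V -> R) N :
  irreflexive E -> irreflexive (blowup_rel E (w := w) (N := N)).
Proof. by move=> h x; exact: h. Qed.

Lemma blowup_approx (R : realType) k l (V : finType) (E : rel V) (w : V -> R) (e : R) :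
  (forall x, 0 <= w x) -> wt w predT = 1 -> irreflexive E -> 0 < e ->
  exists (V' : finType) (E' : rel V'), irreflexive E' /\ M (k := k) (l := l) E w predT - e < s_kl R k l E'.
Proof.
move=> w0 w1 hE e0.
set K : R := (#|{ffun star_vertex k l -> V}| * (k + l).+1)%:R + ((k + l).+1 * (k + l).+1)%:R.
have K0 : 0 <= K by rewrite addr_ge0.
(* N > K/e controls the error, and N > #|V| guarantees a nonempty fiber. *)
pose N := (Num.truncn (K / e) + #|V|).+1.
have hN : K / e < N%:R.
  apply: lt_le_trans (_ : (Num.truncn (K / e)).+1%:R <= _).
    by have /andP[_] := truncn_itv (divr_ge0 K0 (ltW e0)).
  by rewrite ler_nat /N ltnS leq_addr.
have Np : 0 < N%:R :> R by rewrite ltr0n.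
exists (blowup w N), (blowup_rel E (w := w) (N := N)); split; first exact: blowup_irreflexive.
have n0 : #|blowup w N| != 0%N.
  apply/negP => /eqP n0.
  have hf v : w v * N%:R < 1.
    rewrite ltNge; apply/negP => h.
    have f0 : (0 < fiber w N v)%N by rewrite /fiber truncn_gt_nat.
    by have := fintype0 (Tagged (fun v => 'I_(fiber w N v)) (Ordinal f0) : blowup w N); rewrite n0 => /(_ erefl).
  have : N%:R <= \sum_(v : V) (1 : R).
    have -> : N%:R = \sum_v w v * N%:R by rewrite -mulr_suml -[X in X * _]/(wt w predT) w1 mul1r.
    by apply: ler_sum => v _; apply: ltW.
  by rewrite sumr_const ler_nat /N leqNgt ltnS leq_addl.
apply: lt_le_trans (blowup_density k l E w0 w1 (N := N) isT n0).
by rewrite ltrD2l ltrN2 -/K ltr_pdivrMr // mulrC -ltr_pdivrMr.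
Qed.

(** When the neighbours of c span no arc, every choice of out- and in-neighbours is a valid star, so
    the bound of [star_center_le] is attained. *)
Lemma star_center_ge (R : realFieldType) k l (V : finType) (E : rel V) (w : V -> R) c :
  (forall x, 0 <= w x) -> irreflexive E -> (forall x y, adj E c x -> adj E c y -> ~~ E x y) ->
  w c * (wt w (out E c) ^+ k * wt w (inn E c) ^+ l) <=
  M E w [pred phi : {ffun star_vertex k l -> V} | predT phi && (phi None == c)].
Proof.
move=> w0 irr ind.
pose G (u : star_vertex k l) : pred V := if u is Some t then nb E c t else pred1 c.
rewrite -(prod_leaf (f := fun t => wt w (G (Some t)))) //.
rewrite -{1}(wt_pred1 w c) -(prod_option (fun u => wt w (G u))).
rewrite /wt; under eq_bigr do rewrite big_mkcond.
rewrite bigA_distr_bigA /= /M [leRHS]big_mkcond /=; apply: ler_sum => phi _.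
have nn : 0 <= mass w phi by apply: mass_ge0.
case: (boolP [forall u, G u (phi u)]) => [/forallP h|]; last first.
  rewrite negb_forall => /existsP[u /negbTE hu]; rewrite (bigD1 u) //= hu mul0r.
  by case: ifP.
have ec : phi None = c by apply/eqP; exact: (h None).
have hn t : nb E c t (phi (Some t)) := h (Some t).
have -> : valid E phi.
  apply/forallP => u; apply/forallP => v; apply/eqP.
  case: u v => [t|] [t'|]; rewrite ?ec ?irr //.
  - have := ind _ _ (nb_adj (hn t)) (nb_adj (hn t')) => /negbTE ->.
    by case: (t) => i; case: (t') => j.
  - by have := hn t; case: (t) => i /andP[h1 h2] /=; [apply/negbTE|].
  - by have := hn t'; case: (t') => i /andP[h1 h2] /=; [|apply/negbTE].
rewrite ec eqxx /= /mass le_eqVlt; apply/orP; left; apply/eqP.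
by apply: eq_bigr => u _; rewrite h.
Qed.

(** * The weighted bipartite template with a sink *)

Section Template.
Variables (R : realFieldType) (n0 c : nat) (a s : R).
Hypotheses (c_le : (c <= n0.+1)%N) (ha : 0 <= a <= 1) (hs : 0 <= s <= 1).
Local Notation n := n0.+1.

(* [Some (inl i)] is A_i, [Some (inr j)] is B_j and [None] is a sink. The rotation
   i + j in Z/n gives each A_i exactly c in-neighbours among the B_j, and each B_j
   exactly c out-neighbours among the A_i. *)
Definition template_rel : rel (option ('I_n + 'I_n)) := fun x y =>
  match x, y with
  | Some (inr j), Some (inl i) => ((i + j)%R < c)%N
  | Some (inl i), Some (inr j) => (c <= (i + j)%R)%N
  | Some (inl _), None => true
  | _, _ => false
  end.

Definition template_wt (x : option ('I_n + 'I_n)) : R :=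
  match x with
  | Some (inl _) => a / n%:R
  | Some (inr _) => (1 - a) * s / n%:R
  | None => (1 - a) * (1 - s)
  end.

Let nR : n%:R != 0 :> R. Proof. by rewrite pnatr_eq0. Qed.

Lemma template_irreflexive : irreflexive template_rel.
Proof. by case=> [[i|j]|]. Qed.

Lemma template_wt_ge0 x : 0 <= template_wt x.
Proof.
have [a0 a1] := andP ha; have [s0 s1] := andP hs.
case: x => [[i|j]|] /=; rewrite ?divr_ge0 ?mulr_ge0 ?subr_ge0 //.
Qed.

Lemma big_template (P : pred (option ('I_n + 'I_n))) :
  wt template_wt P = (if P None then template_wt None else 0) +
    (\sum_(i | P (Some (inl i))) a / n%:R + \sum_(j | P (Some (inr j))) (1 - a) * s / n%:R).
Proof.
rewrite /wt big_mkcond (bigD1 None) //=; congr (_ + _).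
rewrite (reindex_omap Some id) /=; last by case.
rewrite (eq_bigl predT) => [|x]; last by rewrite eqxx.
by rewrite big_sumType /= -!big_mkcond.
Qed.

Lemma template_wtT : wt template_wt predT = 1.
Proof.
rewrite big_template /= !sumr_const card_ord -![(_ / _) *+ _]mulr_natr !divfK //; ring.
Qed.

Lemma sum_shift_lt (x : 'I_n) (r : R) : \sum_(j : 'I_n | ((x + j)%R < c)%N) r = c%:R * r.
Proof.
rewrite -(reindex_inj (addrI x) (P := fun j : 'I_n => (j < c)%N)) /=.
by rewrite -(big_ord_widen n (fun=> r)) // sumr_const card_ord mulr_natl.
Qed.

Lemma sum_shift_ge (x : 'I_n) (r : R) : \sum_(j : 'I_n | (c <= (x + j)%R)%N) r = (n - c)%:R * r.
Proof.
have := @bigID R 0 +%R 'I_n (index_enum _) (fun j => ((x + j)%R < c)%N) predT (fun=> r).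
rewrite sum_shift_lt sumr_const card_ord -[_ *+ _]mulr_natl /= => h.
under eq_bigl do rewrite leqNgt.
by rewrite natrB // mulrBl h [_ + \sum_(i | _) _]addrC addrK.
Qed.

Lemma template_out_inl i :
  wt template_wt (out template_rel (Some (inl i))) = (1 - a) * (1 - s * (c%:R / n%:R)).
Proof.
rewrite big_template /= big_pred0 // add0r.
rewrite (eq_bigl (fun j => c <= (i + j)%R)%N) => [|j]; last by rewrite /out /= ltnNge negbK andbb.
by rewrite sum_shift_ge natrB //; field; rewrite addrC natr1.
Qed.

Lemma template_inn_inl i :
  wt template_wt (inn template_rel (Some (inl i))) = (1 - a) * (s * (c%:R / n%:R)).
Proof.
rewrite big_template /= big_pred0 // !add0r.
rewrite (eq_bigl (fun j => (i + j)%R < c)%N) => [|j]; last by rewrite /inn /= -ltnNge andbb.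
by rewrite sum_shift_lt; field; rewrite addrC natr1.
Qed.

Lemma template_out_inr j :
  wt template_wt (out template_rel (Some (inr j))) = a * (c%:R / n%:R).
Proof.
rewrite big_template /= [X in _ + (_ + X)]big_pred0 // add0r addr0.
rewrite (eq_bigl (fun i => (j + i)%R < c)%N) => [|i]; last by rewrite /out /= -ltnNge andbb addnC.
by rewrite sum_shift_lt; field; rewrite addrC natr1.
Qed.

Lemma template_inn_inr j :
  wt template_wt (inn template_rel (Some (inr j))) = a * ((n - c)%:R / n%:R).
Proof.
rewrite big_template /= [X in _ + (_ + X)]big_pred0 // add0r addr0.
rewrite (eq_bigl (fun i => c <= (j + i)%R)%N) => [|i]; last by rewrite /inn /= ltnNge negbK andbb addnC.
by rewrite sum_shift_ge; field; rewrite addrC natr1.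
Qed.

(** The neighbours of A_i are B_j's and the sink, those of B_j are A_i's; both sets are independent,
    so [star_center_ge] applies. The nonnegative mass centered at the sink is dropped. *)
Lemma template_mass k l :
  a * (((1 - a) * (1 - s * (c%:R / n%:R))) ^+ k * ((1 - a) * (s * (c%:R / n%:R))) ^+ l) +
  (1 - a) * s * ((a * (c%:R / n%:R)) ^+ k * (a * ((n - c)%:R / n%:R)) ^+ l) <=
  M (k := k) (l := l) template_rel template_wt predT.
Proof.
rewrite (M_part template_rel template_wt (fun phi => phi None)).
have ge := star_center_ge k l template_wt_ge0 template_irreflexive.
rewrite (bigD1 None) //= (reindex_omap Some id) /=; last by case.
rewrite (eq_bigl predT) => [|x]; last by rewrite eqxx.
apply: ler_wpDl; first exact: M_ge0 template_wt_ge0 _.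
rewrite big_sumType /=.
have e (x : R) : x = \sum_(i < n) x / n%:R by rewrite sumr_const card_ord -[(_ / _) *+ _]mulr_natr divfK.
apply: lerD; rewrite [leLHS]e; apply: ler_sum => i _.
- apply: le_trans (ge (Some (inl i)) _); last by case=> [[x|x]|] [[y|y]|].
  by rewrite template_out_inl template_inn_inl mulrAC.
- apply: le_trans (ge (Some (inr i)) _); last by case=> [[x|x]|] [[y|y]|].
  by rewrite template_out_inr template_inn_inr mulrAC.
Qed.

End Template.

Lemma template_approx (R : realType) k l n0 c (a s e : R) : (c <= n0.+1)%N -> 0 <= a <= 1 -> 0 <= s <= 1 -> 0 < e ->
  exists (V : finType) (E : rel V), irreflexive E /\
    a * (((1 - a) * (1 - s * (c%:R / n0.+1%:R))) ^+ k * ((1 - a) * (s * (c%:R / n0.+1%:R))) ^+ l) +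
    (1 - a) * s * ((a * (c%:R / n0.+1%:R)) ^+ k * (a * ((n0.+1 - c)%:R / n0.+1%:R)) ^+ l) - e < s_kl R k l E.
Proof.
move=> cn ha hs e0.
have [V [E [irr h]]] := @blowup_approx R k l _ _ _ e (template_wt_ge0 ha hs)
  (template_wtT n0 a s) (@template_irreflexive n0 c) e0.
exists V, E; split => //; apply: le_lt_trans h; rewrite lerD2r; exact: template_mass.
Qed.

(** * Approaching OPT from below *)

Section Lower.
Variables (R : realType).

Lemma opt_eq_approx k (a e : R) : 0 <= a <= 1 -> 0 < e ->
  exists (V : finType) (E : rel V), irreflexive E /\
    (2 ^+ (2 * k))^-1 * opt_eq (2 * k) a - e < s_kl R k k E.
Proof.
move=> ha e0; have h1 : 0 <= (1 : R) <= 1 by rewrite ler01 lexx.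
(* n = 2, c = 1 and s = 1: the sink has weight 0 and each vertex sends arcs to half of the other
   side and receives arcs from the other half. *)
have [V [E [irr h]]] := @template_approx R k k 1 1 a 1 e isT ha h1 e0.
exists V, E; split => //; move: h; congr (_ - _ < _).
rewrite subSnn div1r mul1r.
have -> : 1 - 2^-1 = 2^-1 :> R by lra.
rewrite mulr1 -!exprD addnn -mul2n /opt_eq !exprMn exprVn; ring.
Qed.

(** With n = k + l - 1 and c = k - 1 each B_j splits the A_i in the ratio (k - 1) : l, and its
    factor s turns the resulting constant into [gam k.-1 l] (1 - d). The value of s gives A_i
    in-neighbours in proportion 1 - d; s <= 1 is the lower bound on d. *)
Lemma opt_gt_approx_large k l (a d e : R) : (0 < l < k)%N -> 0 <= a <= 1 ->
  l%:R / (k + l).-1%:R <= d <= 1 -> 0 < e ->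
  exists (V : finType) (E : rel V), irreflexive E /\ opt_gt k l a d - e < s_kl R k l E.
Proof.
move=> lk ha hd e0.
have [n0 [c [kl kc]]] : exists n0 c, (k + l).-1 = n0.+1 /\ k = c.+1.
  by exists (k + l).-2, k.-1; move: lk; clear; lia.
have cn : (c <= n0.+1)%N by move: kl kc; clear; lia.
have nc : (n0.+1 - c)%N = l by move: kl kc; clear; lia.
have cl : (c + l)%N = n0.+1 by move: kl kc; clear; lia.
have nR : 0 < n0.+1%:R :> R by rewrite ltr0n.
have cR : 0 < c%:R :> R by rewrite ltr0n; move: lk kc; clear; lia.
rewrite kl in hd.
pose s : R := (1 - d) * (n0.+1%:R / c%:R).
have e1 : s * (c%:R / n0.+1%:R) = 1 - d.
  by rewrite /s -mulrA [_ / c%:R * _]mulrA divfK ?mulfV ?mulr1 ?gt_eqF.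
have hs : 0 <= s <= 1.
  have [d0 d1] := andP hd; rewrite mulr_ge0 ?subr_ge0 ?divr_ge0 //=.
  rewrite /s mulrA ler_pdivrMr // mul1r; move: d0; rewrite ler_pdivrMr // => d0.
  by rewrite mulrBl mul1r -{1}cl natrD; lra.
have [V [E [irr h]]] := @template_approx R k l n0 c a s e cn ha hs e0.
exists V, E; split => //; move: h; congr (_ - _ < _).
rewrite e1 nc /opt_gt /gam kc /= cl !exprMn !exprD; set x := 1 - a; set y := 1 - d.
have -> : 1 - y = d by rewrite /y; ring.
rewrite -[X in _ / _ ^+ X]cl exprD /s -/y ![c%:R ^+ c.+1]exprS ![_^-1 ^+ c.+1]exprS !exprVn.
set N : R := n0.+1%:R in nR *; set C : R := c%:R in cR *.
by field; rewrite !expf_neq0 ?gt_eqF // addrC natr1.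
Qed.

(* d^k (1 - d)^l <= gam (k-1) l * d by AM-GM, with equality at d = (k - 1) / (k + l - 1),
   and a (1 - a)^m >= (1 - a) a^m for a <= 1/2. *)
Lemma opt_gt_small k l (a d : R) : (1 < k)%N -> 0 <= a <= 2^-1 ->
  0 <= d <= k.-1%:R / (k + l).-1%:R ->
  opt_gt k l a d <= opt_gt k l a (k.-1%:R / (k + l).-1%:R).
Proof.
case: k => [|[|c]] // _ ha hd; rewrite /opt_gt /= in hd *.
set m := (c.+2 + l)%N; set d1 := c.+1%:R / _ in hd *; set g := gam R c.+1 l.
have d1e : 1 - d1 = l%:R / (c.+1 + l)%:R by exact: one_sub_kml.
have g1 : d1 ^+ c.+1 * (1 - d1) ^+ l = g.
  by rewrite d1e /g /gam !expr_div_n exprD invfM mulrACA.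
have [d10 d11] : 0 <= d1 /\ d1 <= 1 by apply/andP; exact: kml01.
have h : d ^+ c.+1 * (1 - d) ^+ l <= g.
  apply: le_trans (amgm _ _ _ _) _; try lra.
  by rewrite [d + _]addrC subrK expr1n mulr1.
have h2 : (1 - a) * a ^+ m <= a * (1 - a) ^+ m.
  have hp : a ^+ (c.+1 + l) <= (1 - a) ^+ (c.+1 + l) by rewrite lerXn2r ?nnegrE; lra.
  rewrite (_ : m = (c.+1 + l).+1) // (exprS a) (exprS (1 - a)) mulrCA; apply: ler_wpM2l; first lra.
  by apply: ler_wpM2l => //; lra.
have g0 : 0 <= g := gam_ge0 R _ _.
have x0 : 0 <= a * (1 - a) ^+ m by rewrite mulr_ge0 ?exprn_ge0; lra.
rewrite ![_ ^+ c.+2]exprS.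
have e (t : R) : a * (1 - a) ^+ m * (t * t ^+ c.+1) * (1 - t) ^+ l =
  a * (1 - a) ^+ m * t * (t ^+ c.+1 * (1 - t) ^+ l) by ring.
rewrite !e g1.
have h3 : a * (1 - a) ^+ m * d * (d ^+ c.+1 * (1 - d) ^+ l) <= a * (1 - a) ^+ m * d * g.
  by rewrite ler_wpM2l // mulr_ge0 //; lra.
have h4 := ler_wpM2r (_ : 0 <= g * (d1 - d)) h2.
have := h4 (mulr_ge0 g0 _); rewrite subr_ge0 (andP hd).2 => /(_ isT).
lra.
Qed.

(** A small d is raised to (k - 1)/(k + l - 1), which lies in the range of the template because l <=
    k - 1. *)
Lemma opt_gt_approx k l (a d e : R) : (0 < l < k)%N -> 0 <= a <= 2^-1 ->
  0 <= d <= k%:R / (k + l)%:R -> 0 < e ->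
  exists (V : finType) (E : rel V), irreflexive E /\ opt_gt k l a d - e < s_kl R k l E.
Proof.
move=> lk ha hd e0; have ha1 : 0 <= a <= 1 by lra.
have k1 : (1 < k)%N by move: lk; clear; lia.
have kl : k.-1%:R / (k + l).-1%:R = k.-1%:R / (k.-1 + l)%:R :> R.
  by congr (_ / _%:R); move: k1; clear; lia.
have k1' : (0 < k.-1)%N by move: k1; clear; lia.
have hl : (l%:R / (k + l).-1%:R : R) <= k.-1%:R / (k + l).-1%:R.
  by rewrite ler_wpM2r ?invr_ge0 // ler_nat; move: lk; clear; lia.
case: (leP d (k.-1%:R / (k + l).-1%:R)) => hdk.
  have hl1 : l%:R / (k + l).-1%:R <= (k.-1%:R / (k + l).-1%:R : R) <= 1.
    by rewrite hl kl; case/andP: (kml01 R l k1').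
  have [V [E [irr h]]] := opt_gt_approx_large lk ha1 hl1 e0.
  exists V, E; split => //; apply: le_lt_trans h; rewrite lerD2r; apply: opt_gt_small => //.
  by rewrite hdk andbT; case/andP: hd.
apply: opt_gt_approx_large => //; rewrite (le_trans hl (ltW hdk)) /=.
have [_ h2] := andP (kml01 R l (ltnW k1)); apply: le_trans h2.
by case/andP: hd.
Qed.

End Lower.

(* sup_G s_{k,l}(G) = OPT(k,l), stated as: OPT is an upper bound of all
   s_{k,l}(G), and is approached arbitrarily closely. *)
Theorem theorem2p1 (R : realType) (k l : nat) :
  (l <= k)%N -> (1 <= l)%N -> (6 <= k + l)%N ->
  (forall (V : finType) (E : rel V), irreflexive E ->
     s_kl R k l E <= OPT R k l) /\
  (forall eps : R, 0 < eps ->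
     exists (V : finType) (E : rel V),
       irreflexive E /\ OPT R k l - eps < s_kl R k l E).
Proof.
move=> lk l0 m6; split=> [V E _|e e0]; first exact: star_density_le_OPT.
have e2 : 0 < e / 2 by lra.
move: lk; rewrite leq_eqVlt => /orP[/eqP ekl|ltlk].
  subst l; set c : R := (2 ^+ (2 * k))^-1.
  have c0 : 0 < c by rewrite invr_gt0 exprn_gt0.
  have hs : has_sup [set x : R | exists a : R, 0 <= a <= 1 /\ x = opt_eq (2 * k) a]%classic.
    split; first by exists (opt_eq (2 * k) 0), 0; rewrite lexx ler01.
    by exists 2 => _ [b [hb ->]]; exact: opt_eq_ub.
  (* Half of the tolerance goes to the supremum, divided by c because [OPT] multiplies it by c, and
     half to the digraph. *)
  have [_ [a [ha ->]] h] := sup_adherent (divr_gt0 e2 c0) hs.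
  have [V [E [irr h']]] := opt_eq_approx k ha e2.
  exists V, E; split=> //; apply: le_lt_trans h'; rewrite OPT_eqE -/c.
  have := ler_wpM2l (ltW c0) (ltW h); rewrite mulrBr [c * (_ / c)]mulrC divfK ?gt_eqF //; lra.
have hs : has_sup [set x : R | exists a d : R, 0 <= a <= 2^-1 /\ 0 <= d <= k%:R / (k + l)%:R /\
    x = opt_gt k l a d]%classic.
  split; first by exists (opt_gt k l 0 0), 0, 0; rewrite !lexx invr_ge0 ler0n divr_ge0.
  have [_ h1] := andP (kml01 R l (leq_ltn_trans (leq0n _) ltlk)).
  exists (1 + gam R k.-1 l) => _ [b [d [hb [hd ->]]]]; apply: opt_gt_ub; lra.
have [_ [a [d [ha [hd ->]]]] h] := sup_adherent e2 hs.
have lk0 : (0 < l < k)%N by rewrite l0.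
have [V [E [irr h']]] := opt_gt_approx lk0 ha hd e2.
exists V, E; split=> //; apply: le_lt_trans h'; rewrite OPT_gtE //; lra.
Qed.
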